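(* There is a universal constant $C>0$ such that the following holds. Let $N\ge 1$, let $\alpha_1,\dots,\alpha_N\in(0,1)$ be irrational numbers which are rationally independent (that is, $\alpha_1,\dots,\alpha_N$ are linearly independent over $\mathbb{Q}$), and let $f_1,\dots,f_N$ be holomorphic maps, univalent on the unit disk $\mathbb{D}$, with $f_j(0)=0$, $f_j'(0)=e^{2\pi i\alpha_j}$, whose germs at $0$ commute pairwise. If $\mathcal{B}(\alpha_1,\dots,\alpha_N)<+\infty$, then $f_1,\dots,f_N$ are simultaneously linearizable, and their common Siegel disk contains the disk $\{|z|<C e^{-2\pi\mathcal{B}(\alpha_1,\dots,\alpha_N)}\}$.
   Context: Univalent means holomorphic and injective. The number $\alpha_j$ is the rotation number of $f_j$. Germs $f_1,\dots,f_N$ at $0$ with $f_j(0)=0$, $f_j'(0)=e^{2\pi i\alpha_j}$ are simultaneously linearizable if there is a germ of holomorphic diffeomorphism $h$ fixing $0$ such that $h\circ f_j\circ h^{-1}=R_{\alpha_j}$ for all $j$, where $R_{\alpha}(z)=e^{2\pi i\alpha}z$. The common Siegel disk is the maximal domain of linearization, i.e. the largest domain $U\ni 0$, contained in the domain $\mathbb{D}$ of the maps and satisfying $f_j(U)=U$ for all $j$, for which there is a biholomorphism $h$ from $U$ onto a disk centered at $0$ with $h(0)=0$ and $h\circ f_j=R_{\alpha_j}\circ h$ on $U$ for all $j$. Gauss maps. For irrationals $\alpha_1,\dots,\alpha_N\in(0,1)$ linearly independent over $\mathbb{Q}$ and $w\in\{1,\dots,N\}$, put $\hat\alpha_i=\alpha_i$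 for $i\ne w$ and $\hat\alpha_w=1$. Let $a_i$ be the integer with $|a_i\alpha_w-\hat\alpha_i|=\min_{k\in\mathbb{Z}}|k\alpha_w-\hat\alpha_i|<\tfrac12\alpha_w$, and let $\tilde\alpha_i=|a_i\alpha_w-\hat\alpha_i|/\alpha_w\in(0,1/2)$. Define $G(\alpha_1,\dots,\alpha_N,w)=(\tilde\alpha_1,\dots,\tilde\alpha_N)$. Brjuno-type function. For an infinite word $\overline w=(w(n))_{n\ge0}\in\{1,\dots,N\}^{\mathbb{N}}$ let $\alpha_i^{(0)}=\alpha_i$ and $(\alpha_1^{(n+1)},\dots,\alpha_N^{(n+1)})=G(\alpha_1^{(n)},\dots,\alpha_N^{(n)},w(n))$ for $n\ge0$. Define $$\mathcal{B}(\alpha_1,\dots,\alpha_N,\overline w)=\sum_{n=0}^\infty \alpha^{(0)}_{w(0)}\cdots\alpha^{(n-1)}_{w(n-1)}\log\frac{1}{\alpha^{(n)}_{w(n)}},$$ where the empty product (for $n=0$) equals $1$, and $$\mathcal{B}(\alpha_1,\dots,\alpha_N)=\inf_{\overline w\in\{1,\dots,N\}^{\mathbb{N}}}\mathcal{B}(\alpha_1,\dots,\alpha_N,\overline w).$$ *)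

(* Defs.v *)
From mathcomp Require Import all_boot all_order all_algebra.
From mathcomp Require Import all_classical all_reals all_analysis.
From mathcomp.real_closed Require Import complex.
Set Implicit Arguments.
Unset Strict Implicit.
Unset Printing Implicit Defensive.
Import Order.TTheory GRing.Theory Num.Theory.
Import numFieldNormedType.Exports.
Local Open Scope classical_set_scope.
Local Open Scope complex_scope.
Local Open Scope ring_scope.

(* [R[i]^o] carries the topology of the modulus, and scalars are complex, so
   [derivable f z 1] is complex differentiability of [f] at [z]. *)
Notation cplx R := (R[i]^o).

Section Holomorphic.
Variable R : realType.
Local Notation C := (cplx R).
Implicit Types (f g h : C -> C) (U V A : set C) (r a : R).

Definition disk r : set C := [set z | `|z| < r%:C].

Definition holomorphic_on A f := forall z, A z -> derivable f z 1.

Definition univalent_on A f := holomorphic_on A f /\ {in A &, injective f}.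

(* e^{2 pi i a} *)
Definition expi2pi a : C := cos (2 * pi * a) +i* sin (2 * pi * a).

Definition rotation a : C -> C := fun z => expi2pi a * z.

Definition biholomorphism U V h :=
  [/\ holomorphic_on U h, h @` U = V
    & exists g, holomorphic_on V g /\ forall z, U z -> g (h z) = z].

(* [h] represents a germ of holomorphic diffeomorphism fixing 0, and [g] its
   inverse germ. *)
Definition diffeo_germ h g :=
  [/\ h 0 = 0, g 0 = 0,
      \forall z \near (0 : C), derivable h z 1 /\ derivable g z 1
    & \forall z \near (0 : C), g (h z) = z /\ h (g z) = z].

End Holomorphic.

Section Linearization.
Variables (R : realType) (N : nat).
Local Notation C := (cplx R).
Implicit Types (f : 'I_N -> C -> C) (alpha : 'I_N -> R) (U : set C).

Definition simultaneously_linearizable f alpha :=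
  exists h g : C -> C, diffeo_germ h g /\
    forall j, \forall z \near (0 : C), h (f j (g z)) = rotation (alpha j) z.

Definition linearization_domain f alpha U :=
  [/\ open U, connected U, U (0 : C), U `<=` disk (1 : R)
    & (forall j, f j @` U = U) /\
      exists h (r : R), [/\ 0 < r, biholomorphism U (disk r) h, h 0 = 0
        & forall j z, U z -> h (f j z) = rotation (alpha j) (h z)]].

Definition is_common_siegel_disk f alpha U :=
  linearization_domain f alpha U /\
  forall V, linearization_domain f alpha V -> V `<=` U.

End Linearization.

Section Brjuno.
Variables (R : realType) (N : nat).
Implicit Types (alpha : 'I_N -> R) (w : 'I_N) (word : nat -> 'I_N).

Definition rationally_independent alpha :=
  forall c : 'I_N -> rat,
    \sum_(i < N) ratr (c i) * alpha i = 0 -> forall i, c i = 0.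

Definition alpha_hat alpha w : 'I_N -> R :=
  fun i => if i == w then 1 else alpha i.

(* An integer [a] minimizing [`|a * alpha w - alpha_hat alpha w i|]. *)
Definition gauss_coef alpha w (i : 'I_N) : int :=
  xget 0 [set a : int | forall k : int,
    `|a%:~R * alpha w - alpha_hat alpha w i|
      <= `|k%:~R * alpha w - alpha_hat alpha w i|].

Definition gauss alpha w : 'I_N -> R := fun i =>
  `|(gauss_coef alpha w i)%:~R * alpha w - alpha_hat alpha w i| / alpha w.

Fixpoint gauss_orbit alpha word n : 'I_N -> R :=
  if n is m.+1 then gauss (gauss_orbit alpha word m) (word m) else alpha.

(* The numbers [alpha i] need not be independent from 1, so the orbit may
   reach 0. The logarithm and the inverse are those of [\bar R], for which
   [log (1 / 0) = +oo]: the sum is [+oo] as soon as the word selects a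
   vanishing number, whatever the later values of the orbit are. *)
Definition brjuno_word alpha word : \bar R :=
  (\sum_(0 <= n <oo)
    (\prod_(k < n) gauss_orbit alpha word k (word k))%:E
      * lne ((gauss_orbit alpha word n (word n))%:E^-1))%E.

Definition brjuno alpha : \bar R :=
  ereal_inf [set brjuno_word alpha word | word in [set: nat -> 'I_N]].

End Brjuno.

(* Main.v *)
(* The linearization is constructed by the method of majorants. Write
   g(z) = z + sum b_m z^m for the inverse of the common linearizing map; comparing
   coefficients in f_j (g z) = g (lam_j z) gives (lam_j^m - lam_j) b_m as a
   polynomial in the previous b_k, and since the f_j commute, b_m does not depend
   on j, so that the j with the largest divisor may be used for each m separately.

   If all m alpha_j are close to integers p_j, the Gauss maps along a word
   transform (m, p_1, ..., p_N) into other integers, not all zero, whose errors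
   are multiplied by at most 3 / alpha_w at each step. Hence
   max_j ||m alpha_j|| >= u_n 3^-n / 2 as long as m u_n <= 1/2, where
   u_n = alpha^(0)_w(0) ... alpha^(n-1)_w(n-1). So the orders m at which all
   divisors are small are sparse at every scale 1 / u_n, and Davie's counting
   functions, summed over the scales, bound every product of inverse divisors
   entering b_(m+1) by exp (m (4 B + const)). As 4 <= 2 pi, this is enough for the
   radius of convergence.

   The Taylor coefficients of the f_j are bounded uniformly: omitting a value w0
   makes log (1 - f / w0) a map whose image contains no large disk, and Bloch's
   theorem bounds it. Finally, two linearizations differ by a map commuting
   with an irrational rotation, which is linear near 0; thus linearization domains
   are nested, and their union is the common Siegel disk. *)
Require Import Defs.
From mathcomp Require Import all_boot all_order all_algebra.
From mathcomp Require Import all_classical all_reals all_analysis.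
From mathcomp.real_closed Require Import complex.
From mathcomp Require Import ring lra zify.
Import Order.TTheory GRing.Theory Num.Theory.
Import numFieldNormedType.Exports.
Import ComplexField.Normc.
Local Open Scope classical_set_scope.
Local Open Scope ring_scope.

Set Implicit Arguments.
Unset Strict Implicit.
Unset Printing Implicit Defensive.

(** * Complex derivatives *)

(** The divisors are good only for an index [j] that varies with the order, so no single map
    controls the series. What is bounded instead is a superadditive potential [Psi] with
    [Psi m <= m * K], which grows from [m] to [m + 1] by at least the logarithm of some inverse
    divisor of that order. Superadditivity lets [expR (Psi m)] pass through products of power
    series: once the coefficients are divided by it, the recursion is free of divisors and a
    geometric majorant remains. Only [- ln] of the number selected at each scale is charged to the
    Brjuno sum. The other costs of a scale grow like [n - ln u_n] and are weighted by [u_n]; since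
    the Gauss maps return numbers at most [1 / 2], [u_n] decays geometrically and these costs add up
    to a universal constant. So the factors 3 of the Gauss steps, and the slack 1 left by a word
    that almost realises the infimum, end up in [C]. Linearization domains are compared through the
    inverses of their linearizing maps: these all live on disks centred at 0, whereas the domains
    have no common shape. *)

Section ComplexBasics.
Variable R : realType.
Local Notation C := (R[i]).
Local Notation nm := (@normc R).
Implicit Types (x y z w : C) (f g : C -> C) (e : R).

Lemma nm_ge0 z : 0 <= nm z.
Proof. by case: z => a b /=; rewrite sqrtr_ge0. Qed.

Lemma nmD x y : nm (x + y) <= nm x + nm y.
Proof. exact: le_normcD. Qed.

Lemma nmN x : nm (- x) = nm x.
Proof. exact: normcN. Qed.

Lemma nmM x y : nm (x * y) = nm x * nm y.
Proof. exact: normcM. Qed.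

Lemma nmV x : nm x^-1 = (nm x)^-1.
Proof. exact: normcV. Qed.

Lemma nm0 : nm 0 = 0.
Proof. exact: normc0. Qed.

Lemma nm1 : nm 1 = 1.
Proof. exact: normc1. Qed.

Lemma nmX x n : nm (x ^+ n) = nm x ^+ n.
Proof. by elim: n => [|n IH]; rewrite ?expr0 ?nm1 // !exprS nmM IH. Qed.

Lemma nm_eq0 x : (nm x == 0) = (x == 0).
Proof.
apply/eqP/eqP => [|->]; last exact: nm0.
exact: eq0_normc.
Qed.

Lemma nm_gt0 x : (0 < nm x) = (x != 0).
Proof. by rewrite lt_neqAle nm_ge0 andbT eq_sym nm_eq0. Qed.

Lemma nmB x y : nm (x - y) <= nm x + nm y.
Proof. by rewrite -(nmN y); exact: nmD. Qed.

Lemma nmBC x y : nm (x - y) = nm (y - x).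
Proof. by rewrite -nmN opprB. Qed.

Lemma nm_triangle z x y : nm (x - y) <= nm (x - z) + nm (z - y).
Proof. have -> : x - y = (x - z) + (z - y) by ring. exact: nmD. Qed.

Lemma nm_sub_le x y : nm x - nm y <= nm (x - y).
Proof.
rewrite lerBlDr; have {1}-> : x = (x - y) + y by ring.
exact: nmD.
Qed.

Lemma nmR (a : R) : nm a%:C%C = `|a|.
Proof. by rewrite /= expr0n /= addr0 sqrtr_sqr. Qed.

Lemma nmI (a b : R) : nm (a +i* b)%C = Num.sqrt (a ^+ 2 + b ^+ 2).
Proof. by []. Qed.

Lemma nm_sqr z : nm z ^+ 2 = complex.Re z ^+ 2 + complex.Im z ^+ 2.
Proof.
by case: z => a b /=; rewrite sqr_sqrtr // addr_ge0 // sqr_ge0.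
Qed.

Lemma Re_le_nm z : `|complex.Re z| <= nm z.
Proof.
rewrite -(ler_pXn2r (n := 2)) ?nnegrE ?nm_ge0 //.
by rewrite nm_sqr real_normK ?num_real // lerDl sqr_ge0.
Qed.

Lemma Im_le_nm z : `|complex.Im z| <= nm z.
Proof.
rewrite -(ler_pXn2r (n := 2)) ?nnegrE ?nm_ge0 //.
by rewrite nm_sqr real_normK ?num_real // lerDr sqr_ge0.
Qed.

Lemma nm_le_ReIm z : nm z <= `|complex.Re z| + `|complex.Im z|.
Proof.
rewrite -(ler_pXn2r (n := 2)) ?nnegrE ?nm_ge0 ?addr_ge0 //.
rewrite nm_sqr sqrrD !real_normK ?num_real //.
have := mulr_ge0 (normr_ge0 (complex.Re z)) (normr_ge0 (complex.Im z)); lra.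
Qed.

Lemma nm_sum (I : Type) (r : seq I) (P : pred I) (F : I -> C) :
  nm (\sum_(i <- r | P i) F i) <= \sum_(i <- r | P i) nm (F i).
Proof.
elim/big_ind2 : _ => [|x a y b xa yb|//]; first by rewrite nm0.
exact: le_trans (nmD _ _) (lerD xa yb).
Qed.

Lemma nm_norm z : `|z| = (nm z)%:C%C.
Proof. by rewrite normc_def; case: z. Qed.

(** Differentiability in Weierstrass form: without a quotient the point [w = z] needs no exclusion,
    and all estimates are between real numbers. [derivable_cdiffP] is the bridge to [derivable]. *)
Definition cdiff f z (d : C) := forall e, 0 < e -> exists2 dl : R, 0 < dl &
  forall w, nm (w - z) < dl -> nm (f w - f z - d * (w - z)) <= e * nm (w - z).

Definition ccont f z := forall e, 0 < e -> exists2 dl : R, 0 < dl &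
  forall w, nm (w - z) < dl -> nm (f w - f z) < e.

Lemma cdiff_lip f z d : cdiff f z d -> exists2 dl : R, 0 < dl &
  forall w, nm (w - z) < dl -> nm (f w - f z) <= (nm d + 1) * nm (w - z).
Proof.
move=> /(_ 1 ltr01)[dl dl0 H]; exists dl => // w /H {}H.
have -> : f w - f z = (f w - f z - d * (w - z)) + d * (w - z) by ring.
by apply: le_trans (nmD _ _) _; rewrite nmM mulrDl mul1r; move: H; lra.
Qed.

Lemma cdiff_cont f z d : cdiff f z d -> ccont f z.
Proof.
move=> /cdiff_lip[dl dl0 H] e e0.
have K0 : 0 < nm d + 1 by have := nm_ge0 d; lra.
exists (Num.min dl (e / (nm d + 1))); first by rewrite lt_min dl0 divr_gt0.
move=> w; rewrite lt_min => /andP[/H {}H wz].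
apply: le_lt_trans H _; rewrite mulrC -ltr_pdivlMr //.
Qed.

Lemma cdiff_near f g z d dl : 0 < dl -> (forall w, nm (w - z) < dl -> g w = f w) ->
  cdiff f z d -> cdiff g z d.
Proof.
move=> dl0 fg H e /H[dl' dl'0 {}H]; exists (Num.min dl dl').
  by rewrite lt_min dl0.
move=> w; rewrite lt_min => /andP[wz wz'].
by rewrite !fg ?subrr ?nm0 //; apply: H.
Qed.

Lemma cdiff_ext f g z d : (forall w, g w = f w) -> cdiff f z d -> cdiff g z d.
Proof. by move=> fg; apply: (@cdiff_near _ _ _ _ 1) => // w _; exact: fg. Qed.

Lemma cdiff_eqd f z d d' : d' = d -> cdiff f z d -> cdiff f z d'.
Proof. by move=> ->. Qed.

Lemma cdiff_cst (c : C) z : cdiff (fun=> c) z 0.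
Proof.
move=> e e0; exists 1 => // w _.
by rewrite subrr mul0r subrr nm0 mulr_ge0 ?nm_ge0 // ltW.
Qed.

Lemma cdiff_id z : cdiff id z 1.
Proof.
move=> e e0; exists 1 => // w _.
by rewrite mul1r subrr nm0 mulr_ge0 ?nm_ge0 // ltW.
Qed.

Lemma cdiffD f g z df dg : cdiff f z df -> cdiff g z dg ->
  cdiff (fun w => f w + g w) z (df + dg).
Proof.
move=> Hf Hg e e0; have e20 : 0 < e / 2 by lra.
have [d1 d10 H1] := Hf _ e20; have [d2 d20 H2] := Hg _ e20.
exists (Num.min d1 d2); first by rewrite lt_min d10.
move=> w; rewrite lt_min => /andP[/H1 {}H1 /H2 {}H2].
have -> : f w + g w - (f z + g z) - (df + dg) * (w - z) =
  (f w - f z - df * (w - z)) + (g w - g z - dg * (w - z)) by ring.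
by apply: le_trans (nmD _ _) _; lra.
Qed.

Lemma ccont_bound f z : ccont f z -> exists2 dl : R, 0 < dl &
  forall w, nm (w - z) < dl -> nm (f w) <= nm (f z) + 1.
Proof.
move=> /(_ 1 ltr01)[dl dl0 H]; exists dl => // w /H {}H.
by have := nm_sub_le (f w) (f z); lra.
Qed.

Lemma cdiffM f g z df dg : cdiff f z df -> cdiff g z dg ->
  cdiff (fun w => f w * g w) z (df * g z + f z * dg).
Proof.
move=> Hf Hg e e0.
have [d1 d10 H1] := ccont_bound (cdiff_cont Hg).
pose K := nm (g z) + 1; pose L := nm (f z) + 1; pose M := nm df + 1.
have K0 : 0 < K by have := nm_ge0 (g z); rewrite /K; lra.
have L0 : 0 < L by have := nm_ge0 (f z); rewrite /L; lra.
have M0 : 0 < M by have := nm_ge0 df; rewrite /M; lra.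
have [|d2 d20 H2] := Hf (e / 3 / K); first by rewrite !divr_gt0.
have [|d3 d30 H3] := Hg (e / 3 / L); first by rewrite !divr_gt0.
have [|d4 d40 H4] := cdiff_cont Hg (e := e / 3 / M); first by rewrite !divr_gt0.
exists (Num.min (Num.min d1 d2) (Num.min d3 d4)).
  by rewrite !lt_min d10 d20 d30.
move=> w; rewrite !lt_min.
move=> /andP[/andP[/H1 {}H1 /H2 {}H2] /andP[/H3 {}H3 /H4 {}H4]].
have -> : f w * g w - f z * g z - (df * g z + f z * dg) * (w - z) =
  (f w - f z - df * (w - z)) * g w + f z * (g w - g z - dg * (w - z))
  + df * (w - z) * (g w - g z) by ring.
set h := nm (w - z) in H2 H3 *; have h0 : 0 <= h by exact: nm_ge0.
have A1 : nm ((f w - f z - df * (w - z)) * g w) <= e / 3 * h.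
  rewrite nmM; apply: le_trans (_ : (e / 3 / K * h) * K <= _).
    by apply: ler_pM; rewrite ?nm_ge0.
  by rewrite mulrAC divfK // gt_eqF.
have A2 : nm (f z * (g w - g z - dg * (w - z))) <= e / 3 * h.
  rewrite nmM mulrC; apply: le_trans (_ : (e / 3 / L * h) * L <= _).
    by apply: ler_pM; rewrite ?nm_ge0 // /L; lra.
  by rewrite mulrAC divfK // gt_eqF.
have A3 : nm (df * (w - z) * (g w - g z)) <= e / 3 * h.
  rewrite !nmM -/h mulrAC; apply: ler_wpM2r => //; rewrite mulrC.
  apply: le_trans (_ : (e / 3 / M) * M <= _).
    by apply: ler_pM; rewrite ?nm_ge0 // ?ltW // /M; lra.
  by rewrite divfK // gt_eqF.
apply: le_trans (nmD _ _) _.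
have := nmD ((f w - f z - df * (w - z)) * g w) (f z * (g w - g z - dg * (w - z))).
lra.
Qed.

Lemma cdiffZ (c : C) f z df : cdiff f z df -> cdiff (fun w => c * f w) z (c * df).
Proof.
move=> H; apply: cdiff_eqd (cdiffM (cdiff_cst c z) H).
by rewrite mul0r add0r.
Qed.

Lemma cdiffN f z df : cdiff f z df -> cdiff (fun w => - f w) z (- df).
Proof.
move=> H; apply: cdiff_ext (cdiff_eqd _ (cdiffZ (-1) H)) => [w|]; ring.
Qed.

Lemma cdiffB f g z df dg : cdiff f z df -> cdiff g z dg ->
  cdiff (fun w => f w - g w) z (df - dg).
Proof. by move=> Hf Hg; exact: cdiffD Hf (cdiffN Hg). Qed.

Lemma cdiff_comp f g z df dg : cdiff g z dg -> cdiff f (g z) df ->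
  cdiff (fun w => f (g w)) z (df * dg).
Proof.
move=> Hg Hf e e0.
have [d1 d10 H1] := cdiff_lip Hg.
pose K := nm dg + 1; pose L := nm df + 1.
have K0 : 0 < K by have := nm_ge0 dg; rewrite /K; lra.
have L0 : 0 < L by have := nm_ge0 df; rewrite /L; lra.
have [|d2 d20 H2] := Hf (e / 2 / K); first by rewrite !divr_gt0.
have [|d3 d30 H3] := Hg (e / 2 / L); first by rewrite !divr_gt0.
exists (Num.min (Num.min d1 (d2 / K)) d3).
  by rewrite !lt_min d10 d30 divr_gt0.
move=> w; rewrite !lt_min => /andP[/andP[/H1 {}H1 wd2] /H3 {}H3].
set h := nm (w - z) in H1 H3 wd2 *; have h0 : 0 <= h by exact: nm_ge0.
have -> : f (g w) - f (g z) - df * dg * (w - z) =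
  (f (g w) - f (g z) - df * (g w - g z)) + df * (g w - g z - dg * (w - z)) by ring.
have {}H2 : nm (f (g w) - f (g z) - df * (g w - g z)) <= e / 2 * h.
  apply: le_trans (H2 _ _) _.
    by apply: le_lt_trans H1 _; rewrite mulrC -ltr_pdivlMr.
  rewrite -(mulrA (e / 2)) ler_pM2l ?divr_gt0 //.
  by rewrite mulrC ler_pdivrMr // mulrC.
have {}H3 : nm (df * (g w - g z - dg * (w - z))) <= e / 2 * h.
  rewrite nmM mulrC; apply: le_trans (_ : (e / 2 / L * h) * L <= _).
    by apply: ler_pM; rewrite ?nm_ge0 // /L; lra.
  by rewrite mulrAC divfK // gt_eqF.
by apply: le_trans (nmD _ _) _; lra.
Qed.

Lemma cdiff_inv z : z != 0 -> cdiff (fun w => w^-1) z (- z^-1 ^+ 2).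
Proof.
move=> z0 e e0; have nz : 0 < nm z by rewrite nm_gt0.
exists (Num.min (nm z / 2) (e * nm z ^+ 3 / 2)).
  by rewrite lt_min !divr_gt0 // mulr_gt0 // exprn_gt0.
move=> w; rewrite lt_min => /andP[w1 w2].
have nw : nm z / 2 < nm w.
  by have := nm_sub_le z w; rewrite (nmBC z w); lra.
have nw0 : 0 < nm w by lra.
have w0 : w != 0 by rewrite -nm_gt0.
have -> : w^-1 - z^-1 - - z^-1 ^+ 2 * (w - z) = (w - z) * ((w - z) / (z ^+ 2 * w)).
  by field; rewrite z0 w0.
rewrite nmM mulrC ler_wpM2r ?nm_ge0 //.
rewrite nmM nmV nmM nmX ler_pdivrMr ?mulr_gt0 ?exprn_gt0 //.
apply: (le_trans (ltW w2)); rewrite -!mulrA ler_pM2l //.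
by rewrite !ler_pM2l // ltW.
Qed.

Lemma cdiff_compV f z df : f z != 0 -> cdiff f z df ->
  cdiff (fun w => (f w)^-1) z (- (f z)^-1 ^+ 2 * df).
Proof. by move=> f0 H; exact: (cdiff_comp H (cdiff_inv f0)). Qed.

Lemma cdiffX z n : cdiff (fun w => w ^+ n) z (n%:R * z ^+ n.-1).
Proof.
elim: n => [|n IH]; first by rewrite mul0r; exact: cdiff_cst.
apply: cdiff_ext (cdiff_eqd _ (cdiffM (cdiff_id z) IH)) => [w|].
  by rewrite exprS.
rewrite /= mul1r -[n.+1]addn1 natrD mulrDl mul1r addrC.
congr (_ + _); case: n {IH} => [|n]; first by rewrite !mul0r mulr0.
by rewrite exprS /=; ring.
Qed.

Lemma cdiff_unique f z d d' : cdiff f z d -> cdiff f z d' -> d = d'.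
Proof.
move=> H H'; apply/eqP; rewrite -subr_eq0 -nm_eq0; apply/negPn/negP => N.
have N0 : 0 < nm (d - d') by rewrite lt_neqAle eq_sym N nm_ge0.
have [|d1 d10 H1] := H (nm (d - d') / 3); first by lra.
have [|d2 d20 H2] := H' (nm (d - d') / 3); first by lra.
pose t := Num.min d1 d2 / 2.
have m0 : 0 < Num.min d1 d2 by rewrite lt_min d10.
have t0 : 0 < t by rewrite /t; lra.
have nt : nm (z + t%:C%C - z) = t by rewrite addrAC subrr add0r nmR gtr0_norm.
have t1 : t < d1.
  by apply: lt_le_trans (_ : Num.min d1 d2 <= _); rewrite ?ge_min ?lexx // /t; lra.
have t2 : t < d2.
  by apply: lt_le_trans (_ : Num.min d1 d2 <= _); rewrite ?ge_min ?lexx ?orbT // /t; lra.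
have := H1 (z + t%:C%C); have := H2 (z + t%:C%C); rewrite nt => /(_ t2) A /(_ t1) B.
have : nm ((d - d') * t%:C%C) <= 2 * (nm (d - d') / 3) * t.
  have -> : (d - d') * t%:C%C = (f (z + t%:C%C) - f z - d' * (z + t%:C%C - z)) -
     (f (z + t%:C%C) - f z - d * (z + t%:C%C - z)) by ring.
  by apply: le_trans (nmB _ _) _; lra.
by rewrite nmM nmR gtr0_norm // ler_pM2r //; lra.
Qed.

End ComplexBasics.

(** * Calculus of one real variable *)

Section RealCalculus.
Variable R : realType.
Implicit Types (phi psi : R -> R) (a b x y e : R).

Definition rdiff phi x d := forall e, 0 < e -> exists2 dl : R, 0 < dl &
  forall y, `|y - x| < dl -> `|phi y - phi x - d * (y - x)| <= e * `|y - x|.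

Lemma is_derive_rdiff phi x d : is_derive x 1 phi d -> rdiff phi x d.
Proof.
move=> [D E] e e0.
have cv : (fun h : R => h^-1 *: ((phi \o shift x) (h *: 1) - phi x)) @ 0^' --> d.
  by rewrite -E; exact: D.
have /cvgrPdist_le/(_ _ e0) := cv.
rewrite /dnbhs /within /prop_near1 /nbhs /= => /nbhs_ballP[dl /= dl0 H].
exists dl => // y yx.
have [->|yx0] := eqVneq y x; first by rewrite !subrr mulr0 subrr normr0 mulr0.
have yx1 : y - x != 0 by rewrite subr_eq0.
have := H (y - x); rewrite /ball /= sub0r normrN => /(_ yx yx1) A.
have -> : phi y - phi x - d * (y - x) = - (d - (y - x)^-1 * (phi y - phi x)) * (y - x).
  by field.
rewrite normrM normrN ler_wpM2r //.
by move: A; rewrite /shift /= /GRing.scale /= mulr1 subrK.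
Qed.

Lemma rdiff_is_derive phi x d : rdiff phi x d -> is_derive x 1 phi d.
Proof.
move=> H.
have cv : (fun h : R => h^-1 *: ((phi \o shift x) (h *: 1) - phi x)) @ 0^' --> d.
  apply/cvgrPdist_le => e e0; have [dl dl0 {}H] := H e e0.
  rewrite /dnbhs /within /prop_near1 /nbhs /=; apply/nbhs_ballP.
  exists dl => //= h; rewrite /ball /= sub0r normrN => hd h0.
  have h0' : 0 < `|h| by rewrite normr_gt0.
  rewrite /shift /= /GRing.scale /= mulr1.
  have := H (h + x); rewrite addrK => /(_ hd) A.
  rewrite -(ler_pM2r h0') -normrM.
  have -> : (d - h^-1 * (phi (h + x) - phi x)) * h = - (phi (h + x) - phi x - d * h).
    by field.
  by rewrite normrN.
by split; [apply/cvg_ex; exists d | exact/cvg_lim].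
Qed.

Lemma rdiff_eqd phi x d d' : d' = d -> rdiff phi x d -> rdiff phi x d'.
Proof. by move=> ->. Qed.

Lemma rdiffB phi psi x d d' : rdiff phi x d -> rdiff psi x d' ->
  rdiff (fun y => phi y - psi y) x (d - d').
Proof.
move=> /rdiff_is_derive Hf /rdiff_is_derive Hg; exact: (is_derive_rdiff (is_deriveB Hf Hg)).
Qed.

Lemma rdiffM phi psi x d d' : rdiff phi x d -> rdiff psi x d' ->
  rdiff (fun y => phi y * psi y) x (d * psi x + phi x * d').
Proof.
move=> /rdiff_is_derive Hf /rdiff_is_derive Hg.
apply: (rdiff_eqd (d := phi x *: d' + psi x *: d)); last exact: (is_derive_rdiff (is_deriveM Hf Hg)).
by rewrite /GRing.scale /= addrC (mulrC d).
Qed.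

Lemma rdiff_cst (c x : R) : rdiff (fun=> c) x 0.
Proof. exact: (is_derive_rdiff (is_derive_cst _ _ _)). Qed.

Lemma rdiff_id x : rdiff id x 1.
Proof. exact: (is_derive_rdiff (is_derive_id _ _)). Qed.

Definition rcont phi x := forall e, 0 < e -> exists2 dl : R, 0 < dl &
  forall y, `|y - x| < dl -> `|phi y - phi x| < e.

Lemma rcont_continuous phi x : rcont phi x -> {for x, continuous phi}.
Proof.
move=> H; apply/cvgrPdist_lt => e e0; have [dl dl0 {}H] := H e e0.
apply/nbhs_ballP; exists dl => //= y; rewrite /ball /= => yx.
by rewrite distrC; apply: H; rewrite distrC.
Qed.

Lemma rdiff_cont phi x d : rdiff phi x d -> rcont phi x.
Proof.
move=> H e e0; have [dl dl0 {}H] := H 1 ltr01.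
have K0 : 0 < `|d| + 1 by have := normr_ge0 d; lra.
exists (Num.min dl (e / (`|d| + 1))); first by rewrite lt_min dl0 divr_gt0.
move=> y; rewrite lt_min => /andP[/H {}H yx].
have -> : phi y - phi x = (phi y - phi x - d * (y - x)) + d * (y - x) by ring.
apply: le_lt_trans (ler_normD _ _) _; rewrite normrM.
have : (`|d| + 1) * `|y - x| < e by rewrite mulrC -ltr_pdivlMr.
by move: H; lra.
Qed.

Lemma rdiff_bound phi dphi a b (K : R) : a <= b ->
  (forall x, a <= x <= b -> rdiff phi x (dphi x)) ->
  (forall x, a <= x <= b -> `|dphi x| <= K) -> `|phi b - phi a| <= K * (b - a).
Proof.
rewrite le_eqVlt => /orP[/eqP -> _ _|ab D B]; first by rewrite !subrr normr0 mulr0.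
have [||c] := @MVT R phi dphi a b ab.
- move=> x /[!in_itv]/= /andP[ax xb]; apply: rdiff_is_derive; apply: D.
  by rewrite !ltW.
- apply: continuous_in_subspaceT => x; rewrite inE /= in_itv /= => xab.
  exact/rcont_continuous/rdiff_cont/D.
rewrite in_itv /= => /andP[ac cb] ->.
have ba : 0 <= b - a by rewrite subr_ge0 ltW.
rewrite normrM (ger0_norm ba).
by apply: ler_wpM2r => //; [apply: B; rewrite (ltW ac) ltW].
Qed.

(** The fundamental theorem of calculus is used with a finite left end: [F n] integrates from [- n]
    and is a primitive to its right. Two of them differ by a constant where both are primitives, so
    subtracting the value at 0 glues them. *)
Lemma exists_primitive phi : (forall x, rcont phi x) ->
  exists Phi, forall x, rdiff Phi x (phi x).
Proof.
move=> cphi.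
have cphi' : continuous phi by move=> x; exact: rcont_continuous.
have itg a b : lebesgue_measure.-integrable `[a, b] (EFin \o phi).
  apply: continuous_compact_integrable; first exact: segment_compact.
  by apply: continuous_subspaceT.
pose F (n : nat) x := (\int[lebesgue_measure]_(t in `[- n%:R, x]) phi t)%R.
have dF n x : - n%:R < x -> rdiff (F n) x (phi x).
  move=> nx.
  have [||D E] := @continuous_FTC1 R phi (BLeft (- n%:R)) x (x + 1) _ (itg _ _) _ (cphi' x).
  - by rewrite ltrDl.
  - by rewrite /= lte_fin.
  rewrite derive1E in E; exact: (is_derive_rdiff (DeriveDef D E)).
have FE n m x : - n%:R < x -> - n%:R < 0 :> R -> - m%:R < x -> - m%:R < 0 :> R ->
    F n x - F n 0 = F m x - F m 0.
  move=> nx n0 mx m0.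
  have key a b : - n%:R < a -> - m%:R < a -> a <= b ->
      `|(F n b - F m b) - (F n a - F m a)| <= 0 * (b - a).
    move=> na ma ab; apply: (@rdiff_bound (fun x => F n x - F m x) (fun=> 0)) => //.
    - move=> y /andP[ay yb]; apply: rdiff_eqd (rdiffB (dF _ _ _) (dF _ _ _)).
      + by rewrite subrr.
      + exact: lt_le_trans na ay.
      + exact: lt_le_trans ma ay.
    - by move=> y _; rewrite normr0.
  have [x0|x0] := leP 0 x.
    have := key 0 x n0 m0 x0; rewrite mul0r normr_le0 subr_eq0 => /eqP; lra.
  have := key x 0 nx mx (ltW x0); rewrite mul0r normr_le0 subr_eq0 => /eqP; lra.
(* With [.+2] the end [- N x] lies more than 1 to the left of [x], so a single [F (N x)] serves on
   the whole unit ball around [x]. *)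
pose N x : nat := (Num.truncn `|x|).+2.
have Nx x y : `|y - x| < 1 -> - (N x)%:R < y.
  move=> yx; have : `|x| + 1 < (N x)%:R.
    rewrite /N -[(_.+2)%:R]natr1 ltrD2r; exact: truncnS_gt.
  have := ler_norm (- y); have := ler_normD (y - x) x; rewrite subrK normrN.
  by move: yx; lra.
have Nx0 x : - (N x)%:R < 0 :> R by rewrite oppr_lt0 ltr0n.
exists (fun x => F (N x) x - F (N x) 0) => x e e0.
have Nxx : - (N x)%:R < x by apply: Nx; rewrite subrr normr0.
have [dl dl0 H] := dF (N x) x Nxx e e0.
exists (Num.min dl 1); first by rewrite lt_min dl0 ltr01.
move=> y; rewrite lt_min => /andP[/H {}H yx].
rewrite (FE (N y) (N x) y) //; last exact: Nx.
  by move: H; congr (`| _ | <= _); ring.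
by apply: Nx; rewrite subrr normr0.
Qed.

End RealCalculus.

(** * Primitives and integrals of complex functions of a real variable *)

Section PathIntegral.
Variable R : realType.
Local Notation C := (R[i]).
Local Notation nm := (@normc R).
Implicit Types (phi psi Phi Psi : R -> C) (a b c t e : R).

Definition pdiff Phi t (d : C) := forall e, 0 < e -> exists2 dl : R, 0 < dl &
  forall y, `|y - t| < dl -> nm (Phi y - Phi t - d * (y - t)%:C%C) <= e * `|y - t|.

Definition pcont phi t := forall e, 0 < e -> exists2 dl : R, 0 < dl &
  forall y, `|y - t| < dl -> nm (phi y - phi t) < e.

Lemma pdiff_Re Phi t d (z : C) : pdiff Phi t d ->
  rdiff (fun y => complex.Re (z * Phi y)) t (complex.Re (z * d)).
Proof.
move=> H e e0; have K0 : 0 < nm z + 1 by have := nm_ge0 z; lra.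
have [|dl dl0 {}H] := H (e / (nm z + 1)); first by rewrite divr_gt0.
exists dl => // y /H {}H.
have -> : complex.Re (z * Phi y) - complex.Re (z * Phi t) - complex.Re (z * d) * (y - t) =
  complex.Re (z * (Phi y - Phi t - d * (y - t)%:C%C)).
  by case: (Phi y) (Phi t) d z {H K0} => [? ?] [? ?] [? ?] [? ?] /=; ring.
apply: le_trans (Re_le_nm _) _; rewrite nmM.
apply: le_trans (_ : (nm z + 1) * (e / (nm z + 1) * `|y - t|) <= _).
  by apply: ler_pM; rewrite ?nm_ge0 // lerDl.
by rewrite mulrA (mulrC (_ + 1)) divfK // gt_eqF.
Qed.

(** The mean value theorem fails for complex values; it is applied to the real part after
    multiplication by the unimodular [u] that turns the total increment into its modulus. *)
Lemma pdiff_bound Phi dPhi a b (K : R) : a <= b ->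
  (forall t, a <= t <= b -> pdiff Phi t (dPhi t)) ->
  (forall t, a <= t <= b -> nm (dPhi t) <= K) -> nm (Phi b - Phi a) <= K * (b - a).
Proof.
move=> ab D B; set z := Phi b - Phi a.
have [z0|z0] := eqVneq z 0.
  rewrite z0 nm0 mulr_ge0 ?subr_ge0 //; apply: le_trans (B a _); rewrite ?nm_ge0 ?lexx //.
have nz : 0 < nm z by rewrite nm_gt0.
pose u := (conjc z) / (nm z)%:C%C.
have nu : nm u = 1.
  rewrite nmM nmV nmR gtr0_norm //.
  have -> : nm (conjc z) = nm z by case: (z) => x y /=; rewrite sqrrN.
  by rewrite divff // gt_eqF.
have Ez : complex.Re (u * z) = nm z.
  have -> : u * z = (nm z)%:C%C.
    have E : conjc z * z = (nm z ^+ 2)%:C%C.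
      by rewrite nm_sqr; case: (z) => x y; rewrite /GRing.mul /=; congr (_ +i* _)%C; ring.
    rewrite /u mulrAC E rmorphXn /= expr2 mulfK //.
    by apply: contraNneq z0 => /(congr1 (@complex.Re R)) /= /eqP; rewrite nm_eq0.
  by [].
rewrite -[X in X <= _]ger0_norm ?nm_ge0 // -Ez.
have -> : complex.Re (u * z) = complex.Re (u * Phi b) - complex.Re (u * Phi a).
  by rewrite /z; case: (u) (Phi b) (Phi a) => [? ?] [? ?] [? ?] /=; ring.
apply: (@rdiff_bound R (fun t => complex.Re (u * Phi t)) (fun t => complex.Re (u * dPhi t))) => // t tab.
  by apply: pdiff_Re; exact: D.
by apply: le_trans (Re_le_nm _) _; rewrite nmM nu mul1r B.
Qed.

Lemma pdiff_eqd Phi t d d' : d' = d -> pdiff Phi t d -> pdiff Phi t d'.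
Proof. by move=> ->. Qed.

Lemma pdiff_ext Phi Psi t d : (forall y, Psi y = Phi y) -> pdiff Phi t d -> pdiff Psi t d.
Proof. by move=> E H e /H[dl dl0 {}H]; exists dl => // y /H; rewrite !E. Qed.

Lemma pdiffD Phi Psi t d d' : pdiff Phi t d -> pdiff Psi t d' ->
  pdiff (fun y => Phi y + Psi y) t (d + d').
Proof.
move=> Hf Hg e e0; have e20 : 0 < e / 2 by lra.
have [d1 d10 H1] := Hf _ e20; have [d2 d20 H2] := Hg _ e20.
exists (Num.min d1 d2); first by rewrite lt_min d10.
move=> w; rewrite lt_min => /andP[/H1 {}H1 /H2 {}H2].
have -> : Phi w + Psi w - (Phi t + Psi t) - (d + d') * (w - t)%:C%C =
  (Phi w - Phi t - d * (w - t)%:C%C) + (Psi w - Psi t - d' * (w - t)%:C%C) by ring.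
by apply: le_trans (nmD _ _) _; lra.
Qed.

Lemma pdiff_cst (z : C) t : pdiff (fun=> z) t 0.
Proof.
move=> e e0; exists 1 => // y _.
by rewrite mul0r !subrr nm0 mulr_ge0 // ltW.
Qed.

Lemma pdiff_comp f Phi t (df d : C) : pdiff Phi t d -> cdiff f (Phi t) df ->
  pdiff (fun y => f (Phi y)) t (df * d).
Proof.
move=> Hg Hf e e0.
pose K := nm d + 1; pose L := nm df + 1.
have K0 : 0 < K by have := nm_ge0 d; rewrite /K; lra.
have L0 : 0 < L by have := nm_ge0 df; rewrite /L; lra.
have [d1 d10 H1] := Hg 1 ltr01.
have {}H1 y : `|y - t| < d1 -> nm (Phi y - Phi t) <= K * `|y - t|.
  move=> /H1 {}H1.
  have -> : Phi y - Phi t = (Phi y - Phi t - d * (y - t)%:C%C) + d * (y - t)%:C%C by ring.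
  by apply: le_trans (nmD _ _) _; rewrite nmM nmR; move: H1; rewrite /K; lra.
have [|d2 d20 H2] := Hf (e / 2 / K); first by rewrite !divr_gt0.
have [|d3 d30 H3] := Hg (e / 2 / L); first by rewrite !divr_gt0.
exists (Num.min (Num.min d1 (d2 / K)) d3).
  by rewrite !lt_min d10 d30 divr_gt0.
move=> y; rewrite !lt_min => /andP[/andP[/H1 {}H1 wd2] /H3 {}H3].
set h := `|y - t| in H1 H3 wd2 *; have h0 : 0 <= h by exact: normr_ge0.
have -> : f (Phi y) - f (Phi t) - df * d * (y - t)%:C%C =
  (f (Phi y) - f (Phi t) - df * (Phi y - Phi t))
  + df * (Phi y - Phi t - d * (y - t)%:C%C) by ring.
have {}H2 : nm (f (Phi y) - f (Phi t) - df * (Phi y - Phi t)) <= e / 2 * h.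
  apply: le_trans (H2 _ _) _.
    by apply: le_lt_trans H1 _; rewrite mulrC -ltr_pdivlMr.
  rewrite -(mulrA (e / 2)) ler_pM2l ?divr_gt0 //.
  by rewrite mulrC ler_pdivrMr // mulrC.
have {}H3 : nm (df * (Phi y - Phi t - d * (y - t)%:C%C)) <= e / 2 * h.
  rewrite nmM mulrC; apply: le_trans (_ : (e / 2 / L * h) * L <= _).
    by apply: ler_pM; rewrite ?nm_ge0 // /L; lra.
  by rewrite mulrAC divfK // gt_eqF.
by apply: le_trans (nmD _ _) _; lra.
Qed.

Lemma pdiffZ (z : C) Phi t d : pdiff Phi t d -> pdiff (fun y => z * Phi y) t (z * d).
Proof.
move=> H; apply: (pdiff_comp (f := fun w => z * w) H).
by apply: cdiff_eqd (cdiffZ z (cdiff_id _)); rewrite mulr1.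
Qed.

Lemma pdiffB Phi Psi t d d' : pdiff Phi t d -> pdiff Psi t d' ->
  pdiff (fun y => Phi y - Psi y) t (d - d').
Proof.
move=> H H'; apply: pdiff_ext (pdiff_eqd _ (pdiffD H (pdiffZ (-1) H'))) => [y|];
  by rewrite mulN1r.
Qed.

Lemma pdiff_line (z v : C) t : pdiff (fun s => z + s%:C%C * v) t v.
Proof.
move=> e e0; exists 1 => // y _.
have -> : z + y%:C%C * v - (z + t%:C%C * v) - v * (y - t)%:C%C = 0.
  by rewrite rmorphB /=; ring.
by rewrite nm0 mulr_ge0 // ltW.
Qed.

Lemma pdiff_cont Phi t d : pdiff Phi t d -> pcont Phi t.
Proof.
move=> H e e0; have [dl dl0 {}H] := H 1 ltr01.
have K0 : 0 < nm d + 1 by have := nm_ge0 d; lra.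
exists (Num.min dl (e / (nm d + 1))); first by rewrite lt_min dl0 divr_gt0.
move=> y; rewrite lt_min => /andP[/H {}H yx].
have -> : Phi y - Phi t = (Phi y - Phi t - d * (y - t)%:C%C) + d * (y - t)%:C%C by ring.
apply: le_lt_trans (nmD _ _) _; rewrite nmM nmR.
have : (nm d + 1) * `|y - t| < e by rewrite mulrC -ltr_pdivlMr.
by move: H; lra.
Qed.

Lemma pcont_comp f Phi t : pcont Phi t -> ccont f (Phi t) -> pcont (fun y => f (Phi y)) t.
Proof.
move=> H Hf e /Hf[dl dl0 {}Hf]; have [dl' dl'0 {}H] := H _ dl0.
by exists dl' => // y /H /Hf.
Qed.

Definition clamp a b t := Num.max a (Num.min b t).

Lemma clamp_id a b t : a <= t <= b -> clamp a b t = t.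
Proof. by move=> /andP[at_ tb]; rewrite /clamp (min_idPr tb) (max_idPr at_). Qed.

Lemma clamp_itv a b t : a <= b -> a <= clamp a b t <= b.
Proof. by move=> ab; rewrite /clamp le_max lexx /= ge_max ab /= ge_min lexx. Qed.

Lemma clamp_lip a b s t : `|clamp a b s - clamp a b t| <= `|s - t|.
Proof.
have key u v : `|Num.max a u - Num.max a v| <= `|u - v|
             /\ `|Num.min b u - Num.min b v| <= `|u - v|.
  have := ler_norm (u - v); have := ler_norm (- (u - v)); rewrite normrN => A B.
  split; rewrite ler_norml.
    by case: (ltP a u) => ?; case: (ltP a v) => ?; apply/andP; split; lra.
  by case: (ltP b u) => ?; case: (ltP b v) => ?; apply/andP; split; lra.
by apply: le_trans (proj1 (key _ _)) _; exact: (proj2 (key _ _)).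
Qed.

Lemma exists_pprimitive phi a b : a <= b -> (forall t, a <= t <= b -> pcont phi t) ->
  exists Phi, forall t, pdiff Phi t (phi (clamp a b t)).
Proof.
move=> ab H.
have H' t : pcont (fun s => phi (clamp a b s)) t.
  move=> e e0; have [dl dl0 {}H] := H _ (clamp_itv t ab) e e0.
  exists dl => // y yt; apply: H; exact: le_lt_trans (clamp_lip _ _ _ _) yt.
have [|A HA] := @exists_primitive R (fun t => complex.Re (phi (clamp a b t))).
  move=> t e e0; have [dl dl0 {}H'] := H' t e e0; exists dl => // y /H' {}H'.
  apply: le_lt_trans H'; apply: le_trans (Re_le_nm _).
  by case: (phi _) (phi _) => [? ?] [? ?].
have [|B HB] := @exists_primitive R (fun t => complex.Im (phi (clamp a b t))).
  move=> t e e0; have [dl dl0 {}H'] := H' t e e0; exists dl => // y /H' {}H'.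
  apply: le_lt_trans H'; apply: le_trans (Im_le_nm _).
  by case: (phi _) (phi _) => [? ?] [? ?].
exists (fun t => (A t +i* B t)%C) => t e e0; have e20 : 0 < e / 2 by lra.
have [d1 d10 H1] := HA t _ e20; have [d2 d20 H2] := HB t _ e20.
exists (Num.min d1 d2); first by rewrite lt_min d10.
move=> w; rewrite lt_min => /andP[/H1 {}H1 /H2 {}H2].
apply: le_trans (nm_le_ReIm _) _.
set x := complex.Re _; set y := complex.Im _.
have -> : x = A w - A t - complex.Re (phi (clamp a b t)) * (w - t).
  by rewrite /x; case: (phi _) => [? ?] /=; ring.
have -> : y = B w - B t - complex.Im (phi (clamp a b t)) * (w - t).
  by rewrite /y; case: (phi _) => [? ?] /=; ring.
by move: H1 H2; lra.
Qed.

(* The integral is the increment of a primitive; [phi] is only looked at on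
   [[a, b]], hence the clamping. *)
Definition rint phi a b : C :=
  let Phi := xget (fun=> 0) [set Phi | forall t, pdiff Phi t (phi (clamp a b t))] in
  Phi b - Phi a.

Lemma rintE Phi phi a b : a <= b ->
  (forall t, a <= t <= b -> pcont phi t) ->
  (forall t, a <= t <= b -> pdiff Phi t (phi t)) -> rint phi a b = Phi b - Phi a.
Proof.
move=> ab c D; rewrite /rint; set S := [set _ | _].
have [Psi0 SP0] := exists_pprimitive ab c.
have := @xgetPex _ (fun=> 0) S (ex_intro _ Psi0 SP0).
set Psi := xget _ _ => SP.
apply/eqP; rewrite -subr_eq0 -nm_eq0 eq_le nm_ge0 andbT.
have -> : Psi b - Psi a - (Phi b - Phi a) = (Psi b - Phi b) - (Psi a - Phi a) by ring.
rewrite -[leRHS](mul0r (b - a)).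
apply: (@pdiff_bound (fun t => Psi t - Phi t) (fun=> 0)) => // [t tab|t _]; last by rewrite nm0.
by apply: pdiff_eqd (pdiffB (SP t) (D t tab)); rewrite clamp_id // subrr.
Qed.

Lemma exists_rint phi a b : a <= b -> (forall t, a <= t <= b -> pcont phi t) ->
  exists2 Phi, (forall t, a <= t <= b -> pdiff Phi t (phi t)) &
    forall s t, a <= s -> s <= t -> t <= b -> rint phi s t = Phi t - Phi s.
Proof.
move=> ab c; have [Phi H] := exists_pprimitive ab c; exists Phi.
  by move=> t tab; have := H t; rewrite clamp_id.
move=> s t as_ st tb; apply: rintE => // u /andP[su ut].
- by apply: c; rewrite (le_trans as_) //= (le_trans ut).
- have := H u; rewrite clamp_id //.
  by rewrite (le_trans as_) //= (le_trans ut).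
Qed.

Lemma rint_chasles phi a b c : a <= b -> b <= c ->
  (forall t, a <= t <= c -> pcont phi t) ->
  rint phi a c = rint phi a b + rint phi b c.
Proof.
move=> ab bc H; have ac := le_trans ab bc.
have [Phi _ E] := exists_rint ac H.
by rewrite !E //; ring.
Qed.

Lemma rintD phi psi a b : a <= b ->
  (forall t, a <= t <= b -> pcont phi t) -> (forall t, a <= t <= b -> pcont psi t) ->
  (forall t, a <= t <= b -> pcont (fun t => phi t + psi t) t) ->
  rint (fun t => phi t + psi t) a b = rint phi a b + rint psi a b.
Proof.
move=> ab H H' H''.
have [Phi D E] := exists_rint ab H; have [Psi D' E'] := exists_rint ab H'.
rewrite E // E' // (@rintE (fun t => Phi t + Psi t)) //; first by ring.
by move=> t tab; apply: pdiffD; [exact: D|exact: D'].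
Qed.

Lemma rintZ (z : C) phi a b : a <= b ->
  (forall t, a <= t <= b -> pcont phi t) ->
  rint (fun t => z * phi t) a b = z * rint phi a b.
Proof.
move=> ab H; have [Phi D E] := exists_rint ab H.
rewrite E // (@rintE (fun t => z * Phi t)) //; first by ring.
- move=> t tab; apply: pcont_comp (H t tab) _.
  exact: cdiff_cont (cdiffZ z (cdiff_id _)).
- by move=> t tab; apply: pdiffZ; exact: D.
Qed.

Lemma rint_bound phi a b (K : R) : a <= b ->
  (forall t, a <= t <= b -> pcont phi t) ->
  (forall t, a <= t <= b -> nm (phi t) <= K) -> nm (rint phi a b) <= K * (b - a).
Proof.
move=> ab H B; have [Phi D E] := exists_rint ab H.
by rewrite E //; apply: pdiff_bound D B.
Qed.

Lemma rint_cst (z : C) a b : a <= b -> rint (fun=> z) a b = z * (b - a)%:C%C.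
Proof.
move=> ab; rewrite (@rintE (fun t => 0 + t%:C%C * z)) //.
- by rewrite rmorphB /=; ring.
- by move=> t _; exact: pdiff_cont (pdiff_cst _ _).
- by move=> t _; exact: pdiff_line.
Qed.

Lemma eq_rint phi psi a b : a <= b -> (forall t, a <= t <= b -> phi t = psi t) ->
  rint phi a b = rint psi a b.
Proof.
move=> ab E; rewrite /rint.
have EC t : phi (clamp a b t) = psi (clamp a b t) by rewrite E // clamp_itv.
have -> // : [set Phi | forall t, pdiff Phi t (phi (clamp a b t))]
           = [set Phi | forall t, pdiff Phi t (psi (clamp a b t))].
by apply/seteqP; split => Phi /= H t; have := H t; rewrite EC.
Qed.

End PathIntegral.

(** * Goursat's theorem *)

Section Goursat.
Variable R : realType.
Local Notation C := (R[i]).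
Local Notation nm := (@normc R).
Implicit Types (F G : C -> C) (a b c d e : R) (w : C).

Definition rect a b c d : set C :=
  [set w | (a <= complex.Re w <= b) && (c <= complex.Im w <= d)].

(** The integral of [F dz] along the boundary, counterclockwise; the factor [i] on the vertical
    sides is [dz / dt]. *)
Definition bint F a b c d : C :=
  rint (fun s => F (s +i* c)%C) a b + 'i%C * rint (fun t => F (b +i* t)%C) c d
  - rint (fun s => F (s +i* d)%C) a b - 'i%C * rint (fun t => F (a +i* t)%C) c d.

Lemma pdiff_hline c s : pdiff (fun s : R => (s +i* c)%C) s 1.
Proof.
apply: pdiff_ext (pdiff_line (0 +i* c)%C 1 s) => y.
by rewrite mulr1 /GRing.add /= add0r addr0.
Qed.

Lemma pdiff_vline a t : pdiff (fun t : R => (a +i* t)%C) t 'i%C.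
Proof.
apply: pdiff_ext (pdiff_line (a +i* 0)%C 'i%C t) => y.
by rewrite /GRing.add /GRing.mul /=; congr (_ +i* _)%C; ring.
Qed.

Lemma pcont_hline F c s : ccont F (s +i* c)%C -> pcont (fun s : R => F (s +i* c)%C) s.
Proof. by move=> H; exact: (pcont_comp (pdiff_cont (pdiff_hline c s)) H). Qed.

Lemma pcont_vline F a t : ccont F (a +i* t)%C -> pcont (fun t : R => F (a +i* t)%C) t.
Proof. by move=> H; exact: (pcont_comp (pdiff_cont (pdiff_vline a t)) H). Qed.

Lemma ccontD F G w : ccont F w -> ccont G w -> ccont (fun w => F w + G w) w.
Proof.
move=> H1 H2 e e0; have e20 : 0 < e / 2 by lra.
have [d1 d10 {}H1] := H1 _ e20; have [d2 d20 {}H2] := H2 _ e20.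
exists (Num.min d1 d2); first by rewrite lt_min d10.
move=> v; rewrite lt_min => /andP[/H1 {}H1 /H2 {}H2].
have -> : F v + G v - (F w + G w) = (F v - F w) + (G v - G w) by ring.
by apply: le_lt_trans (nmD _ _) _; lra.
Qed.

Lemma bint_split_h F a m b c d : a <= m -> m <= b -> c <= d ->
  (forall w, rect a b c d w -> ccont F w) ->
  bint F a b c d = bint F a m c d + bint F m b c d.
Proof.
move=> am mb cd H; have ab := le_trans am mb; rewrite /bint.
rewrite (@rint_chasles _ (fun s => F (s +i* c)%C) a m b) //; last first.
  by move=> t tab; apply/pcont_hline/H; rewrite /rect /= tab lexx.
rewrite (@rint_chasles _ (fun s => F (s +i* d)%C) a m b) //; last first.
  by move=> t tab; apply/pcont_hline/H; rewrite /rect /= tab lexx cd.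
ring.
Qed.

Lemma bint_split_v F a b c m d : c <= m -> m <= d -> a <= b ->
  (forall w, rect a b c d w -> ccont F w) ->
  bint F a b c d = bint F a b c m + bint F a b m d.
Proof.
move=> cm md ab H; have cd := le_trans cm md; rewrite /bint.
rewrite (@rint_chasles _ (fun t => F (a +i* t)%C) c m d) //; last first.
  by move=> t tab; apply/pcont_vline/H; rewrite /rect /= tab lexx ab.
rewrite (@rint_chasles _ (fun t => F (b +i* t)%C) c m d) //; last first.
  by move=> t tab; apply/pcont_vline/H; rewrite /rect /= tab lexx ab.
ring.
Qed.

Lemma bint_primitive F G a b c d : a <= b -> c <= d ->
  (forall w, rect a b c d w -> ccont F w) ->
  (forall w, rect a b c d w -> cdiff G w (F w)) -> bint F a b c d = 0.
Proof.
move=> ab cd H D; rewrite /bint.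
have I0 : 'i%C * 'i%C = -1 :> C by rewrite -expr2 sqr_i.
have A u v : c <= u <= d -> a <= v <= b ->
   rint (fun s => F (s +i* u)%C) a b = G (b +i* u)%C - G (a +i* u)%C.
  move=> ucd vab; apply: (@rintE _ (fun s => G (s +i* u)%C)) => // t tab.
    by apply/pcont_hline/H; rewrite /rect /= tab.
  apply: pdiff_eqd (pdiff_comp (pdiff_hline u t) (D _ _)); first by rewrite mulr1.
  by rewrite /rect /= tab.
have B u : a <= u <= b ->
   'i%C * rint (fun t => F (u +i* t)%C) c d = G (u +i* d)%C - G (u +i* c)%C.
  move=> uab; rewrite (@rintE _ (fun t => - 'i%C * G (u +i* t)%C)) //.
  - by rewrite -mulrBr mulrA mulrN I0 opprK mul1r.
  - by move=> t tab; apply/pcont_vline/H; rewrite /rect /= tab uab.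
  - move=> t tcd; apply: pdiff_eqd (pdiffZ _ (pdiff_comp (pdiff_vline u t) (D _ _))).
      by rewrite mulrCA !mulNr I0 opprK mulr1.
    by rewrite /rect /= tcd uab.
rewrite (A c a) ?lexx ?cd ?ab // (A d a) ?lexx ?cd ?ab // !B ?lexx ?ab //; ring.
Qed.

Lemma bint_bound F a b c d (K : R) : a <= b -> c <= d ->
  (forall w, rect a b c d w -> ccont F w) ->
  (forall w, rect a b c d w -> nm (F w) <= K) ->
  nm (bint F a b c d) <= K * (2 * ((b - a) + (d - c))).
Proof.
move=> ab cd H B; rewrite /bint.
have A u : c <= u <= d -> nm (rint (fun s => F (s +i* u)%C) a b) <= K * (b - a).
  move=> ucd; apply: rint_bound => // t tab; last by apply: B; rewrite /rect /= tab.
  by apply/pcont_hline/H; rewrite /rect /= tab.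
have E u : a <= u <= b -> nm ('i%C * rint (fun t => F (u +i* t)%C) c d) <= K * (d - c).
  move=> uab; rewrite nmM.
  have -> : nm 'i%C = 1 by rewrite /= expr0n /= add0r expr1n sqrtr1.
  rewrite mul1r; apply: rint_bound => // t tab; last by apply: B; rewrite /rect /= tab uab.
  by apply/pcont_vline/H; rewrite /rect /= tab uab.
have := A c; rewrite lexx cd => /(_ isT) A1.
have := A d; rewrite lexx cd => /(_ isT) A2.
have := E a; rewrite lexx ab => /(_ isT) A3.
have := E b; rewrite lexx ab => /(_ isT) A4.
apply: le_trans (nmB _ _) _; move: A3; set x := nm ('i%C * _) => A3.
have := nmB (rint (fun s => F (s +i* c)%C) a b + 'i%C * rint (fun t => F (b +i* t)%C) c d)
            (rint (fun s => F (s +i* d)%C) a b).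
have := nmD (rint (fun s => F (s +i* c)%C) a b) ('i%C * rint (fun t => F (b +i* t)%C) c d).
lra.
Qed.

Lemma bintD F G a b c d : a <= b -> c <= d ->
  (forall w, rect a b c d w -> ccont F w) -> (forall w, rect a b c d w -> ccont G w) ->
  bint (fun w => F w + G w) a b c d = bint F a b c d + bint G a b c d.
Proof.
move=> ab cd HF HG; rewrite /bint.
have A u : c <= u <= d -> rint (fun s => F (s +i* u)%C + G (s +i* u)%C) a b =
   rint (fun s => F (s +i* u)%C) a b + rint (fun s => G (s +i* u)%C) a b.
  move=> ucd; have r t : a <= t <= b -> rect a b c d (t +i* u)%C by rewrite /rect /= => ->.
  apply: rintD => // t /r {}r.
  - exact/pcont_hline/HF.
  - exact/pcont_hline/HG.
  - by apply: (@pcont_hline (fun w => F w + G w)); apply: ccontD; [exact: HF|exact: HG].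
have E u : a <= u <= b -> rint (fun t => F (u +i* t)%C + G (u +i* t)%C) c d =
   rint (fun t => F (u +i* t)%C) c d + rint (fun t => G (u +i* t)%C) c d.
  move=> uab; have r t : c <= t <= d -> rect a b c d (u +i* t)%C.
    by rewrite /rect /= => ->; rewrite uab.
  apply: rintD => // t /r {}r.
  - exact/pcont_vline/HF.
  - exact/pcont_vline/HG.
  - by apply: (@pcont_vline (fun w => F w + G w)); apply: ccontD; [exact: HF|exact: HG].
by rewrite !A ?lexx ?cd // !E ?lexx ?ab //; ring.
Qed.

Lemma nested_point (u v : nat -> R) : (forall n, u n <= u n.+1) ->
  (forall n, v n.+1 <= v n) -> (forall n, u n <= v n) ->
  exists x, forall n, u n <= x <= v n.
Proof.
move=> uS vS uv.
have uM n k : u n <= u (n + k)%N.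
  by elim: k => [|k IH]; rewrite ?addn0 // addnS (le_trans IH).
have vM n k : v (n + k)%N <= v n.
  by elim: k => [|k IH]; rewrite ?addn0 // addnS (le_trans _ IH).
have uvM n m : u n <= v m.
  case/orP: (leq_total n m) => /subnKC E.
    by apply: le_trans (uM n (m - n)%N) _; rewrite E.
  by apply: le_trans (uv n) _; rewrite -E.
exists (sup (range u)) => n; apply/andP; split.
  apply: ub_le_sup; last by exists n.
  by exists (v 0%N) => _ [m _ <-].
by apply: ge_sup; [exists (u 0%N), 0%N | move=> _ [m _ <-]].
Qed.

(** The usual way below of showing that a modulus vanishes: it is at most an arbitrarily small
    multiple of a fixed number. *)
Lemma le0_eps (x K : R) : (forall e, 0 < e -> x <= e * K) -> x <= 0.
Proof.
move=> H; rewrite leNgt; apply/negP => x0.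
have K0 : 0 < `|K| + 1 by have := normr_ge0 K; lra.
have := H (x / 2 / (`|K| + 1)) (divr_gt0 _ K0).
have x20 : 0 < x / 2 by lra.
move=> /(_ x20).
have : x / 2 / (`|K| + 1) * K <= x / 2 / (`|K| + 1) * (`|K| + 1).
  by apply: ler_wpM2l; [rewrite divr_ge0 // ltW | have := ler_norm K; lra].
rewrite divfK ?gt_eqF //; lra.
Qed.

Lemma half_geo_lt (K e : R) : 0 < e -> exists n : nat, K / 2 ^+ n < e.
Proof.
move=> e0; have [n] : exists n : nat, `|K| / e < n%:R.
  by exists (Num.truncn (`|K| / e)).+1; exact: truncnS_gt.
move=> Hn; exists n; move: Hn.
rewrite ltr_pdivrMr // => H.
rewrite ltr_pdivrMr ?exprn_gt0 //; apply: le_lt_trans (ler_norm _) _.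
apply: (lt_le_trans H); rewrite mulrC ler_pM2l //.
by rewrite -natrX ler_nat ltnW // ltn_expl.
Qed.

(** Quartering: some quarter carries at least a fourth of the integral, and the nested quarters meet
    at a point where [F] is affine up to [e * |w - z|]. The affine part has a primitive and
    integrates to 0; the rest is of the order of [e] times the squared size of the quarter, and the
    decay [4 ^- n] of that square compensates the factor [4 ^ n] lost. *)
Theorem goursat F a b c d : a <= b -> c <= d ->
  (forall w, rect a b c d w -> exists D, cdiff F w D) -> bint F a b c d = 0.
Proof.
move=> ab cd dF.
have cF w : rect a b c d w -> ccont F w by move=> /dF[D /cdiff_cont].
pose h n := (b - a) / 2 ^+ n; pose k n := (d - c) / 2 ^+ n.
have hS n : h n.+1 = h n / 2 by rewrite /h exprSr invfM mulrA.
have kS n : k n.+1 = k n / 2 by rewrite /k exprSr invfM mulrA.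
have h0 n : 0 <= h n by rewrite divr_ge0 ?subr_ge0 // exprn_ge0.
have k0 n : 0 <= k n by rewrite divr_ge0 ?subr_ge0 // exprn_ge0.
(* A quarter of generation [n] is recorded by its lower left corner, its sides being [h n] and
   [k n]. *)
pose J n (p : R * R) := bint F p.1 (p.1 + h n) p.2 (p.2 + k n).
pose P n (p q : R * R) := [/\ p.1 <= q.1, q.1 + h n.+1 <= p.1 + h n,
  p.2 <= q.2, q.2 + k n.+1 <= p.2 + k n & nm (J n p) <= 4 * nm (J n.+1 q)].
pose valid n (p : R * R) := [&& a <= p.1, p.1 + h n <= b, c <= p.2 & p.2 + k n <= d].
have exP n p : valid n p -> exists q, P n p q.
  case: p => x y /and4P[/= ax xb cy yd].
  have hn := h0 n.+1; have kn := k0 n.+1; have hSn := hS n; have kSn := kS n.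
  pose x' := x + h n.+1; pose y' := y + k n.+1.
  have sub x1 x2 y1 y2 : a <= x1 -> x2 <= b -> c <= y1 -> y2 <= d ->
     forall w, rect x1 x2 y1 y2 w -> ccont F w.
    move=> A1 A2 A3 A4 w /andP[/andP[A5 A6] /andP[A7 A8]]; apply: cF.
    by rewrite /rect /= (le_trans A1) // (le_trans A6) // (le_trans A3) // (le_trans A8).
  have E : J n (x, y) = J n.+1 (x, y) + J n.+1 (x, y') + (J n.+1 (x', y) + J n.+1 (x', y')).
    rewrite /J /= (@bint_split_h F x x'); first last.
    - by apply: sub => //; rewrite /x'; lra.
    - by lra.
    - by rewrite /x'; lra.
    - by rewrite /x'; lra.
    have -> : x + h n = x' + h n.+1 by rewrite /x'; lra.
    congr (_ + _).
      rewrite (@bint_split_v F x _ y y'); first last.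
      - by apply: sub => //; rewrite /x'; lra.
      - by rewrite /x'; lra.
      - by rewrite /y'; lra.
      - by rewrite /y'; lra.
      by congr (_ + bint _ _ _ _ _); rewrite /y'; lra.
    rewrite (@bint_split_v F x' _ y y'); first last.
    - by apply: sub => //; rewrite /x'; lra.
    - by rewrite /x'; lra.
    - by rewrite /y'; lra.
    - by rewrite /y'; lra.
    by congr (_ + bint _ _ _ _ _); rewrite /y'; lra.
  have [A1|A1] := leP (nm (J n (x, y))) (4 * nm (J n.+1 (x, y))).
    by exists (x, y); split => //=; lra.
  have [A2|A2] := leP (nm (J n (x, y))) (4 * nm (J n.+1 (x, y'))).
    by exists (x, y'); split => //=; rewrite /y'; lra.
  have [A3|A3] := leP (nm (J n (x, y))) (4 * nm (J n.+1 (x', y))).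
    by exists (x', y); split => //=; rewrite /x'; lra.
  exists (x', y'); split; rewrite /=; [by rewrite /x'; lra | by rewrite /x'; lra
    | by rewrite /y'; lra | by rewrite /y'; lra | ].
  have := nmD (J n.+1 (x, y) + J n.+1 (x, y')) (J n.+1 (x', y) + J n.+1 (x', y')).
  have := nmD (J n.+1 (x, y)) (J n.+1 (x, y')).
  have := nmD (J n.+1 (x', y)) (J n.+1 (x', y')).
  rewrite -E; lra.
pose fix p n := if n is m.+1 then xget (p m) [set q | P m (p m) q] else (a, c).
have vp n : valid n (p n) /\ P n (p n) (p n.+1).
  elim: n => [|n [IH1 IH2]].
    have v0 : valid 0%N (a, c).
      by rewrite /valid /h /k /= !expr0 !divr1 !lexx /= ![_ + (_ - _)]addrC !subrK !lexx.
    by split => //; have [q Hq] := exP _ _ v0; exact: (xgetPex (a, c) (ex_intro _ q Hq)).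
  have v1 : valid n.+1 (p n.+1).
    case: IH2 => B1 B2 B3 B4 _; move: IH1 => /and4P[A1 A2 A3 A4].
    by apply/and4P; split; lra.
  by split => //; have [q Hq] := exP _ _ v1; exact: (xgetPex _ (ex_intro _ q Hq)).
have [x0 Hx] : exists x, forall n, (p n).1 <= x <= (p n).1 + h n.
  apply: nested_point => n; last by rewrite lerDl.
    by have [_ []] := vp n.
  by have [_ []] := vp n.
have [y0 Hy] : exists x, forall n, (p n).2 <= x <= (p n).2 + k n.
  apply: nested_point => n; last by rewrite lerDl.
    by have [_ []] := vp n.
  by have [_ []] := vp n.
have [|D HD] := dF (x0 +i* y0)%C.
  have := Hx 0%N; have := Hy 0%N; rewrite /rect /= /h /k expr0 !divr1.
  by rewrite ![_ + (_ - _)]addrC !subrK => -> ->.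
have J4 n : nm (J 0%N (p 0%N)) <= 4 ^+ n * nm (J n (p n)).
  elim: n => [|n IH]; first by rewrite expr0 mul1r.
  have [_ [_ _ _ _ A]] := vp n.
  by apply: (le_trans IH); rewrite exprSr -mulrA ler_pM2l // exprn_gt0.
have J0 : J 0%N (p 0%N) = bint F a b c d.
  by rewrite /J /h /k /= !expr0 !divr1 ![_ + (_ - _)]addrC !subrK.
apply/eqP; rewrite -nm_eq0 eq_le nm_ge0 andbT -J0.
apply: (@le0_eps _ (2 * (b - a + (d - c)) ^+ 2)) => e e0.
have [dl dl0 {}HD] := HD e e0.
have [n Hn] := half_geo_lt (b - a + (d - c)) dl0.
apply: le_trans (J4 n) _.
have [/and4P[A1 A2 A3 A4] _] := vp n.
pose z := (x0 +i* y0)%C.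
pose G w := F w + - (F z + D * (w - z)).
have zn w : rect (p n).1 ((p n).1 + h n) (p n).2 ((p n).2 + k n) w -> nm (w - z) <= h n + k n.
  case: w => u v /andP[/andP[u1 u2] /andP[v1 v2]].
  apply: le_trans (nm_le_ReIm _) _; rewrite /= in u1 u2 v1 v2 *.
  have := Hx n; have := Hy n => /andP[? ?] /andP[? ?].
  by apply: lerD; rewrite ler_norml; apply/andP; split; lra.
have sub w : rect (p n).1 ((p n).1 + h n) (p n).2 ((p n).2 + k n) w -> ccont F w.
  case: w => u v /andP[/= /andP[u1 u2] /andP[v1 v2]]; apply: cF.
  by rewrite /rect /=; apply/andP; split; apply/andP; split; lra.
have daff w : cdiff (fun w => - (F z + D * (w - z))) w (- (0 + D * (1 - 0))).
  apply: cdiffN; apply: cdiffD (cdiff_cst _ _) _.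
  by apply: cdiffZ; apply: cdiffB (cdiff_id _) (cdiff_cst _ _).
have E : J n (p n) = bint G (p n).1 ((p n).1 + h n) (p n).2 ((p n).2 + k n).
  rewrite bintD ?lerDl //; last by move=> w _; exact: cdiff_cont (daff w).
  rewrite [X in _ = _ + X](@bint_primitive _ (fun w => (D * z - F z) * w - D / 2 * w ^+ 2)) ?lerDl ?addr0 //.
    by move=> w _; exact: cdiff_cont (daff w).
  move=> w _; apply: cdiff_eqd (cdiffB (cdiffZ _ (cdiff_id w)) (cdiffZ _ (cdiffX w 2))).
  have n2 : (2 : C) != 0 by rewrite pnatr_eq0.
  by rewrite /= expr1; field.
have cG w : rect (p n).1 ((p n).1 + h n) (p n).2 ((p n).2 + k n) w -> ccont G w.
  by move=> /sub Fw; apply: ccontD => //; exact: cdiff_cont (daff w).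
have hk : h n + k n = (b - a + (d - c)) / 2 ^+ n by rewrite /h /k -mulrDl.
have := @bint_bound G (p n).1 ((p n).1 + h n) (p n).2 ((p n).2 + k n) (e * (h n + k n)).
rewrite !lerDl -E => /(_ (h0 n) (k0 n) cG) B.
have {}B : nm (J n (p n)) <= e * (h n + k n) * (2 * (h n + k n)).
  have -> : h n + k n = (p n).1 + h n - (p n).1 + ((p n).2 + k n - (p n).2) by ring.
  move: B; rewrite ![_ + _ - _]addrAC !subrr !add0r; apply => w /zn Bw.
  rewrite /G opprD addrA; apply: le_trans (HD _ _) _.
    by apply: le_lt_trans Bw _; rewrite hk.
  by rewrite ler_pM2l.
apply: le_trans (_ : 4 ^+ n * (e * (h n + k n) * (2 * (h n + k n))) <= _).
  by rewrite ler_pM2l // exprn_gt0.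
have -> : 4 ^+ n = (2 ^+ n) ^+ 2 :> R by rewrite -exprM mulnC exprM expr2 -natrM.
rewrite hk.
have n2 : (2 ^+ n : R) != 0 by rewrite expf_neq0.
by rewrite le_eqVlt; apply/orP; left; apply/eqP; field.
Qed.

End Goursat.

(** * The complex exponential *)

Section ComplexExponential.
Variable R : realType.
Local Notation C := (R[i]).
Local Notation nm := (@normc R).
Implicit Types (z w : C) (t x y e : R).

Lemma mulcE (a b c d : R) :
  (a +i* b)%C * (c +i* d)%C = ((a * c - b * d) +i* (a * d + b * c))%C :> C.
Proof. by []. Qed.

Lemma addcE (a b c d : R) : (a +i* b)%C + (c +i* d)%C = ((a + c) +i* (b + d))%C :> C.
Proof. by []. Qed.

Lemma oppcE (a b : R) : - (a +i* b)%C = ((- a) +i* (- b))%C :> C.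
Proof. by []. Qed.

Lemma oneE : 1 = (1 +i* 0)%C :> C.
Proof. by []. Qed.

Definition cis t : C := (cos t +i* sin t)%C.

Definition cexp z : C := (expR (complex.Re z))%:C%C * cis (complex.Im z).

Lemma cisD s t : cis (s + t) = cis s * cis t.
Proof.
by rewrite /cis cosD sinD mulcE addrC (addrC (cos s * _)).
Qed.

Lemma cis0 : cis 0 = 1.
Proof. by rewrite /cis cos0 sin0. Qed.

Lemma cis2pi : cis (2 * pi) = 1.
Proof. by rewrite /cis mulr_natl cos2pi sin2pi. Qed.

Lemma nm_cis t : nm (cis t) = 1.
Proof. by rewrite /= cos2Dsin2 sqrtr1. Qed.

Lemma cis_neq0 t : cis t != 0.
Proof. by rewrite -nm_eq0 nm_cis oner_eq0. Qed.

Lemma cexpD z w : cexp (z + w) = cexp z * cexp w.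
Proof.
rewrite /cexp; case: z w => [a b] [c d] /=.
by rewrite expRD cisD rmorphM /=; ring.
Qed.

Lemma cexp0 : cexp 0 = 1.
Proof. by rewrite /cexp /= expR0 cis0 mulr1. Qed.

Lemma nm_cexp z : nm (cexp z) = expR (complex.Re z).
Proof. by rewrite nmM nmR nm_cis mulr1 gtr0_norm // expR_gt0. Qed.

Lemma cexp_neq0 z : cexp z != 0.
Proof. by rewrite -nm_eq0 nm_cexp gt_eqF // expR_gt0. Qed.

Lemma cexp2pi z : cexp (z + (0 +i* (2 * pi))%C) = cexp z.
Proof. by rewrite cexpD [X in _ * X]/cexp /= expR0 cis2pi !mulr1. Qed.

Lemma polar z : z != 0 -> exists2 t, 0 <= t <= 2 * pi & z = (nm z)%:C%C * cis t.
Proof.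
move=> z0; have nz : 0 < nm z by rewrite nm_gt0.
have pi0 : 0 <= pi :> R by exact: pi_ge0.
pose a := complex.Re z / nm z; pose b := complex.Im z / nm z.
have ab : a ^+ 2 + b ^+ 2 = 1.
  rewrite /a /b !expr_div_n -mulrDl -nm_sqr divff // expf_neq0 // gt_eqF //.
have a1 : -1 <= a <= 1.
  by have := Re_le_nm z; rewrite ler_norml /a ler_pdivlMr // ler_pdivrMr // mul1r mulN1r.
have zE : z = (nm z)%:C%C * (a +i* b)%C.
  rewrite /a /b; move: (nm z) nz => r r0; case: (z) => x y; rewrite mulcE.
  by rewrite !mul0r subr0 addr0 !(mulrC r) !divfK ?gt_eqF.
have cA : cos (acos a) = a by rewrite acosK // in_itv.
have sA : sin (acos a) = `|b|.
  by rewrite sin_acos // -ab addrC addKr sqrtr_sqr.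
have [b0|b0] := leP 0 b.
  exists (acos a); first by rewrite acos_ge0 //= (le_trans (acos_lepi a1)) // mulr_natl mulr2n lerDl.
  by rewrite /cis cA sA ger0_norm.
exists (2 * pi - acos a).
  have := acos_ge0 a1; have := acos_lepi a1; lra.
rewrite /cis cosB sinB mulr_natl cos2pi sin2pi cA sA !mul1r !mul0r addr0 sub0r.
by rewrite ltr0_norm // opprK.
Qed.

Lemma cdiff_cexp0 : cdiff cexp 0 1.
Proof.
move=> e e0.
have [|d1 d10 H1] := is_derive_rdiff (is_derive_expR (0 : R)) (e := e / 8); first by lra.
have [|d2 d20 H2] := is_derive_rdiff (is_derive_cos (0 : R)) (e := e / 8); first by lra.
have [|d3 d30 H3] := is_derive_rdiff (is_derive_sin (0 : R)) (e := e / 8); first by lra.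
have E0 : 0 < Num.min 1 (e / 8) by rewrite lt_min ltr01 divr_gt0.
have [d4 d40 H4] := rdiff_cont (is_derive_rdiff (is_derive_cos (0 : R))) E0.
have [d5 d50 H5] := rdiff_cont (is_derive_rdiff (is_derive_sin (0 : R))) E0.
exists (Num.min (Num.min (Num.min d1 d2) (Num.min d3 d4)) d5).
  by rewrite !lt_min d10 d20 d30 d40.
case=> x y; rewrite subr0 !lt_min => /andP[/andP[/andP[n1 n2] /andP[n3 n4]] n5].
set h := nm _ in n1 n2 n3 n4 n5 *; have h0 : 0 <= h by exact: nm_ge0.
have xh : `|x| <= h by exact: (Re_le_nm (x +i* y)%C).
have yh : `|y| <= h by exact: (Im_le_nm (x +i* y)%C).
have := H1 x; rewrite !subr0 expR0 mul1r => /(_ (le_lt_trans xh n1)) {}H1.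
have := H2 y; rewrite !subr0 cos0 sin0 oppr0 mul0r subr0 => /(_ (le_lt_trans yh n2)) {}H2.
have := H3 y; rewrite !subr0 cos0 sin0 subr0 mul1r => /(_ (le_lt_trans yh n3)) {}H3.
have := H4 y; rewrite !subr0 cos0 lt_min => /(_ (le_lt_trans yh n4)) /andP[_ {}H4].
have := H5 y; rewrite !subr0 sin0 subr0 lt_min => /(_ (le_lt_trans yh n5)) /andP[_ {}H5].
rewrite cexp0 mul1r.
(* The first two summands are first-order remainders of [expR], [cos] and [sin] at 0; the last is
   [x] times a factor tending to 0. *)
have -> : cexp (x +i* y)%C - 1 - (x +i* y)%C = (expR x - 1 - x)%:C%C * cis y +
   ((cos y - 1) +i* (sin y - y))%C + x%:C%C * ((cos y - 1) +i* sin y)%C.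
  rewrite /cexp /cis /= oneE !(mulcE, oppcE, addcE).
  by congr (_ +i* _)%C; ring.
apply: le_trans (nmD _ _) _; rewrite nmM nmR.
have A : nm ((expR x - 1 - x)%:C%C * cis y + ((cos y - 1) +i* (sin y - y))%C) <= e / 8 * h + e / 4 * h.
  apply: le_trans (nmD _ _) _; rewrite nmM nmR nm_cis mulr1; apply: lerD.
    by apply: (le_trans H1); rewrite ler_pM2l // divr_gt0.
  apply: le_trans (nm_le_ReIm _) _.
  rewrite [complex.Re _]/= [complex.Im _]/=.
  have : e / 8 * `|y| <= e / 8 * h by rewrite ler_pM2l // divr_gt0.
  by move: H2 H3; lra.
have B : `|x| * nm ((cos y - 1) +i* sin y)%C <= h * (e / 4).
  apply: ler_pM; rewrite ?nm_ge0 //; apply: le_trans (nm_le_ReIm _) _.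
  by rewrite [complex.Re _]/= [complex.Im _]/=; move: H4 H5; lra.
have : 0 <= e * h by rewrite mulr_ge0 // ltW.
by move: A B; lra.
Qed.

Lemma cdiff_cexp z : cdiff cexp z (cexp z).
Proof.
apply: (@cdiff_ext _ (fun w => cexp z * cexp (w - z))).
  by move=> w; rewrite -cexpD addrC subrK.
apply: cdiff_eqd (cdiffZ _ (cdiff_comp (dg := 1) (df := 1) _ _)).
- by rewrite !mulr1.
- by apply: cdiff_eqd (cdiffB (cdiff_id z) (cdiff_cst z z)); rewrite subr0.
- by rewrite subrr; exact: cdiff_cexp0.
Qed.

Lemma cexp_surj z : z != 0 -> exists2 u, cexp u = z &
  complex.Re u = ln (nm z) /\ 0 <= complex.Im u <= 2 * pi.
Proof.
move=> z0; have [t t0 E] := polar z0.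
exists (ln (nm z) +i* t)%C => //.
by rewrite /cexp /= lnK ?posrE ?nm_gt0 // -E.
Qed.

Lemma pdiff_cis t : pdiff cis t ('i%C * cis t).
Proof.
have E y : cis y = cexp (0 +i* y)%C by rewrite /cexp /= expR0 mul1r.
apply: (pdiff_ext (Phi := fun y => cexp (0 +i* y)%C)) => [y|]; first exact: E.
by rewrite mulrC E; exact: (pdiff_comp (pdiff_vline 0 t) (cdiff_cexp _)).
Qed.

End ComplexExponential.

(** * Taylor expansions *)

Section Taylor.
Variable R : realType.
Local Notation C := (R[i]).
Local Notation nm := (@normc R).
Implicit Types (f g : C -> C) (z w : C) (r e a b c d : R).

Lemma pi2_gt0 : 0 < 2 * pi :> R.
Proof. by rewrite mulr_gt0 // pi_gt0. Qed.

Lemma nm_circ r t : 0 < r -> nm (r%:C%C * cis t) = r.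
Proof. by move=> r0; rewrite nmM nm_cis mulr1 nmR gtr0_norm. Qed.

(** A square of half side [h] around [p] is cut out; [goursat] kills the four rectangles around it,
    and the square contributes at most [8 h K] with [K] a local bound of [f]. This serves difference
    quotients, which are merely continuous at their base point so far. *)
Lemma goursat_exc f a b c d p : a < complex.Re p < b -> c < complex.Im p < d ->
  (forall w, rect a b c d w -> w != p -> exists D, cdiff f w D) -> ccont f p ->
  bint f a b c d = 0.
Proof.
case: p => x y; rewrite [complex.Re _]/= [complex.Im _]/=.
move=> /andP[ax xb] /andP[cy yd] D Cp.
have Cf w : rect a b c d w -> ccont f w.
  move=> rw; have [->//|wp] := eqVneq w (x +i* y)%C.
  by have [? /cdiff_cont] := D w rw wp.
have [dl dl0 B] := ccont_bound Cp.
set K := nm _ + 1 in B.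
have K0 : 0 <= K by rewrite addr_ge0 ?nm_ge0.
apply/eqP; rewrite -nm_eq0 eq_le nm_ge0 andbT.
apply: (@le0_eps _ _ (8 * K)) => e e0.
pose h := Num.min (Num.min e (dl / 3))
  (Num.min (Num.min (x - a) (b - x)) (Num.min (y - c) (d - y))).
have h0 : 0 < h by rewrite !lt_min e0 !subr_gt0 ax xb cy yd divr_gt0.
have : h <= h by []; rewrite {2}/h !le_min.
move=> /andP[/andP[he hd] /andP[/andP[h1 h2] /andP[h3 h4]]].
have sub u1 u2 v1 v2 w : a <= u1 -> u2 <= b -> c <= v1 -> v2 <= d ->
    rect u1 u2 v1 v2 w -> rect a b c d w.
  move=> A1 A2 A3 A4 /andP[/andP[A5 A6] /andP[A7 A8]].
  by rewrite /rect /= (le_trans A1) // (le_trans A6) // (le_trans A3) // (le_trans A8).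
rewrite (@bint_split_h _ _ _ (x - h)) //; [|by lra|by lra|by lra].
rewrite (@bint_split_h _ _ (x - h) (x + h)); [|by lra|by lra|by lra|];
  last by move=> w rw; apply: Cf; apply: sub rw => //; lra.
rewrite (@bint_split_v _ _ (x - h) (x + h) _ (y - h)); [|by lra|by lra|by lra|];
  last by move=> w rw; apply: Cf; apply: sub rw => //; lra.
rewrite (@bint_split_v _ _ (x - h) (x + h) (y - h) (y + h)); [|by lra|by lra|by lra|];
  last by move=> w rw; apply: Cf; apply: sub rw => //; lra.
have Z u1 u2 v1 v2 : a <= u1 -> u1 <= u2 -> u2 <= b -> c <= v1 -> v1 <= v2 -> v2 <= d ->
    [\/ x < u1, u2 < x, y < v1 | v2 < y] -> bint f u1 u2 v1 v2 = 0.
  move=> A1 A2 A3 A4 A5 A6 N; apply: goursat => // w rw.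
  apply: D; first exact: sub rw.
  apply/eqP => E; move: rw; rewrite E => /andP[/andP[/= B1 B2] /andP[B3 B4]].
  by case: N; lra.
have -> : bint f a (x - h) c d = 0 by apply: Z; try lra; apply: Or42; lra.
have -> : bint f (x + h) b c d = 0 by apply: Z; try lra; apply: Or41; lra.
have -> : bint f (x - h) (x + h) c (y - h) = 0 by apply: Z; try lra; apply: Or44; lra.
have -> : bint f (x - h) (x + h) (y + h) d = 0 by apply: Z; try lra; apply: Or43; lra.
rewrite !add0r !addr0.
have -> : e * (8 * K) = K * (2 * (e + e + (e + e))) by ring.
apply: le_trans (bint_bound (K := K) _ _ _ _) _; [by lra|by lra| | | ].
- by move=> w rw; apply: Cf; apply: sub rw => //; lra.
- case=> u v /andP[/andP[A5 A6] /andP[A7 A8]]; apply: B.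
  apply: le_lt_trans (nm_le_ReIm _) _; rewrite /= in A5 A6 A7 A8 *.
  apply: le_lt_trans (_ : dl / 3 + dl / 3 < _); last by lra.
  by apply: lerD; rewrite ler_norml; apply/andP; split; lra.
- by rewrite ler_wpM2l // ler_pM2l //; lra.
Qed.

Lemma pdiff_shift (Phi : R -> C) t T (D : C) : pdiff Phi (t + T) D -> pdiff (fun y => Phi (y + T)) t D.
Proof.
move=> H e /H[dl dl0 {}H]; exists dl => // y yt.
have E : y + T - (t + T) = y - t by ring.
by have := H (y + T); rewrite E; apply.
Qed.

Lemma rint_period (phi : R -> C) c (T : R) : 0 <= T -> (forall t, pcont phi t) ->
  (forall t, phi (t + T) = phi t) -> rint phi c (c + T) = rint phi 0 T.
Proof.
move=> T0 H per.
pose A := Num.min 0 c; pose B := Num.max 0 c + T.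
have A0 : A <= 0 by rewrite ge_min lexx.
have Ac : A <= c by rewrite ge_min lexx orbT.
have B0 : 0 + T <= B by rewrite lerD2r le_max lexx.
have Bc : c + T <= B by rewrite lerD2r le_max lexx orbT.
have [||Phi D E] := @exists_rint _ phi A B; [by lra|by move=> *; exact: H|].
rewrite (E c (c + T)) ?lerDl // (E 0 T) //; last by lra.
have key u v : A <= u -> u <= v -> v + T <= B -> Phi (v + T) - Phi v = Phi (u + T) - Phi u.
  move=> Au uv vB; apply/eqP; rewrite -subr_eq0 -nm_eq0 eq_le nm_ge0 andbT.
  rewrite -[leRHS](mul0r (v - u)).
  apply: (@pdiff_bound _ (fun t => Phi (t + T) - Phi t) (fun=> 0)) =>
    // [t /andP[ut tv]|t _]; last by rewrite nm0.
  apply: pdiff_eqd (pdiffB (pdiff_shift (D _ _)) (D _ _)).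
  - by rewrite per subrr.
  - by apply/andP; split; lra.
  - by apply/andP; split; lra.
case/orP: (le_total 0 c) => c0.
  by rewrite (key 0 c) // add0r.
by rewrite -(key c 0) // ?add0r //; lra.
Qed.

(** The mean of [f] over the circle of radius [r]. As [dz = i z dt], a Cauchy integral of [g] is the
    mean of [z g(z)], so the Cauchy kernel takes the form [z / (z - w)]. *)
Definition cm f r : C := (2 * pi)^-1%:C%C * rint (fun t => f (r%:C%C * cis t)) 0 (2 * pi).

Lemma pcont_circ f r t : ccont f (r%:C%C * cis t) -> pcont (fun t => f (r%:C%C * cis t)) t.
Proof. by move=> H; exact: (pcont_comp (pdiff_cont (pdiffZ _ (pdiff_cis t))) H). Qed.

Definition circ_cont f r := forall z, nm z = r -> ccont f z.

Lemma circ_contD f g r : circ_cont f r -> circ_cont g r ->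
  circ_cont (fun z => f z + g z) r.
Proof. by move=> Hf Hg z zr; exact: ccontD (Hf z zr) (Hg z zr). Qed.

Lemma eq_cm f g r : 0 < r -> (forall z, nm z = r -> f z = g z) -> cm f r = cm g r.
Proof.
move=> r0 E; rewrite /cm; congr (_ * _); apply: eq_rint.
  exact: ltW pi2_gt0.
by move=> t _; rewrite E ?nm_circ.
Qed.

Lemma cmD f g r : 0 < r -> circ_cont f r -> circ_cont g r ->
  cm (fun z => f z + g z) r = cm f r + cm g r.
Proof.
move=> r0 Hf Hg; rewrite /cm -mulrDr; congr (_ * _).
have Hf' t : ccont f (r%:C%C * cis t) by apply: Hf; rewrite nm_circ.
have Hg' t : ccont g (r%:C%C * cis t) by apply: Hg; rewrite nm_circ.
apply: rintD => [|t _|t _|t _]; first exact: ltW pi2_gt0.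
- exact: pcont_circ.
- exact: pcont_circ.
- apply: (@pcont_circ (fun z => f z + g z)); exact: ccontD.
Qed.

Lemma cmZ (k : C) f r : 0 < r -> circ_cont f r -> cm (fun z => k * f z) r = k * cm f r.
Proof.
move=> r0 Hf; rewrite /cm mulrCA; congr (_ * _).
apply: rintZ => [|t _]; first exact: ltW pi2_gt0.
by apply/pcont_circ/Hf; rewrite nm_circ.
Qed.

Lemma cm_bound f r (K : R) : 0 < r -> circ_cont f r ->
  (forall z, nm z = r -> nm (f z) <= K) -> nm (cm f r) <= K.
Proof.
move=> r0 Hf B; rewrite /cm nmM nmR ger0_norm ?invr_ge0 ?(ltW pi2_gt0) //.
rewrite mulrC ler_pdivrMr ?pi2_gt0 //.
rewrite -[2 * pi in leRHS]subr0; apply: rint_bound => [|t _|t _].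
- exact: ltW pi2_gt0.
- by apply/pcont_circ/Hf; rewrite nm_circ.
- by apply: B; rewrite nm_circ.
Qed.

Lemma cm_cst (k : C) r : cm (fun=> k) r = k.
Proof.
rewrite /cm rint_cst ?(ltW pi2_gt0) // subr0 mulrCA -rmorphM /= mulVf ?mulr1 //.
by rewrite gt_eqF // pi2_gt0.
Qed.

Lemma cm_negpow r k : 0 < r -> cm (fun z => z^-1 ^+ k.+1) r = 0.
Proof.
move=> r0.
have rn0 t : r%:C%C * cis t != 0 :> C by rewrite -nm_gt0 nm_circ.
have k0 : (k.+1%:R : C) != 0 by rewrite pnatr_eq0.
have I2 : 'i%C * 'i%C = -1 :> C by rewrite -expr2 sqr_i.
rewrite /cm (@rintE _ (fun t => 'i%C / k.+1%:R * (r%:C%C * cis t)^-1 ^+ k.+1)).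
- by rewrite cis2pi cis0 subrr mulr0.
- exact: ltW pi2_gt0.
- move=> t _; apply: (@pcont_circ (fun z => z^-1 ^+ k.+1)).
  exact: cdiff_cont (cdiff_comp (cdiff_inv (rn0 t)) (cdiffX _ _)).
- move=> t _; apply: pdiff_eqd.
  2: { apply: pdiffZ; apply: (pdiff_comp (f := fun z => z^-1 ^+ k.+1)).
       - exact: pdiffZ (pdiff_cis t).
       - exact: cdiff_comp (cdiff_inv (rn0 t)) (cdiffX _ _). }
  rewrite /= exprS; move: (rn0 t) => {}rn0.
  have -> : r%:C%C * ('i%C * cis t) = 'i%C * (r%:C%C * cis t) by rewrite mulrCA.
  move: (r%:C%C * cis t) rn0 => z z0.
  transitivity (- ('i%C * 'i%C) * (k.+1%:R / k.+1%:R) * (z^-1 * z) * (z^-1 * z^-1 ^+ k)).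
    by rewrite I2 opprK divff // mulVf // !mul1r.
  ring.
Qed.

Lemma cis_eq1 (x : R) : `|x| <= pi -> cis x = 1 -> x = 0.
Proof.
move=> xp [c1 _]; apply/eqP; rewrite -normr_eq0; apply/eqP.
apply: (@cos_inj R); rewrite ?in_itv /= ?normr_ge0 ?lexx ?pi_ge0 //.
by rewrite cos0; case: (ger0P x) => _; rewrite ?cosN.
Qed.

(** The exponential maps the rectangle [[ln r1, ln r2] x [th - pi, th + pi]] onto the annulus. Its
    horizontal sides cancel by periodicity and its vertical sides give the two means. Taking for
    [th] the argument of [w0] makes its preimage in the rectangle unique and interior. *)
Lemma cm_exc f w0 r1 r2 : 0 < r1 -> r1 < nm w0 -> nm w0 < r2 ->
  (forall z, r1 <= nm z <= r2 -> z != w0 -> exists D, cdiff f z D) -> ccont f w0 ->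
  cm f r1 = cm f r2.
Proof.
move=> r10 r1w wr2 D Cw.
have w00 : w0 != 0 by rewrite -nm_gt0; exact: lt_trans r10 r1w.
have nw0 : 0 < nm w0 by rewrite nm_gt0.
have r20 : 0 < r2 := lt_trans nw0 wr2.
have [u0 Eu0 [Ru0 _]] := cexp_surj w00.
have I0 : 'i%C != 0 :> C by rewrite -nm_eq0 /= expr0n /= add0r expr1n sqrtr1 oner_eq0.
pose th := complex.Im u0; pose F u := f (cexp u).
have Cf z : r1 <= nm z <= r2 -> ccont f z.
  by move=> zr; have [->//|zw] := eqVneq z w0; have [? /cdiff_cont] := D z zr zw.
have a_b : ln r1 < ln (nm w0) < ln r2 by rewrite !ltr_ln ?posrE // r1w wr2.
have cexpr u : rect (ln r1) (ln r2) (th - pi) (th + pi) u -> r1 <= nm (cexp u) <= r2.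
  rewrite /rect nm_cexp /= => /andP[/andP[A1 A2] _].
  by rewrite -[r1]lnK ?posrE // -[r2]lnK ?posrE // !ler_expR A1 A2.
have J0 : bint F (ln r1) (ln r2) (th - pi) (th + pi) = 0.
  apply: (@goursat_exc _ _ _ _ _ u0).
  - by rewrite Ru0.
  - by have := pi_gt0 R; rewrite -/th; move=> ?; apply/andP; split; lra.
  - move=> u ru uu0; have [|dd Hd] := D (cexp u) (cexpr u ru).
      apply: contra uu0 => /eqP E.
      have E1 : complex.Re u = complex.Re u0.
        by have := congr1 nm (etrans E (esym Eu0)); rewrite !nm_cexp => /expR_inj.
      have E2 : complex.Im u = complex.Im u0.
        apply/eqP; rewrite -subr_eq0; apply/eqP; apply: cis_eq1.
          by move: ru => /andP[_ /andP[B1 B2]]; rewrite ler_norml -/th; apply/andP; split; lra.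
        have := etrans E (esym Eu0); rewrite /cexp E1 => /mulfI.
        rewrite -nm_eq0 nmR gtr0_norm ?expR_gt0 // gt_eqF ?expR_gt0 // => /(_ isT) E3.
        by apply: (mulIf (cis_neq0 (complex.Im u0))); rewrite -cisD subrK mul1r.
      by apply/eqP; case: (u) (u0) E1 E2 => [? ?] [? ?] /= -> ->.
    by exists (dd * cexp u); exact: cdiff_comp (cdiff_cexp u) Hd.
  - by rewrite -Eu0 in Cw; move=> e /Cw[dl dl0 H]; have [dl' dl'0 H'] := cdiff_cont (cdiff_cexp u0) dl0;
      exists dl' => // u /H' /H.
have per t : cis (t + 2 * pi) = cis t :> C by rewrite cisD cis2pi mulr1.
have cexpE (s t : R) : cexp (s +i* t)%C = (expR s)%:C%C * cis t by [].
have hor : rint (fun s => F (s +i* (th - pi))%C) (ln r1) (ln r2) =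
           rint (fun s => F (s +i* (th + pi))%C) (ln r1) (ln r2).
  apply: eq_rint => [|t _]; first by case/andP: a_b => A1 A2; exact: ltW (lt_trans A1 A2).
  have E : cis (th + pi) = cis (th - pi) by rewrite -(per (th - pi)); congr cis; ring.
  by rewrite /F !cexpE E.
have ver r : r1 <= r <= r2 ->
    rint (fun t => F (ln r +i* t)%C) (th - pi) (th + pi) = rint (fun t => f (r%:C%C * cis t)) 0 (2 * pi).
  move=> rr; have rr0 : 0 < r by case/andP: rr => A1 _; exact: lt_le_trans r10 A1.
  have -> : th + pi = (th - pi) + 2 * pi by ring.
  rewrite -(@rint_period _ (th - pi)); first last.
  - by move=> t; rewrite per.
  - by move=> t; apply/pcont_circ/Cf; rewrite nm_circ.
  - exact: ltW pi2_gt0.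
  apply: eq_rint => [|t _]; first by rewrite lerDl ltW // pi2_gt0.
  by rewrite /F cexpE lnK ?posrE.
have r12 : r1 <= r2 := ltW (lt_trans r1w wr2).
have V1 := ver r1; rewrite lexx r12 in V1; have {V1}V1 := V1 isT.
have V2 := ver r2; rewrite lexx r12 in V2; have {V2}V2 := V2 isT.
move: J0; rewrite /bint hor V1 V2 /cm => J0.
congr (_ * _); apply: (mulfI I0); apply/esym/eqP; rewrite -subr_eq0 -[X in _ == X]J0.
by apply/eqP; ring.
Qed.

Lemma cm_const f r1 r2 : 0 < r1 -> r1 <= r2 ->
  (forall z, r1 <= nm z <= r2 -> exists D, cdiff f z D) -> cm f r1 = cm f r2.
Proof.
move=> r10; rewrite le_eqVlt => /orP[/eqP->//|r12] D.
(* A point in the middle of the annulus plays the part of the exceptional one. *)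
have m0 : 0 < (r1 + r2) / 2 by lra.
have nE : nm ((r1 + r2) / 2)%:C%C = (r1 + r2) / 2 by rewrite nmR gtr0_norm.
apply: (@cm_exc _ ((r1 + r2) / 2)%:C%C); rewrite ?nE //; [by lra|by lra|by move=> z /D|].
have [|? /cdiff_cont//] := D ((r1 + r2) / 2)%:C%C.
by rewrite nE; apply/andP; split; lra.
Qed.

(** The mean does not depend on the radius and tends to [f 0] as the circle shrinks; at 0 continuity
    is enough. *)
Lemma cm_center f r rho : 0 < r < rho -> ccont f 0 ->
  (forall z, 0 < nm z < rho -> exists D, cdiff f z D) -> cm f r = f 0.
Proof.
move=> /andP[r0 rrho] C0 D.
apply/eqP; rewrite -subr_eq0 -nm_eq0 eq_le nm_ge0 andbT.
apply: (@le0_eps _ _ 1) => e e0; rewrite mulr1.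
have [dl dl0 H] := C0 e e0.
pose s := Num.min (dl / 2) r.
have s0 : 0 < s by rewrite lt_min divr_gt0.
have sr : s <= r by rewrite ge_min lexx orbT.
have sdl : s < dl by rewrite gt_min; apply/orP; left; lra.
rewrite -(@cm_const f s r) //; last first.
  by move=> z /andP[z1 z2]; apply: D; rewrite (lt_le_trans s0) // (le_lt_trans z2).
have Cf : circ_cont f s.
  move=> z zs; have [|? /cdiff_cont//] := D z.
  by rewrite zs s0 (le_lt_trans sr).
have -> : cm f s - f 0 = cm (fun z => f z + - f 0) s.
  by rewrite cmD // ?cm_cst // => z _; exact: cdiff_cont (cdiff_cst _ _).
apply: cm_bound => //.
  by apply: circ_contD => // z _; exact: cdiff_cont (cdiff_cst _ _).
by move=> z zs; apply/ltW/H; rewrite subr0 zs.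
Qed.

Lemma ccontM f g z : ccont f z -> ccont g z -> ccont (fun w => f w * g w) z.
Proof.
move=> Hf Hg e e0.
have [d1 d10 H1] := ccont_bound Hg.
pose K := nm (g z) + 1; pose L := nm (f z) + 1.
have K0 : 0 < K by have := nm_ge0 (g z); rewrite /K; lra.
have L0 : 0 < L by have := nm_ge0 (f z); rewrite /L; lra.
have [|d2 d20 H2] := Hf (e / 2 / K); first by rewrite !divr_gt0.
have [|d3 d30 H3] := Hg (e / 2 / L); first by rewrite !divr_gt0.
exists (Num.min (Num.min d1 d2) d3); first by rewrite !lt_min d10 d20.
move=> w; rewrite !lt_min => /andP[/andP[/H1 {}H1 /H2 {}H2] /H3 {}H3].
have -> : f w * g w - f z * g z = (f w - f z) * g w + f z * (g w - g z) by ring.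
apply: le_lt_trans (nmD _ _) _; rewrite !nmM.
have A : nm (f w - f z) * nm (g w) <= e / 2.
  apply: le_trans (_ : e / 2 / K * K <= _); last by rewrite divfK // gt_eqF.
  by apply: ler_pM; rewrite ?nm_ge0 // ltW.
have B : nm (f z) * nm (g w - g z) < e / 2.
  apply: le_lt_trans (_ : L * nm (g w - g z) < _).
    by rewrite ler_wpM2r ?nm_ge0 // /L; lra.
  by rewrite mulrC -ltr_pdivlMr.
lra.
Qed.

Lemma geo_lt (q K e : R) : 0 <= q < 1 -> 0 < e -> exists n : nat, K * q ^+ n < e.
Proof.
move=> /andP[q0 q1] e0; have K0 : 0 < `|K| + 1 by have := normr_ge0 K; lra.
have : (q ^+ n) @[n --> \oo] --> (0 : R) by apply: cvg_expr; rewrite ger0_norm.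
move=> /cvgrPdist_lt /(_ (e / (`|K| + 1)) (divr_gt0 e0 K0)) [n _ /(_ n (leqnn n))].
rewrite /= sub0r normrN ger0_norm ?exprn_ge0 // => H; exists n.
apply: le_lt_trans (_ : (`|K| + 1) * q ^+ n < _).
  by rewrite ler_wpM2r ?exprn_ge0 //; have := ler_norm K; lra.
by rewrite mulrC -ltr_pdivlMr.
Qed.

End Taylor.

(** * Cauchy's formula and Taylor's theorem *)

Section TaylorTheorem.
Variable R : realType.
Local Notation C := (R[i]).
Local Notation nm := (@normc R).
Implicit Types (f g : C -> C) (z w : C) (r e rho M : R).

Lemma circle_bound f r : 0 < r -> circ_cont f r ->
  exists2 M, 0 <= M & forall z, nm z = r -> nm (f z) <= M.
Proof.
move=> r0 H; pose phi t := nm (f (r%:C%C * cis t)).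
have cphi : continuous phi.
  move=> t; apply: rcont_continuous => e e0.
  have [|dl dl0 {}H] := pcont_circ (f := f) (r := r) (t := t) _ e0.
    by apply: H; rewrite nm_circ.
  exists dl => // y /H {}H; apply: le_lt_trans H; rewrite /phi ler_norml.
  have := nm_sub_le (f (r%:C%C * cis y)) (f (r%:C%C * cis t)).
  have := nm_sub_le (f (r%:C%C * cis t)) (f (r%:C%C * cis y)).
  by rewrite (nmBC (f (r%:C%C * cis t))) => ? ?; apply/andP; split; lra.
have [|c _ Hc] := @EVT_max R phi 0 (2 * pi) (ltW (pi2_gt0 R)).
  exact: continuous_subspaceT.
exists (phi c); first exact: nm_ge0.
move=> z zr; have z0 : z != 0 by rewrite -nm_gt0 zr.
have [t t2 E] := polar z0; rewrite E zr.
by apply: Hc; rewrite in_itv.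
Qed.

Definition dquot f w (d : C) z := if z == w then d else (f z - f w) / (z - w).

Lemma dquot_cont f w d : cdiff f w d -> ccont (dquot f w d) w.
Proof.
move=> H e e0; have e20 : 0 < e / 2 by lra.
have [dl dl0 {}H] := H _ e20; exists dl => // z zw.
rewrite /dquot eqxx; case: eqVneq => [_|zw0]; first by rewrite subrr nm0.
have n0 : 0 < nm (z - w) by rewrite nm_gt0 subr_eq0.
have zw1 : z - w != 0 by rewrite subr_eq0.
have -> : (f z - f w) / (z - w) - d = (f z - f w - d * (z - w)) / (z - w) by field.
apply: le_lt_trans (_ : e / 2 < e); last by lra.
by rewrite nmM nmV ler_pdivrMr // H.
Qed.

Lemma dquot_cdiff f w d z D : z != w -> cdiff f z D ->
  exists D', cdiff (dquot f w d) z D'.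
Proof.
move=> zw H; have zw0 : z - w != 0 by rewrite subr_eq0.
eexists; apply: (@cdiff_near _ (fun z => (f z - f w) * (z - w)^-1) _ _ _ (nm (z - w))).
- by rewrite nm_gt0.
- move=> v vz; rewrite /dquot; case: eqVneq => // vw.
  by move: vz; rewrite vw nmBC ltxx.
- apply: cdiffM; first exact: cdiffB H (cdiff_cst _ _).
  apply: (@cdiff_compV _ (fun z => z - w)) => //.
  exact: cdiffB (cdiff_id _) (cdiff_cst _ _).
Qed.

(* Remainder of the geometric expansion of the Cauchy kernel [z / (z - w)]. *)
Definition cauchy_rem w n z := (w / z) ^+ n * (z / (z - w)).

Lemma cauchy_rem_step w n z : z != 0 -> z != w ->
  cauchy_rem w n z = (w / z) ^+ n + cauchy_rem w n.+1 z.
Proof.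
move=> z0 zw; have zw0 : z - w != 0 by rewrite subr_eq0.
rewrite /cauchy_rem exprSr; move: ((w / z) ^+ n) => x.
by field; rewrite ?z0 ?zw0.
Qed.

Lemma nm_cauchy_rem w n r z : nm z = r -> nm w < r ->
  nm (cauchy_rem w n z) <= (nm w / r) ^+ n * (r / (r - nm w)).
Proof.
move=> zr wr; have r0 : 0 < r := le_lt_trans (nm_ge0 w) wr.
rewrite /cauchy_rem !(nmM, nmX, nmV) zr.
apply: ler_wpM2l; first by rewrite exprn_ge0 // divr_ge0 ?nm_ge0 // ltW.
apply: ler_wpM2l; first exact: ltW.
have rw : 0 < r - nm w by rewrite subr_gt0.
have H := nm_sub_le z w; rewrite zr in H.
by rewrite lef_pV2 ?posrE // (lt_le_trans rw).
Qed.

Section Expansion.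
Variables (w : C) (r : R).
Hypothesis (wr : nm w < r).
Let r0 : 0 < r := le_lt_trans (nm_ge0 w) wr.

Let circ_neq0 z : nm z = r -> z != 0.
Proof. by move=> zr; rewrite -nm_gt0 zr. Qed.

Let circ_neqw z : nm z = r -> z != w.
Proof. by move=> zr; apply/eqP => E; move: wr; rewrite -E zr ltxx. Qed.

Let circ_cont_rem n : circ_cont (cauchy_rem w n) r.
Proof.
move=> z zr; have z0 := circ_neq0 zr; have zw : z - w != 0 by rewrite subr_eq0 circ_neqw.
apply: (cdiff_cont (d := _)).
apply: cdiffM.
  apply: (@cdiff_comp _ (fun x => x ^+ n)); last exact: cdiffX.
  exact: cdiffZ (cdiff_inv z0).
apply: cdiffM; first exact: cdiff_id.
apply: (@cdiff_compV _ (fun z => z - w)) => //.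
exact: cdiffB (cdiff_id _) (cdiff_cst _ _).
Qed.

Let circ_cont_neg k : circ_cont (fun z => z^-1 ^+ k) r.
Proof.
move=> z zr; apply: (cdiff_cont (d := _)).
exact: (@cdiff_comp _ (fun x => x ^+ k) _ _ _ _ (cdiff_inv (circ_neq0 zr)) (cdiffX _ _)).
Qed.

Let circ_contM f g : circ_cont f r -> circ_cont g r -> circ_cont (fun z => f z * g z) r.
Proof. by move=> Hf Hg z zr; apply: ccontM; [exact: Hf|exact: Hg]. Qed.

Lemma cm_cauchy_expand g n : circ_cont g r ->
  cm (fun z => g z * cauchy_rem w 0 z) r =
  \sum_(k < n) w ^+ k * cm (fun z => g z * z^-1 ^+ k) r + cm (fun z => g z * cauchy_rem w n z) r.
Proof.
move=> Cg; elim: n => [|n IH]; first by rewrite big_ord0 add0r.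
rewrite IH big_ord_recr /= -addrA; congr (_ + _).
have Cgn : circ_cont (fun z => g z * z^-1 ^+ n) r by exact: circ_contM.
rewrite -cmZ // -cmD //; first last.
- exact: circ_contM.
- by apply: circ_contM => // z _; exact: cdiff_cont (cdiff_cst _ _).
apply: eq_cm => // z zr; rewrite (cauchy_rem_step n (circ_neq0 zr) (circ_neqw zr)).
by rewrite expr_div_n exprVn; ring.
Qed.

(** In the expansion of the kernel the powers [z ^- k] with [k >= 1] have mean 0, the constant term
    has mean 1, and the remainder tends to 0 geometrically. *)
Lemma cm_cauchy1 : cm (cauchy_rem w 0) r = 1.
Proof.
apply/eqP; rewrite -subr_eq0 -nm_eq0 eq_le nm_ge0 andbT.
apply: (@le0_eps _ _ 1) => e e0; rewrite mulr1.
have [|n Hn] := @geo_lt R (nm w / r) ((nm w / r) * (r / (r - nm w))) e _ e0.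
  by rewrite divr_ge0 ?nm_ge0 ?(ltW r0) //= ltr_pdivrMr // mul1r.
have C1 : circ_cont (fun=> 1 : C) r by move=> z _; exact: cdiff_cont (cdiff_cst _ _).
have := @cm_cauchy_expand (fun=> 1) n.+1 C1.
rewrite (@eq_cm _ _ (cauchy_rem w 0)) //; last by move=> z _; rewrite mul1r.
rewrite big_ord_recl expr0 mul1r [X in _ + X + _]big1; last first.
  move=> i _; rewrite (@eq_cm _ _ (fun z => z^-1 ^+ i.+1)) //; last by move=> z _; rewrite mul1r.
  by rewrite cm_negpow // mulr0.
rewrite (@eq_cm _ (fun z => 1 * z^-1 ^+ (@ord0 n)) (fun=> 1)) //; last by move=> z _; rewrite expr0 mulr1.
rewrite cm_cst addr0 => ->; rewrite addrAC subrr add0r.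
apply: le_trans (ltW Hn); apply: cm_bound => //.
  exact: circ_contM.
move=> z zr; rewrite mul1r; apply: (le_trans (nm_cauchy_rem n.+1 zr wr)).
by rewrite exprS mulrAC.
Qed.

(** The function [H z = z (f z - f w) / (z - w)] extends continuously to [w] and vanishes at 0, so
    its mean is 0; [cm_cauchy1] turns this into the formula. *)
Lemma cauchy_formula f rho : r < rho ->
  (forall z, nm z < rho -> exists d, cdiff f z d) ->
  f w = cm (fun z => f z * cauchy_rem w 0 z) r.
Proof.
move=> rrho D; have Cf z : nm z <= r -> ccont f z.
  by move=> zr; have [|? /cdiff_cont//] := D z; exact: le_lt_trans rrho.
have Ccf : circ_cont f r by move=> z zr; apply: Cf; rewrite zr.
have [d Hd] := D w (lt_trans wr rrho).
pose H z := z * dquot f w d z.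
have DH z : nm z < rho -> z != w -> exists d, cdiff H z d.
  move=> zr zw; have [D1 HD1] := D z zr; have [D2 HD2] := dquot_cdiff d zw HD1.
  by eexists; apply: cdiffM (cdiff_id z) HD2.
have CHw : ccont H w.
  by apply: ccontM (dquot_cont Hd); exact: cdiff_cont (cdiff_id _).
have CH0 : ccont H 0.
  have [->//|w0] := eqVneq 0 w.
  by have [|? /cdiff_cont//] := DH 0 _ w0; rewrite nm0 (lt_trans r0).
have CH : circ_cont H r.
  by move=> z zr; have [|? /cdiff_cont//] := DH z _ (circ_neqw zr); rewrite zr.
have cmH : cm H r = 0.
  (* For [w = 0] the centre itself is the exceptional point. Otherwise the circle is moved across
     [w] to radius [nm w / 2], then shrunk to 0. *)
  have [w0|w0] := eqVneq w 0.
    rewrite (@cm_center _ H r rho) ?r0 //; first by rewrite /H mul0r.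
    move=> z /andP[z0 zr]; apply: DH => //.
    by rewrite w0 -nm_gt0.
  have nw0 : 0 < nm w by rewrite nm_gt0.
  rewrite -(@cm_exc _ H w (nm w / 2) r) //; [|by lra|by lra|].
    rewrite (@cm_center _ H (nm w / 2) (nm w)) //; first by rewrite /H mul0r.
      by apply/andP; split; lra.
    move=> z /andP[z0 zw]; apply: DH; first exact: lt_trans (lt_trans wr rrho).
    by apply/eqP => E; move: zw; rewrite E ltxx.
  move=> z /andP[_ zr] zw; apply: DH => //; exact: le_lt_trans rrho.
have E : cm H r = cm (fun z => f z * cauchy_rem w 0 z) r - f w * cm (cauchy_rem w 0) r.
  rewrite -mulNr -cmZ // -cmD //; first last.
  - by apply: circ_contM => // z _; exact: cdiff_cont (cdiff_cst _ _).
  - exact: circ_contM.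
  apply: eq_cm => // z zr; rewrite /H /dquot (negbTE (circ_neqw zr)) /cauchy_rem expr0 mul1r.
  by ring.
by apply/esym/eqP; rewrite -subr_eq0 -[X in _ - X]mulr1 -cm_cauchy1 -E cmH.
Qed.

End Expansion.

(** The coefficients are the means of [f z / z ^ k] at radius [rho / 2], equal to those at every
    other radius by [cm_const]; hence one sequence serves all [r] and [M]. The remainder is the mean
    against [cauchy_rem]. *)
Theorem taylor f rho : 0 < rho -> (forall z, nm z < rho -> exists d, cdiff f z d) ->
  exists a : nat -> C, forall r M, 0 < r < rho -> (forall z, nm z = r -> nm (f z) <= M) ->
    (forall n, nm (a n) <= M / r ^+ n) /\
    (forall w n, nm w < r ->
      nm (f w - \sum_(k < n) a k * w ^+ k) <= M * ((nm w / r) ^+ n * (r / (r - nm w)))).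
Proof.
move=> rho0 D; pose A k r := cm (fun z => f z * z^-1 ^+ k) r.
have DA k z : 0 < nm z < rho -> exists d, cdiff (fun z => f z * z^-1 ^+ k) z d.
  move=> /andP[z0 zr]; have [d Hd] := D z zr.
  rewrite nm_gt0 in z0; eexists; apply: cdiffM Hd _.
  exact: (@cdiff_comp _ (fun x => x ^+ k) _ _ _ _ (cdiff_inv z0) (cdiffX _ _)).
have AE k r : 0 < r < rho -> A k r = A k (rho / 2).
  move=> /andP[r0 rr]; have r2 : 0 < rho / 2 by lra.
  case/orP: (le_total r (rho / 2)) => H; [|apply/esym]; apply: cm_const => // z /andP[z1 z2];
    apply: DA; apply/andP; split; lra.
exists (fun k => A k (rho / 2)) => r M rr B; have /andP[r0 rrho] := rr.
have Cf : circ_cont f r by move=> z zr; have [|? /cdiff_cont//] := D z; rewrite zr.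
have CA k : circ_cont (fun z => f z * z^-1 ^+ k) r.
  by move=> z zr; have [|? /cdiff_cont//] := DA k z; rewrite zr.
split=> [n|w n wr].
  rewrite -(AE _ r) //; apply: cm_bound => // z zr.
  by rewrite nmM nmX nmV zr exprVn ler_pM2r ?invr_gt0 ?exprn_gt0 // B.
rewrite (cauchy_formula wr rrho D) (cm_cauchy_expand wr n Cf).
have -> : \sum_(k < n) A k (rho / 2) * w ^+ k = \sum_(k < n) w ^+ k * A k r.
  by apply: eq_bigr => k _; rewrite AE // mulrC.
rewrite addrAC subrr add0r; apply: cm_bound => // [z zr|z zr].
  apply: ccontM; first exact: Cf.
  have z0 : z != 0 by rewrite -nm_gt0 zr.
  have zw : z - w != 0 by rewrite subr_eq0; apply/eqP => E; move: wr; rewrite -E zr ltxx.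
  apply: (cdiff_cont (d := _)); apply: cdiffM.
    apply: (@cdiff_comp _ (fun x => x ^+ n)); last exact: cdiffX.
    exact: cdiffZ (cdiff_inv z0).
  apply: cdiffM; first exact: cdiff_id.
  apply: (@cdiff_compV _ (fun z => z - w)) => //.
  exact: cdiffB (cdiff_id _) (cdiff_cst _ _).
rewrite nmM; apply: ler_pM; rewrite ?nm_ge0 ?B //.
exact: nm_cauchy_rem.
Qed.

End TaylorTheorem.

(** * Power series *)

Section PowerSeries.
Variable R : realType.
Local Notation C := (R[i]).
Local Notation nm := (@normc R).
Implicit Types (f g : C -> C) (z w : C) (r e rho K M Q q : R).

(** The intervals around the partial sums whose radius is the geometric tail are nested; a common
    point is the sum, and comes with its error bound. *)
Lemma real_series (c : nat -> R) K q : 0 <= q < 1 -> (forall n, `|c n| <= K * q ^+ n) ->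
  exists S, forall n, `|S - \sum_(k < n) c k| <= K * q ^+ n / (1 - q).
Proof.
move=> /andP[q0 q1] H; have q10 : 0 < 1 - q by rewrite subr_gt0.
pose s n := \sum_(k < n) c k; pose t n := K * q ^+ n / (1 - q).
have tS n : t n = K * q ^+ n + t n.+1.
  by rewrite /t exprS; field; rewrite gt_eqF.
have K0 : 0 <= K by have := H 0%N; rewrite expr0 mulr1; exact: le_trans.
have sS n : s n.+1 = s n + c n by rewrite /s big_ord_recr.
have := @nested_point R (fun n => s n - t n) (fun n => s n + t n).
case=> [n|n|n|S HS].
- by have := H n; rewrite sS (tS n) ler_norml => /andP[? ?]; lra.
- by have := H n; rewrite sS (tS n) ler_norml => /andP[? ?]; lra.
- have : 0 <= t n by rewrite divr_ge0 ?mulr_ge0 ?exprn_ge0 // ltW.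
  lra.
exists S => n; have /andP[? ?] := HS n; rewrite -/(s n) -/(t n) ler_norml.
by apply/andP; split; lra.
Qed.

Lemma complex_series (c : nat -> C) K q : 0 <= q < 1 -> (forall n, nm (c n) <= K * q ^+ n) ->
  exists S, forall n, nm (S - \sum_(k < n) c k) <= 2 * (K * q ^+ n / (1 - q)).
Proof.
move=> q01 H.
have [|A HA] := @real_series (fun n => complex.Re (c n)) K q q01.
  by move=> n; apply: le_trans (Re_le_nm _) (H n).
have [|B HB] := @real_series (fun n => complex.Im (c n)) K q q01.
  by move=> n; apply: le_trans (Im_le_nm _) (H n).
exists (A +i* B)%C => n; apply: le_trans (nm_le_ReIm _) _.
have -> : \sum_(k < n) c k =
    ((\sum_(k < n) complex.Re (c k)) +i* (\sum_(k < n) complex.Im (c k)))%C.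
  elim: n => [|n IH]; first by rewrite !big_ord0.
  by rewrite !big_ord_recr IH /=; case: (c n).
by have := HA n; have := HB n; rewrite /=; lra.
Qed.

Lemma cdiff_shift f (a : C) z d : cdiff f (a + z) d -> cdiff (fun w => f (a + w)) z d.
Proof.
move=> H; apply: cdiff_eqd (cdiff_comp (g := fun w => a + w) (dg := 1) _ H).
  by rewrite mulr1.
by apply: cdiff_eqd (cdiffD (cdiff_cst a z) (cdiff_id z)); rewrite add0r.
Qed.

Lemma cdiff_unshift f (a : C) z d : cdiff (fun w => f (a + w)) z d -> cdiff f (a + z) d.
Proof.
move=> H; apply: (@cdiff_ext _ (fun w => f (a + (- a + w)))).
  by move=> w; rewrite addrA subrr add0r.
by apply: (@cdiff_shift (fun w => f (a + w))); rewrite addKr.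
Qed.

Lemma quadratic_cdiff f z d (K dl : R) : 0 < dl -> (forall w, nm (w - z) < dl ->
  nm (f w - f z - d * (w - z)) <= K * nm (w - z) ^+ 2) -> cdiff f z d.
Proof.
move=> dl0 H e e0; have K0 : 0 < `|K| + 1 by have := normr_ge0 K; lra.
exists (Num.min dl (e / (`|K| + 1))); first by rewrite lt_min dl0 divr_gt0.
move=> w; rewrite lt_min => /andP[/H {}H wz]; apply: (le_trans H).
rewrite expr2 mulrA ler_wpM2r ?nm_ge0 //.
apply: le_trans (_ : (`|K| + 1) * nm (w - z) <= _).
  by rewrite ler_wpM2r ?nm_ge0 //; have := ler_norm K; lra.
by rewrite mulrC -ler_pdivlMr // ltW.
Qed.

(** The remainder depends on [f] only through a bound on one circle, and [d] is the same for all
    circles: in this uniform shape the estimate passes to limits. *)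
Lemma taylor2 f (a : C) rho : 0 < rho -> (forall z, nm (z - a) < rho -> exists d, cdiff f z d) ->
  exists2 d, cdiff f a d & forall r M, 0 < r < rho -> (forall z, nm (z - a) = r -> nm (f z) <= M) ->
    forall w, nm (w - a) <= r / 2 ->
      nm (f w - f a - d * (w - a)) <= 2 * M / r ^+ 2 * nm (w - a) ^+ 2.
Proof.
move=> rho0 D; have [|c Hc] := @taylor R (fun z => f (a + z)) rho rho0.
  move=> z zr; have [|d Hd] := D (a + z); first by rewrite addrAC subrr add0r.
  by exists d; exact: cdiff_shift.
have key r M : 0 < r < rho -> (forall z, nm (z - a) = r -> nm (f z) <= M) ->
    forall w, nm (w - a) <= r / 2 ->
      nm (f w - f a - c 1%N * (w - a)) <= 2 * M / r ^+ 2 * nm (w - a) ^+ 2.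
  move=> rr B w wr; have /andP[r0 rrho] := rr.
  have [|_ H] := Hc r M rr; first by move=> z zr; apply: B; rewrite addrAC subrr add0r.
  have M0 : 0 <= M.
    by apply: le_trans (nm_ge0 (f (a + r%:C%C))) (B _ _); rewrite addrAC subrr add0r nmR gtr0_norm.
  have c0 : c 0%N = f a.
    have := H 0 1%N; rewrite nm0 big_ord1 expr0 mulr1 expr1 !mul0r mulr0 addr0 => /(_ r0) A.
    by apply/esym/eqP; rewrite -subr_eq0 -nm_eq0 eq_le A nm_ge0.
  have aw : a + (w - a) = w by ring.
  have := H (w - a) 2%N; rewrite aw !big_ord_recl big_ord0 /= /bump /= expr0 expr1 c0 mulr1 addr0.
  rewrite opprD addrA; have wr' : nm (w - a) < r by lra.
  move=> /(_ wr') A; apply: (le_trans A).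
  have rw : 0 < r - nm (w - a) by rewrite subr_gt0.
  have -> : 2 * M / r ^+ 2 * nm (w - a) ^+ 2 = M * ((nm (w - a) / r) ^+ 2 * 2).
    by rewrite expr_div_n; ring.
  rewrite ler_wpM2l // ler_wpM2l ?exprn_ge0 ?divr_ge0 ?nm_ge0 ?(ltW r0) //.
  by rewrite ler_pdivrMr //; lra.
exists (c 1%N) => //.
have r20 : 0 < rho / 2 < rho by apply/andP; split; lra.
have [||M _ HM] := @circle_bound R (fun z => f (a + z)) (rho / 2); first by lra.
  move=> z zr; have [|d Hd] := D (a + z); first by rewrite addrAC subrr add0r zr; lra.
  exact: cdiff_cont (cdiff_shift Hd).
apply: (@quadratic_cdiff _ _ _ (2 * M / (rho / 2) ^+ 2) (rho / 2 / 2)); first by lra.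
move=> w wr; apply: key => //; last exact: ltW.
move=> z zr; have := HM (z - a) zr; have -> // : a + (z - a) = z by ring.
Qed.

(** The quadratic remainder of [taylor2] has one constant for all [P n], so it survives the
    pointwise limit and makes [D] the derivative of [g]. *)
Lemma cdiff_limit (P : nat -> C -> C) (d : nat -> C) g z (D : C) r M : 0 < r ->
  (forall n w, nm (w - z) < 2 * r -> exists d, cdiff (P n) w d) ->
  (forall n w, nm (w - z) = r -> nm (P n w) <= M) ->
  (forall w e, nm (w - z) < r -> 0 < e -> exists N, forall n, (N <= n)%N -> nm (g w - P n w) <= e) ->
  (forall n, cdiff (P n) z (d n)) ->
  (forall e, 0 < e -> exists N, forall n, (N <= n)%N -> nm (D - d n) <= e) ->
  cdiff g z D.
Proof.
move=> r0 dP B Pg dd dD.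
apply: (@quadratic_cdiff _ _ _ (2 * M / r ^+ 2) (r / 2)); first by lra.
move=> w wr; rewrite -subr_le0; apply: (@le0_eps _ _ 3) => e e0.
have [|N1 H1] := Pg w e _ e0; first by lra.
have [|N2 H2] := Pg z e _ e0; first by rewrite subrr nm0.
have e'0 : 0 < e / (nm (w - z) + 1) by rewrite divr_gt0 // ltr_wpDl // nm_ge0.
have [N3 H3] := dD _ e'0.
pose n := maxn N1 (maxn N2 N3).
have /H1 {}H1 : (N1 <= n)%N by rewrite leq_maxl.
have /H2 {}H2 : (N2 <= n)%N by rewrite leq_max leq_max leqnn orbT.
have /H3 {}H3 : (N3 <= n)%N by rewrite leq_max leq_max leqnn !orbT.
have r2 : 0 < 2 * r by lra.
have [d' Hd' T] := taylor2 r2 (dP n).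
have rr : 0 < r < 2 * r by apply/andP; split; lra.
have {T} := T r M rr (B n) w (ltW wr).
rewrite (cdiff_unique Hd' (dd n)) => T.
have -> : g w - g z - D * (w - z) = (g w - P n w) - (g z - P n z)
    - (D - d n) * (w - z) + (P n w - P n z - d n * (w - z)) by ring.
have A : nm ((D - d n) * (w - z)) <= e.
  rewrite nmM; apply: le_trans (_ : e / (nm (w - z) + 1) * (nm (w - z) + 1) <= _).
    by apply: ler_pM; rewrite ?nm_ge0 //; lra.
  by rewrite divfK // gt_eqF // ltr_wpDl // nm_ge0.
have := nmD (g w - P n w - (g z - P n z) - (D - d n) * (w - z)) (P n w - P n z - d n * (w - z)).
have := nmB (g w - P n w - (g z - P n z)) ((D - d n) * (w - z)).
have := nmB (g w - P n w) (g z - P n z).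
lra.
Qed.

Definition psum (b : nat -> C) n z := \sum_(k < n) b k * z ^+ k.

Lemma cdiff_psum b n z : cdiff (psum b n.+1) z (psum (fun k => k.+1%:R * b k.+1) n z).
Proof.
rewrite /psum; elim: n => [|n IH].
  rewrite big_ord0; apply: (@cdiff_ext _ (fun=> b 0%N)); last exact: cdiff_cst.
  by move=> w; rewrite big_ord1 expr0 mulr1.
rewrite big_ord_recr.
apply: (@cdiff_ext _ (fun z => \sum_(k < n.+1) b k * z ^+ k + b n.+1 * z ^+ n.+1)).
  by move=> w; rewrite [LHS]big_ord_recr.
apply: cdiffD => //; apply: cdiff_eqd (cdiffZ _ (cdiffX _ _)).
by rewrite /=; ring.
Qed.

Lemma psum_cdiff b n z : exists d, cdiff (psum b n) z d.
Proof.
case: n => [|n]; last by eexists; exact: cdiff_psum.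
exists 0; apply: (@cdiff_ext _ (fun=> 0)); last exact: cdiff_cst.
by move=> w; rewrite /psum big_ord0.
Qed.

Lemma geo_sum_le (q : R) n : 0 <= q < 1 -> \sum_(k < n) q ^+ k <= (1 - q)^-1.
Proof.
move=> /andP[q0 q1]; have q10 : 0 < 1 - q by rewrite subr_gt0.
rewrite -div1r ler_pdivlMr // mulrC -[1 - q]opprB mulNr -subrX1 opprB.
by rewrite lerBlDr lerDl exprn_ge0.
Qed.

Lemma psum_bound b K Q n z : (forall n, nm (b n) <= K * Q ^+ n) -> 0 <= Q -> Q * nm z < 1 ->
  nm (psum b n z) <= K / (1 - Q * nm z).
Proof.
move=> H Q0 z1; have q0 : 0 <= Q * nm z by rewrite mulr_ge0 ?nm_ge0.
have K0 : 0 <= K by have := H 0%N; rewrite expr0 mulr1; apply: le_trans; exact: nm_ge0.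
apply: le_trans (nm_sum _ _ _) _.
apply: le_trans (_ : \sum_(k < n) K * (Q * nm z) ^+ k <= _).
  apply: ler_sum => k _; rewrite nmM nmX exprMn mulrA ler_wpM2r ?exprn_ge0 ?nm_ge0 //.
by rewrite -mulr_sumr ler_wpM2l // geo_sum_le // q0.
Qed.

Lemma geo_small K q e : 0 <= q < 1 -> 0 < e -> 0 <= K ->
  exists N, forall n, (N <= n)%N -> K * q ^+ n <= e.
Proof.
move=> q01 e0 K0; have [N HN] := geo_lt K q01 e0; exists N => n Nn.
apply: le_trans (ltW HN); rewrite ler_wpM2l //; case/andP: q01 => q0 q1.
by apply: ler_wiXn2l => //; exact: ltW.
Qed.

Lemma psum_limit (b : nat -> C) K Q : 0 < Q -> (forall n, nm (b n) <= K * Q ^+ n) ->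
  exists g : C -> C, forall z, Q * nm z < 1 -> forall n,
    nm (g z - psum b n z) <= 2 * K / (1 - Q * nm z) * (Q * nm z) ^+ n.
Proof.
move=> Q0 H.
have ex z : exists S, Q * nm z < 1 -> forall n,
    nm (S - psum b n z) <= 2 * K / (1 - Q * nm z) * (Q * nm z) ^+ n.
  have [z1|z1] := ltP (Q * nm z) 1; last by exists 0 => ?.
  have q0 : 0 <= Q * nm z < 1 by rewrite z1 mulr_ge0 ?nm_ge0 // ltW.
  have [|S HS] := @complex_series (fun k => b k * z ^+ k) K _ q0.
    by move=> n; rewrite nmM nmX exprMn mulrA ler_wpM2r ?exprn_ge0 ?nm_ge0.
  exists S => _ n; apply: (le_trans (HS n)); rewrite le_eqVlt; apply/orP; left.
  by apply/eqP; ring.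
by have [g Hg] := choice ex; exists g.
Qed.

Lemma psum_limit_cdiff (b : nat -> C) K Q g z (D : C) : 0 < Q ->
  (forall n, nm (b n) <= K * Q ^+ n) ->
  (forall z, Q * nm z < 1 -> forall n,
    nm (g z - psum b n z) <= 2 * K / (1 - Q * nm z) * (Q * nm z) ^+ n) ->
  Q * nm z < 1 ->
  (forall e, 0 < e -> exists N, forall n, (N <= n)%N ->
     nm (D - psum (fun k => k.+1%:R * b k.+1) n z) <= e) ->
  cdiff g z D.
Proof.
move=> Q0 H G z1 HD.
have K0 : 0 <= K by have := H 0%N; rewrite expr0 mulr1; apply: le_trans; exact: nm_ge0.
pose r := (Q^-1 - nm z) / 2.
have r0 : 0 < r by rewrite /r divr_gt0 // subr_gt0 -div1r ltr_pdivlMr // mulrC.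
have near w : nm (w - z) <= r -> Q * nm w <= (1 + Q * nm z) / 2.
  move=> wz; have -> : (1 + Q * nm z) / 2 = Q * (r + nm z).
    by rewrite /r; field; rewrite gt_eqF.
  by rewrite ler_pM2l //; have := nm_sub_le w z; lra.
apply: (@cdiff_limit (fun n => psum b n.+1) (fun n => psum (fun k => k.+1%:R * b k.+1) n z)
          _ _ _ r (K / (1 - (1 + Q * nm z) / 2)) r0 _ _ _ _ HD).
- by move=> n w _; exact: psum_cdiff.
- move=> n w wz; have A := near w; rewrite wz lexx in A; have {}A := A isT.
  apply: le_trans (psum_bound _ H (ltW Q0) _) _; first by lra.
  by rewrite ler_wpM2l // lef_pV2 ?posrE; lra.
- move=> w e wz e0; have A := near w (ltW wz); have w1 : Q * nm w < 1 by lra.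
  have [||N HN] := @geo_small (2 * K / (1 - Q * nm w)) (Q * nm w) e _ e0.
  + by rewrite w1 mulr_ge0 ?nm_ge0 // ltW.
  + by rewrite divr_ge0 ?mulr_ge0 // subr_ge0 ltW.
  exists N => n Nn; apply: le_trans (G w w1 n.+1) _; apply: HN.
  exact: leq_trans Nn (leqnSn _).
- by move=> n; exact: cdiff_psum.
Qed.

(** Since [n + 1 <= 2 ^ n], the differentiated series has coefficients at most [K Q (2 Q) ^ n]; this
    crude factor 2 is what halves the disk. *)
Lemma psum_limit_cdiff2 (b : nat -> C) K Q g z : 0 < Q ->
  (forall n, nm (b n) <= K * Q ^+ n) ->
  (forall z, Q * nm z < 1 -> forall n,
    nm (g z - psum b n z) <= 2 * K / (1 - Q * nm z) * (Q * nm z) ^+ n) ->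
  2 * Q * nm z < 1 -> exists D, cdiff g z D.
Proof.
move=> Q0 H G z1.
have K0 : 0 <= K by have := H 0%N; rewrite expr0 mulr1; apply: le_trans; exact: nm_ge0.
have H' n : nm (n.+1%:R * b n.+1) <= (K * Q) * (2 * Q) ^+ n.
  rewrite nmM (_ : nm n.+1%:R = n.+1%:R); last first.
    by rewrite -(rmorph_nat (real_complex R)) nmR ger0_norm.
  apply: le_trans (_ : 2 ^+ n * (K * Q ^+ n.+1) <= _).
    by apply: ler_pM; rewrite ?nm_ge0 // -natrX ler_nat ltn_expl.
  by rewrite exprMn exprS le_eqVlt; apply/orP; left; apply/eqP; ring.
have Q20 : 0 < 2 * Q by rewrite mulr_gt0.
have [g' G'] := psum_limit Q20 H'.
exists (g' z); apply: (psum_limit_cdiff Q0 H G).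
  have q0 : 0 <= Q * nm z by rewrite mulr_ge0 ?nm_ge0 // ltW.
  by lra.
move=> e e0.
have [||N HN] := @geo_small (2 * (K * Q) / (1 - 2 * Q * nm z)) (2 * Q * nm z) e _ e0.
- by rewrite z1 mulr_ge0 ?nm_ge0 // ltW.
- by rewrite divr_ge0 ?mulr_ge0 ?subr_ge0 // ltW.
by exists N => n /HN; apply: le_trans; exact: G'.
Qed.

End PowerSeries.

(** * Mean value inequality, inversion, logarithm *)

Section HolomorphicTools.
Variable R : realType.
Local Notation C := (R[i]).
Local Notation nm := (@normc R).
Implicit Types (f g F : C -> C) (a c z w : C) (r e rho K M q : R).

Lemma nm_convex z w a r t : nm (z - a) < r -> nm (w - a) < r -> 0 <= t <= 1 ->
  nm (w + t%:C%C * (z - w) - a) < r.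
Proof.
move=> zr wr /andP[t0 t1].
have -> : w + t%:C%C * (z - w) - a = t%:C%C * (z - a) + (1 - t)%:C%C * (w - a).
  by rewrite rmorphB /=; ring.
apply: le_lt_trans (nmD _ _) _; rewrite !nmM !nmR !ger0_norm ?subr_ge0 //.
have [->|t0'] := eqVneq t 0; first by rewrite mul0r add0r subr0 mul1r.
have tp : 0 < t by rewrite lt_neqAle eq_sym t0'.
have : t * nm (z - a) < t * r by rewrite ltr_pM2l.
have : (1 - t) * nm (w - a) <= (1 - t) * r by rewrite ler_wpM2l ?subr_ge0 // ltW.
lra.
Qed.

Lemma mean_value_ineq F (dF : C -> C) a c r e :
  (forall z, nm (z - a) < r -> cdiff F z (dF z)) ->
  (forall z, nm (z - a) < r -> nm (dF z - c) <= e) ->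
  forall z w, nm (z - a) < r -> nm (w - a) < r -> nm (F z - F w - c * (z - w)) <= e * nm (z - w).
Proof.
move=> D B z w zr wr.
pose l t := w + t%:C%C * (z - w).
have := @pdiff_bound R (fun t => F (l t) - c * l t) (fun t => dF (l t) * (z - w) - c * (z - w)) 0 1
  (e * nm (z - w)) ler01.
have lin t : 0 <= t <= 1 -> nm (l t - a) < r by exact: nm_convex.
have l1 : l 1 = z by rewrite /l mul1r addrC subrK.
have l0 : l 0 = w by rewrite /l mul0r addr0.
rewrite subr0 mulr1 l1 l0; have -> : F z - c * z - (F w - c * w) = F z - F w - c * (z - w) by ring.
apply=> t t01; first by apply: pdiffB;
  [exact: pdiff_comp (pdiff_line w (z - w) t) (D _ (lin t t01)) | exact: pdiffZ (pdiff_line w (z - w) t)].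
by rewrite -mulrBl nmM ler_wpM2r ?nm_ge0 // B // lin.
Qed.

Lemma deriv0_cst F a r : (forall z, nm (z - a) < r -> cdiff F z 0) ->
  forall z w, nm (z - a) < r -> nm (w - a) < r -> F z = F w.
Proof.
move=> D z w zr wr.
have := @mean_value_ineq F (fun=> 0) a 0 r 0 D _ z w zr wr.
rewrite !mul0r !subr0 => H; apply/eqP; rewrite -subr_eq0 -nm_eq0 eq_le nm_ge0 andbT.
by apply: H => u _; rewrite nm0.
Qed.

Lemma covering F a c r : 0 < r -> c != 0 ->
  (forall z w, nm (z - a) < r -> nm (w - a) < r ->
     nm (F z - F w - c * (z - w)) <= nm c / 2 * nm (z - w)) ->
  forall v, nm (v - F a) < nm c * r / 2 -> exists2 z, nm (z - a) < r & F z = v.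
Proof.
move=> r0 c0 H v vr; have nc : 0 < nm c by rewrite nm_gt0.
pose s := nm (v - F a) / nm c.
have s0 : 0 <= s by rewrite divr_ge0 ?nm_ge0.
have sr : 2 * s < r by rewrite mulrC -ltr_pdivlMr // ltr_pdivrMr // mulrC mulrA.
pose T z := z - (F z - v) / c.
pose x n := iter n T a.
have step z : T z - z = - ((F z - v) / c) by rewrite /T; ring.
have xS n : x n.+1 = x n - (F (x n) - v) / c by [].
have xE n : F (x n) - v = - c * (x n.+1 - x n) by rewrite xS; field.
have key n : nm (x n.+1 - x n) <= s * 2^-1 ^+ n /\ nm (x n - a) <= 2 * s * (1 - 2^-1 ^+ n).
  elim: n => [|n [IH1 IH2]].
    split; last by rewrite /x /= !subrr nm0 mulr0.
    by rewrite expr0 mulr1 /x /= step nmN nmM nmV nmBC.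
  have p0 : 0 <= s * 2^-1 ^+ n by rewrite mulr_ge0 // exprn_ge0.
  have e2 : 2^-1 ^+ n.+1 = 2^-1 ^+ n / 2 :> R by rewrite exprSr.
  have B2 : nm (x n.+1 - a) <= 2 * s * (1 - 2^-1 ^+ n.+1).
    apply: le_trans (nm_triangle (x n) _ _) _; rewrite e2; move: IH1 IH2 p0; lra.
  split=> //.
  have xr : nm (x n - a) < r by move: IH2 p0; lra.
  have xr' : nm (x n.+1 - a) < r.
    have p1 : 0 <= s * 2^-1 ^+ n.+1 by rewrite mulr_ge0 // exprn_ge0.
    by move: B2 p1; lra.
  have -> : x n.+2 - x n.+1 = - ((F (x n.+1) - F (x n) - c * (x n.+1 - x n)) / c).
    rewrite (xS n.+1) [LHS](_ : _ = - ((F (x n.+1) - F (x n) + (F (x n) - v)) / c)).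
      by rewrite xE mulNr.
    by field.
  rewrite nmN nmM nmV ler_pdivrMr //; apply: (le_trans (H _ _ xr' xr)).
  rewrite e2; have := ler_wpM2l (ltW nc) IH1; lra.
have [||S HS] := @complex_series R (fun n => x n.+1 - x n) s (2^-1).
- by rewrite invr_ge0 invf_lt1 ?ltr1n //= ler0n.
- by move=> n; have [] := key n.
have sumE n : \sum_(k < n) (x k.+1 - x k) = x n - a.
  elim: n => [|n IH]; first by rewrite big_ord0 subrr.
  by rewrite big_ord_recr IH /=; ring.
pose z := a + S.
have zx n : nm (z - x n) <= 4 * s * 2^-1 ^+ n.
  have := HS n; rewrite sumE /z; have -> : S - (x n - a) = a + S - x n by ring.
  by have -> : 1 - 2^-1 = 2^-1 :> R by [lra]; rewrite invrK; lra.
have zr : nm (z - a) < r.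
  have [||n Hn] := @geo_lt R 2^-1 (4 * s) (r - 2 * s) _ _.
  - by rewrite invr_ge0 invf_lt1 ?ltr1n //= ler0n.
  - by rewrite subr_gt0.
  apply: le_lt_trans (nm_triangle (x n) _ _) _.
  have [_ B] := key n; have := zx n.
  have p0 : 0 <= s * 2^-1 ^+ n by rewrite mulr_ge0 // exprn_ge0.
  by move: B p0 Hn; lra.
exists z => //; apply/eqP; rewrite -subr_eq0 -nm_eq0 eq_le nm_ge0 andbT.
apply: (@le0_eps _ _ 1) => e e0; rewrite mulr1.
have [|n Hn] := @geo_lt R 2^-1 (8 * nm c * s) e _ e0.
  by rewrite invr_ge0 invf_lt1 ?ltr1n //= ler0n.
have [B1 B2] := key n; have B3 := zx n.
have p0 : 0 <= s * 2^-1 ^+ n by rewrite mulr_ge0 // exprn_ge0.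
have xr : nm (x n - a) < r by move: B2 p0; lra.
have -> : F z - v = (F z - F (x n) - c * (z - x n)) + c * (z - x n) + (F (x n) - v) by ring.
have A1 := H _ _ zr xr.
have A2 : nm (c * (z - x n)) <= nm c * (4 * s * 2^-1 ^+ n) by rewrite nmM ler_pM2l.
have A3 : nm (F (x n) - v) <= nm c * (s * 2^-1 ^+ n) by rewrite xE nmM nmN ler_pM2l.
have A4 : nm c / 2 * nm (z - x n) <= nm c / 2 * (4 * s * 2^-1 ^+ n) by rewrite ler_pM2l // divr_gt0.
have := nmD (F z - F (x n) - c * (z - x n) + c * (z - x n)) (F (x n) - v).
have := nmD (F z - F (x n) - c * (z - x n)) (c * (z - x n)).
have : 0 <= nm c * (s * 2^-1 ^+ n) by rewrite mulr_ge0 // ltW.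
lra.
Qed.

Lemma taylor_near f a rho : 0 < rho -> (forall z, nm (z - a) < rho -> exists d, cdiff f z d) ->
  exists b K Q, [/\ 0 < Q, forall n, nm (b n) <= K * Q ^+ n &
    forall z, Q * nm z < 1 -> forall n,
      nm (f (a + z) - psum b n z) <= 2 * K / (1 - Q * nm z) * (Q * nm z) ^+ n].
Proof.
move=> rho0 D; have [|b Hb] := @taylor R (fun z => f (a + z)) rho rho0.
  move=> z zr; have [|d Hd] := D (a + z); first by rewrite addrAC subrr add0r.
  by exists d; exact: cdiff_shift.
have r2 : 0 < rho / 2 < rho by apply/andP; split; lra.
have r20 : 0 < rho / 2 by case/andP: r2.
have [|M M0 HM] := @circle_bound R (fun z => f (a + z)) (rho / 2) r20.
  move=> z zr; have [|d Hd] := D (a + z); first by rewrite addrAC subrr add0r zr; lra.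
  exact: cdiff_cont (cdiff_shift Hd).
have [B1 B2] := Hb _ M r2 HM.
exists b, M, (rho / 2)^-1; split=> [|n|z z1 n]; first by rewrite invr_gt0.
  by rewrite exprVn.
have zr : nm z < rho / 2 by move: z1; rewrite mulrC ltr_pdivrMr // mul1r.
apply: le_trans (B2 z n zr) _; rewrite (mulrC _^-1).
have q1 : 0 < 1 - nm z / (rho / 2) by rewrite subr_gt0 ltr_pdivrMr // mul1r.
have -> : rho / 2 / (rho / 2 - nm z) = (1 - nm z / (rho / 2))^-1.
  have h1 : rho / 2 - nm z != 0 by rewrite gt_eqF // subr_gt0.
  move: (rho / 2) h1 r20 => s h1 /gt_eqF/negbT h2.
  by field; rewrite ?h1 ?h2.
set q := (1 - _)^-1; set x := _ ^+ n.
have q0 : 0 <= q by rewrite /q invr_ge0 ltW.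
have x0 : 0 <= x by rewrite exprn_ge0 // divr_ge0 ?nm_ge0 // ltW.
have := mulr_ge0 M0 (mulr_ge0 x0 q0); lra.
Qed.

(** Near [a] the derivative is the sum of the differentiated Taylor series, itself a power
    series. *)
Lemma deriv_cdiff f (df : C -> C) a rho : 0 < rho ->
  (forall z, nm (z - a) < rho -> cdiff f z (df z)) -> exists d, cdiff df a d.
Proof.
move=> rho0 D; have [|b [K [Q [Q0 Hb Hf]]]] := @taylor_near f a rho rho0.
  by move=> z zr; exists (df z); exact: D.
have K0 : 0 <= K by have := Hb 0%N; rewrite expr0 mulr1; apply: le_trans; exact: nm_ge0.
pose b' k := k.+1%:R * b k.+1.
have Hb' n : nm (b' n) <= (K * Q) * (2 * Q) ^+ n.
  rewrite nmM (_ : nm n.+1%:R = n.+1%:R); last first.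
    by rewrite -(rmorph_nat (real_complex R)) nmR ger0_norm.
  apply: le_trans (_ : 2 ^+ n * (K * Q ^+ n.+1) <= _).
    by apply: ler_pM; rewrite ?nm_ge0 // -natrX ler_nat ltn_expl.
  by rewrite exprMn exprS le_eqVlt; apply/orP; left; apply/eqP; ring.
have Q20 : 0 < 2 * Q by rewrite mulr_gt0.
have [g' G'] := psum_limit Q20 Hb'.
have E z : 2 * Q * nm z < 1 -> cdiff (fun z => f (a + z)) z (g' z).
  move=> z1; have q0 : 0 <= Q * nm z by rewrite mulr_ge0 ?nm_ge0 // ltW.
  apply: (psum_limit_cdiff Q0 Hb Hf); first by lra.
  move=> e e0; have [||N HN] := @geo_small _ (2 * (K * Q) / (1 - 2 * Q * nm z)) (2 * Q * nm z) e _ e0.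
  - by rewrite z1 mulr_ge0 ?nm_ge0 // ltW.
  - by rewrite divr_ge0 ?mulr_ge0 ?subr_ge0 // ltW.
  by exists N => n /HN; apply: le_trans; exact: G'.
have [|d Hd] := psum_limit_cdiff2 (z := 0) Q20 Hb' G'; first by rewrite nm0 mulr0.
exists d; rewrite -[a]addr0; apply: cdiff_unshift.
have m0 : 0 < Num.min rho (2 * Q)^-1 by rewrite lt_min rho0 invr_gt0.
apply: cdiff_near m0 _ Hd => z; rewrite subr0 lt_min => /andP[z1 z2].
apply: cdiff_unique (E z _); first by apply: cdiff_shift; apply: D; rewrite addrAC subrr add0r.
by rewrite -ltr_pdivlMl // mulr1.
Qed.

Lemma exists_cprimitive f r rho : 0 < r < rho -> (forall z, nm z < rho -> exists d, cdiff f z d) ->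
  exists F, forall z, nm z < r -> cdiff F z (f z).
Proof.
move=> /andP[r0 rrho] D; have [c Hc] := taylor (lt_trans r0 rrho) D.
have [|M M0 HM] := @circle_bound R f r r0.
  by move=> z zr; have [|? /cdiff_cont//] := D z; rewrite zr.
have rr : 0 < r < rho by rewrite r0.
have [B1 B2] := Hc r M rr HM.
pose b n := if n is k.+1 then c k / k.+1%:R else 0.
have Q0 : 0 < r^-1 by rewrite invr_gt0.
have Hb n : nm (b n) <= M * r * r^-1 ^+ n.
  case: n => [|n]; first by rewrite /b nm0 expr0 mulr1 mulr_ge0 // ltW.
  rewrite /b nmM nmV (_ : nm n.+1%:R = n.+1%:R); last first.
    by rewrite -(rmorph_nat (real_complex R)) nmR ger0_norm.
  rewrite ler_pdivrMr ?ltr0n // exprS mulrA mulfK ?gt_eqF // exprVn.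
  apply: (le_trans (B1 n)); rewrite ler_peMr ?ler1n //.
  by rewrite divr_ge0 // exprn_ge0 // ltW.
have [F HF] := psum_limit Q0 Hb; exists F => z zr.
have z1 : r^-1 * nm z < 1 by rewrite mulrC ltr_pdivrMr // mul1r.
apply: (psum_limit_cdiff Q0 Hb HF z1) => e e0.
have E n : psum (fun k => k.+1%:R * b k.+1) n z = \sum_(k < n) c k * z ^+ k.
  apply: eq_bigr => k _; congr (_ * _); rewrite /b.
  have : (k.+1%:R : C) != 0 by rewrite pnatr_eq0.
  by move=> k0; field.
have [||N HN] := @geo_small _ (M * (r / (r - nm z))) (nm z / r) e _ e0.
- by rewrite divr_ge0 ?nm_ge0 ?(ltW r0) //= ltr_pdivrMr // mul1r.
- by rewrite mulr_ge0 // divr_ge0 ?subr_ge0 // ltW.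
exists N => n /HN; apply: le_trans; rewrite E; apply: le_trans (B2 z n zr) _.
by rewrite mulrAC mulrA.
Qed.

(** With [L] a primitive of [u' / u] adjusted at 0, the product [u exp (- L)] has derivative 0 and
    value 1 at 0. *)
Lemma exists_clog (u du : C -> C) r rho : 0 < r < rho ->
  (forall z, nm z < rho -> cdiff u z (du z)) -> (forall z, nm z < rho -> u z != 0) ->
  exists L, forall z, nm z < r -> cdiff L z (du z / u z) /\ cexp (L z) = u z.
Proof.
move=> /andP[r0 rrho] D u0.
have Dd z : nm z < rho -> exists d, cdiff du z d.
  move=> zr; apply: (@deriv_cdiff u du z (rho - nm z)); first by rewrite subr_gt0.
  move=> w wz; apply: D; have := nm_sub_le w z; lra.
have [||F HF] := @exists_cprimitive (fun z => du z / u z) r rho.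
- by rewrite r0.
- move=> z zr; have [d Hd] := Dd z zr; eexists; apply: cdiffM Hd _.
  exact: cdiff_compV (u0 z zr) (D z zr).
have u00 : u 0 != 0 by apply: u0; rewrite nm0 (lt_trans r0).
have [l El _] := cexp_surj u00.
pose L z := F z + (l - F 0).
have DL z : nm z < r -> cdiff L z (du z / u z).
  by move=> /HF H; apply: cdiff_eqd (cdiffD H (cdiff_cst _ _)); rewrite addr0.
exists L => z zr; split; first exact: DL.
have DE w : nm (w - 0) < r -> cdiff (fun w => u w * cexp (- L w)) w 0.
  rewrite subr0 => wr; have wrho := lt_trans wr rrho.
  apply: cdiff_eqd (cdiffM (D w wrho) (cdiff_comp (cdiffN (DL w wr)) (cdiff_cexp _))).
  have := u0 w wrho; move: (cexp _) (u w) => x y y0.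
  by field.
have := deriv0_cst DE (z := z) (w := 0); rewrite !subr0 nm0 => /(_ zr r0).
have -> : L 0 = l by rewrite /L; ring.
rewrite -El -cexpD subrr cexp0 => E.
have EL : cexp (L z) * cexp (- L z) = 1 by rewrite -cexpD subrr cexp0.
by apply: (mulIf (cexp_neq0 (- L z))); rewrite EL E.
Qed.

Definition bigO n f := exists K dl : R, 0 < dl /\ forall z, nm z < dl -> nm (f z) <= K * nm z ^+ n.

(** Cauchy's inequality on small circles kills every Taylor coefficient: vanishing to order [n + 1]
    bounds [a n] by a multiple of the radius. *)
Lemma flat_eq0 f rho : (forall z, nm z < rho -> exists d, cdiff f z d) ->
  (forall n, bigO n f) -> forall z, nm z < rho -> f z = 0.
Proof.
move=> D O z zr; have rho0 : 0 < rho := le_lt_trans (nm_ge0 z) zr.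
have [a Ha] := taylor rho0 D.
have a0 n : a n = 0.
  apply/eqP; rewrite -nm_eq0 eq_le nm_ge0 andbT.
  have [K [dl [dl0 HK]]] := O n.+1.
  apply: (@le0_eps _ _ K) => e e0.
  pose r := Num.min e (Num.min (dl / 2) (rho / 2)).
  have r0 : 0 < r by rewrite !lt_min e0 !divr_gt0.
  have : r <= r by []; rewrite {2}/r !le_min => /andP[re /andP[rdl rr]].
  have K0 : 0 <= K.
    have rd : nm r%:C%C < dl by rewrite nmR gtr0_norm //; lra.
    have := le_trans (nm_ge0 _) (HK _ rd); rewrite nmR gtr0_norm //.
    by rewrite pmulr_lge0 ?exprn_gt0.
  have rrho : 0 < r < rho by apply/andP; split; lra.
  have [|B _] := Ha r (K * r ^+ n.+1) rrho.
    by move=> w wr; rewrite -wr; apply: HK; rewrite wr; lra.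
  apply: (le_trans (B n)); rewrite exprS mulrA mulfK ?expf_neq0 ?gt_eqF // mulrC.
  by rewrite ler_wpM2r.
pose r := (nm z + rho) / 2.
have := nm_ge0 z => nz.
have rr : 0 < r < rho by rewrite /r; apply/andP; split; lra.
have r0 : 0 < r by case/andP: rr.
have [|M M0 HM] := @circle_bound R f r r0.
  by move=> w wr; have [|? /cdiff_cont//] := D w; rewrite wr; case/andP: rr.
have [_ B] := Ha r M rr HM.
have zr' : nm z < r by rewrite /r; lra.
apply/eqP; rewrite -nm_eq0 eq_le nm_ge0 andbT; apply: (@le0_eps _ _ 1) => e e0; rewrite mulr1.
have [|n Hn] := @geo_lt R (nm z / r) (M * (r / (r - nm z))) e _ e0.
  by rewrite divr_ge0 ?nm_ge0 ?(ltW r0) //= ltr_pdivrMr // mul1r.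
have := B z n zr'; rewrite big1 ?subr0 => [H|k _]; last by rewrite a0 mul0r.
by apply: (le_trans H); rewrite mulrA mulrAC ltW.
Qed.

Lemma near_eq0 f rho dl : (forall z, nm z < rho -> exists d, cdiff f z d) -> 0 < dl ->
  (forall z, nm z < dl -> f z = 0) -> forall z, nm z < rho -> f z = 0.
Proof.
move=> D dl0 H; apply: flat_eq0 => // n; exists 0, dl; split=> // z /H ->.
by rewrite nm0 mul0r.
Qed.

End HolomorphicTools.

(** * A bound for univalent functions *)

Section UnivalentBound.
Variable R : realType.
Local Notation C := (R[i]).
Local Notation nm := (@normc R).
Implicit Types (f g L : C -> C) (a c z w : C) (r rho M : R).

Lemma ccont_comp f g z : ccont f z -> ccont g (f z) -> ccont (fun w => g (f w)) z.
Proof.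
move=> Hf Hg e /Hg[dl dl0 {}Hg]; have [dl' dl'0 {}Hf] := Hf _ dl0.
by exists dl' => // w /Hf /Hg.
Qed.

Lemma exists_deriv f r : (forall z, nm z < r -> exists d, cdiff f z d) ->
  exists df, forall z, nm z < r -> cdiff f z (df z).
Proof.
move=> D; have ex z : exists d, nm z < r -> cdiff f z d.
  by have [/D[d' ?]|_] := boolP (nm z < r); [exists d'|exists 0].
by have [df H] := choice ex; exists df.
Qed.

Lemma cauchy_ineq f a rho r M : 0 < r < rho ->
  (forall z, nm (z - a) < rho -> exists d, cdiff f z d) ->
  (forall z, nm (z - a) = r -> nm (f z) <= M) -> forall z, nm (z - a) < r ->
    nm (f z) <= M * (r / (r - nm (z - a))) /\
    nm (f z - f a) <= M * (nm (z - a) / (r - nm (z - a))).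
Proof.
move=> rr D B z zr; have /andP[r0 rrho] := rr.
have [||b Hb] := @taylor R (fun z => f (a + z)) rho; first exact: lt_trans rrho.
  move=> w wr; have [|d Hd] := D (a + w); first by rewrite addrAC subrr add0r.
  by exists d; exact: cdiff_shift.
have [|_ H] := Hb r M rr; first by move=> w wr; apply: B; rewrite addrAC subrr add0r.
have az : a + (z - a) = z by ring.
split; first by have := H (z - a) 0%N zr; rewrite az big_ord0 subr0 expr0 mul1r.
have b0 : b 0%N = f a.
  have := H 0 1%N; rewrite nm0 big_ord1 expr0 mulr1 expr1 !mul0r mulr0 addr0 => /(_ r0) A.
  by apply/esym/eqP; rewrite -subr_eq0 -nm_eq0 eq_le A nm_ge0.
have := H (z - a) 1%N zr; rewrite az big_ord1 expr0 mulr1 b0 expr1.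
by rewrite [_ / r * _]mulrA divfK // gt_eqF.
Qed.

(* Bloch's theorem with a non-optimal constant: a point where
   [(r - |z - a|) |l z|] is within a factor two of its supremum is the centre of
   a disk on which [l] is nearly constant. *)
Lemma bloch L (l : C -> C) a rho r : 0 < r < rho ->
  (forall z, nm (z - a) < rho -> cdiff L z (l z)) ->
  exists v0, forall v, nm (v - v0) < nm (l a) * r / 256 ->
    exists2 z, nm (z - a) < rho & L z = v.
Proof.
move=> /andP[r0 rrho] D.
have [la0|la0] := eqVneq (l a) 0.
  by exists 0 => v; rewrite la0 nm0 !mul0r ltNge nm_ge0.
have Dl z : nm (z - a) < rho -> exists d, cdiff l z d.
  move=> zr; apply: (@deriv_cdiff R L l z (rho - nm (z - a))); first by rewrite subr_gt0.
  by move=> w wz; apply: D; have := nm_triangle z w a; lra.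
pose s := (r + rho) / 2.
have s0 : 0 < s by rewrite /s; lra.
have srho : s < rho by rewrite /s; lra.
have ss : 0 < s < rho by rewrite s0.
have [|M M0 HM] := @circle_bound R (fun z => l (a + z)) s s0.
  move=> z zs; have [|d Hd] := Dl (a + z); first by rewrite addrAC subrr add0r zs.
  exact: cdiff_cont (cdiff_shift Hd).
have HM' z : nm (z - a) = s -> nm (l z) <= M.
  by move=> /HM; have -> : a + (z - a) = z by ring.
pose phi z := (r - nm (z - a)) * nm (l z).
pose A := [set phi z | z in [set z | nm (z - a) < r]].
have ubA : has_ubound A.
  exists (r * (M * (s / (s - r)))) => _ [z /= zr <-].
  have rs : r < s by rewrite /s; lra.
  have zs : nm (z - a) < s by exact: lt_trans zr rs.
  have [B _] := cauchy_ineq ss Dl HM' zs.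
  apply: ler_pM; rewrite ?nm_ge0 ?subr_ge0 ?(ltW zr) //; first by rewrite gerBl nm_ge0.
  apply: (le_trans B); rewrite ler_wpM2l // ler_pM2l // lef_pV2 ?posrE ?subr_gt0 //.
  by rewrite lerD2l lerN2 ltW.
have Aa : A (phi a) by exists a => //=; rewrite subrr nm0.
have supA : has_sup A by split => //; exists (phi a).
pose S := sup A.
have phiS z : nm (z - a) < r -> phi z <= S by move=> zr; apply: ub_le_sup => //; exists z.
have phia : phi a = nm (l a) * r by rewrite /phi subrr nm0 subr0 mulrC.
have S0 : 0 < S.
  apply: lt_le_trans (phiS a _); last by rewrite subrr nm0.
  by rewrite phia mulr_gt0 // nm_gt0.
have [|_ [b /= br <-] Hb] := @sup_adherent R A (S / 2) _ supA; first by lra.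
have {}Hb : S / 2 < phi b by move: Hb; rewrite -/S; lra.
pose t := r - nm (b - a).
have t0 : 0 < t by rewrite subr_gt0.
have phib : phi b = t * nm (l b) by [].
have nlb : 0 < nm (l b).
  by rewrite -(pmulr_rgt0 _ t0) -phib; lra.
have inb z k : nm (z - b) < t * k -> 0 <= k -> k <= 1 -> nm (z - a) < r.
  move=> zb k0 k1; have := nm_triangle b z a.
  have : t * k <= t by rewrite ler_piMr // ltW.
  by rewrite /t in zb *; lra.
(* One factor 2 is the loss of distance to the boundary, the other is the near-maximality of [b]. *)
have l4 z : nm (z - b) < t / 2 -> nm (l z) <= 4 * nm (l b).
  move=> zb; have zr := inb z _ zb.
  have {}zr : nm (z - a) < r by apply: zr; lra.
  have H := phiS z zr.
  have A1 : t / 2 <= r - nm (z - a) by have := nm_triangle b z a; rewrite /t in zb *; lra.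
  have A2 : t / 2 * nm (l z) <= phi z by rewrite /phi ler_wpM2r // nm_ge0.
  by rewrite -(ler_pM2l t0); move: Hb A2 H; rewrite phib; lra.
have r4 : 0 < t / 4 < t / 2 by apply/andP; split; lra.
have Dlb z : nm (z - b) < t / 2 -> exists d, cdiff l z d.
  move=> zb; apply: Dl; apply: lt_trans rrho.
  by apply: (inb z _ zb); lra.
have Hl z : nm (z - b) < t / 64 -> nm (l z - l b) <= nm (l b) / 2.
  move=> zb.
  have [||_ B] := @cauchy_ineq l b (t / 2) (t / 4) (4 * nm (l b)) r4 Dlb _ z.
  - by move=> w wb; apply: l4; rewrite wb; lra.
  - by lra.
  apply: (le_trans B).
  have q : nm (z - b) / (t / 4 - nm (z - b)) <= 1 / 8.
    by rewrite ler_pdivrMr; lra.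
  apply: le_trans (ler_wpM2l _ q) _; first by rewrite mulr_ge0 // ltW.
  by lra.
have t64 : 0 < t / 64 by lra.
have lb0 : l b != 0 by rewrite -nm_gt0.
have DL z : nm (z - b) < t / 64 -> nm (z - a) < rho.
  by move=> zb; apply: lt_trans rrho; apply: (inb z _ zb); lra.
have Lip z w : nm (z - b) < t / 64 -> nm (w - b) < t / 64 ->
    nm (L z - L w - l b * (z - w)) <= nm (l b) / 2 * nm (z - w).
  apply: (mean_value_ineq (dF := l)) => // u ub; exact/D/DL.
exists (L b) => v vb.
(* The covered disk has radius [|l b| t / 128 = phi b / 128], and [phi b > S / 2 >= |l a| r / 2]:
   hence the constant 256. *)
have [|z zb <-] := covering t64 lb0 Lip (v := v).
  apply: lt_le_trans vb _.
  have := phiS a; rewrite subrr nm0 phia => /(_ r0) P1.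
  by move: Hb; rewrite phib; lra.
by exists z => //; exact: DL.
Qed.

(** The function [z / f z] takes at 0 the value [1 / d], of modulus 1, which is its mean over
    [|z| = 1 / 2]. If [|f| >= 1] held on that circle, the mean would be at most [1 / 2]. *)
Lemma univalent_small_value f d : (forall z, nm z < 1 -> exists d, cdiff f z d) ->
  (forall z w, nm z < 1 -> nm w < 1 -> f z = f w -> z = w) ->
  f 0 = 0 -> nm d = 1 -> cdiff f 0 d -> exists2 w, nm w = 1 / 2 & nm (f w) < 1.
Proof.
move=> D inj f0 d1 Hd.
have d0 : d != 0 by rewrite -nm_eq0 d1 oner_eq0.
have fz0 z : nm z < 1 -> z != 0 -> f z != 0.
  by move=> z1; apply: contra => /eqP E; apply/eqP/inj; rewrite ?nm0 // f0.
pose p z := (dquot f 0 d z)^-1.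
have pE z : z != 0 -> p z = z / f z.
  by move=> z0; rewrite /p /dquot (negbTE z0) f0 !subr0 invf_div.
have p0 : p 0 = d^-1 by rewrite /p /dquot eqxx.
have Cp0 : ccont p 0.
  apply: (ccont_comp (dquot_cont Hd)).
  by apply: cdiff_cont (cdiff_inv _); rewrite /dquot eqxx.
have Dp z : 0 < nm z < 1 -> exists d, cdiff p z d.
  move=> /andP[z0 z1]; rewrite nm_gt0 in z0; have [D1 HD1] := D z z1.
  have [D2 HD2] := dquot_cdiff d z0 HD1.
  eexists; apply: cdiff_compV HD2.
  by rewrite /dquot (negbTE z0) f0 !subr0 mulf_neq0 ?invr_neq0 // fz0.
have h01 : 0 < (1 / 2 : R) < 1 by apply/andP; split; lra.
have Cp : circ_cont p (1 / 2).
  by move=> z zr; have [|? /cdiff_cont//] := Dp z; rewrite zr.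
apply: contrapT => N.
have : nm (cm p (1 / 2)) <= 1 / 2.
  apply: cm_bound; [by lra|by []|move=> z zr].
  have z0 : z != 0 by rewrite -nm_gt0 zr; lra.
  have z1 : nm z < 1 by rewrite zr; lra.
  rewrite pE // nmM nmV zr ler_pdivrMr ?nm_gt0 ?fz0 // ler_peMr; [by []|by lra|].
  by rewrite leNgt; apply/negP => fz; apply: N; exists z.
rewrite (cm_center h01 Cp0 Dp) p0 nmV d1 invr1; lra.
Qed.

(** From [f = f w (1 - u)] with [|f w| < 1] and [|u| <= exp (256 pi)]; the exponent is the bound
    [2048 pi] on the derivative of [log u] times the radius [1 / 8]. *)
Definition univalent_cst : R := 1 + expR (256 * pi).

(** The omitted value comes from [univalent_small_value]: it is attained on [|w| = 1 / 2], hence by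
    injectivity not inside. Two values of the logarithm differing by [2 pi i] would give two points
    with the same image under [f]. *)
Theorem univalent_bound f d : (forall z, nm z < 1 -> exists d, cdiff f z d) ->
  (forall z w, nm z < 1 -> nm w < 1 -> f z = f w -> z = w) ->
  f 0 = 0 -> nm d = 1 -> cdiff f 0 d -> forall z, nm z < 1 / 8 -> nm (f z) <= univalent_cst.
Proof.
move=> D inj f0 d1 Hd.
have [w wr fw] := univalent_small_value D inj f0 d1 Hd.
have w0 : w != 0 by rewrite -nm_gt0 wr; lra.
have fw0 : f w != 0.
  apply/eqP => E; case/eqP: w0; apply: inj; rewrite ?nm0 ?wr ?f0 //; lra.
have [df Hdf] := exists_deriv D.
pose u z := 1 - f z / f w; pose du z := - (df z / f w).
have Du z : nm z < 1 / 2 -> cdiff u z (du z).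
  move=> zr; have z1 : nm z < 1 by lra.
  apply: cdiff_ext (cdiff_eqd _ (cdiffB (cdiff_cst 1 z) (cdiffZ (f w)^-1 (Hdf z z1)))) => [v|].
    by rewrite /u mulrC.
  by rewrite /du sub0r mulrC.
have u0 z : nm z < 1 / 2 -> u z != 0.
  move=> zr; rewrite /u subr_eq0 eq_sym; apply/eqP => E.
  have E1 : f z = f w by rewrite -[f z](divfK fw0) E mul1r.
  have : z = w by apply: inj => //; [lra|rewrite wr; lra].
  by move=> E2; move: zr; rewrite E2 wr ltxx.
have r38 : 0 < (3 / 8 : R) < 1 / 2 by apply/andP; split; lra.
have [L HL] := exists_clog r38 Du u0.
(* [bloch] at radius [1 / 8] covers a disk of radius [|L' a| / 2048]; if this exceeded [pi], both
   [v0 + i pi] and [v0 - i pi] would be values of [L]. *)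
have lb a : nm a < 1 / 8 -> nm (du a / u a) <= 2048 * pi.
  move=> a8; rewrite leNgt; apply/negP => H.
  have r8 : 0 < (1 / 8 : R) < 1 / 4 by apply/andP; split; lra.
  have in38 z : nm (z - a) < 1 / 4 -> nm z < 3 / 8 by move=> za; have := nm_sub_le z a; lra.
  have [|v0 Hv] := @bloch L (fun z => du z / u z) a (1 / 4) (1 / 8) r8.
    by move=> z /in38 /HL[].
  have big (s : R) : `|s| = pi -> exists2 z, nm (z - a) < 1 / 4 & L z = v0 + (0 +i* s)%C.
    move=> sp; apply: Hv; rewrite addrAC subrr add0r nmI expr0n /= add0r sqrtr_sqr sp.
    by lra.
  have [|z1 z1a E1] := big pi; first by rewrite gtr0_norm // pi_gt0.
  have [|z2 z2a E2] := big (- pi); first by rewrite normrN gtr0_norm // pi_gt0.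
  have E : L z1 = L z2 + (0 +i* (2 * pi))%C.
    rewrite E1 E2 -addrA addcE addr0; congr (_ + (_ +i* _)%C); ring.
  have [_ U1] := HL z1 (in38 z1 z1a); have [_ U2] := HL z2 (in38 z2 z2a).
  have UE : u z1 = u z2 by rewrite -U1 -U2 E cexp2pi.
  have fE : f z1 = f z2.
    move: UE; rewrite /u => /addrI /oppr_inj /mulIf; apply.
    by rewrite invr_neq0.
  have zE : z1 = z2.
    by apply: inj => //; [have := in38 _ z1a|have := in38 _ z2a]; lra.
  move: E; rewrite zE -[X in X = _]addr0 => /addrI [] /eqP.
  by rewrite eq_sym gt_eqF // pi2_gt0.
move=> z z8.
have := @mean_value_ineq R L (fun z => du z / u z) 0 0 (1 / 8) (2048 * pi) _ _ z 0.
rewrite !subr0 nm0 mul0r subr0 => H.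
have {}H : nm (L z - L 0) <= 2048 * pi * nm z.
  have h8 : 0 < 1 / 8 :> R by lra.
  apply: H => // v; rewrite !subr0 => v8; last exact: lb.
  by have [|] := HL v; first lra.
have {}H : nm (L z - L 0) <= 256 * pi.
  by apply: (le_trans H); have := pi_gt0 R => p0; have := ler_wpM2l (ltW p0) (ltW z8); lra.
have [|_ Uz] := HL z; first lra.
have [|_ U0] := HL 0; first by rewrite nm0; lra.
have uz : u z = cexp (L z - L 0).
  have -> : u z = cexp (L z - L 0) * u 0 by rewrite -U0 -Uz -cexpD subrK.
  by rewrite /u f0 mul0r subr0 mulr1.
have nu : nm (u z) <= expR (256 * pi).
  rewrite uz nm_cexp ler_expR; apply: le_trans H; apply: le_trans (Re_le_nm _).
  exact: ler_norm.
have -> : f z = f w * (1 - u z) by rewrite /u; field.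
rewrite nmM -[univalent_cst]mul1r; apply: ler_pM; rewrite ?nm_ge0 ?(ltW fw) //.
by apply: le_trans (nmB _ _) _; rewrite nm1 /univalent_cst lerD2l.
Qed.

End UnivalentBound.

(** * Small divisors *)

Section GaussArithmetic.
Variables (R : realType) (N : nat).
Implicit Types (alpha : 'I_N -> R) (w i : 'I_N) (word : nat -> 'I_N) (x e : R).

Lemma nearest_int x : exists a : int, `|a%:~R - x| <= 1 / 2.
Proof.
exists (Num.floor (x + 1 / 2)).
have := floor_le (x + 1 / 2); have := floorD1_gt (x + 1 / 2).
rewrite intrD => A B; rewrite ler_norml; apply/andP; split; lra.
Qed.

Lemma int_norm_ge1 (a : int) : a != 0 -> 1 <= `|a%:~R : R|.
Proof. by move=> a0; rewrite -intr_norm -[1]/(1%:~R) ler_int -gtz0_ge1 normr_gt0. Qed.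

Lemma int_far x e (P : int) : P != 0 -> 0 <= x <= 1 / 2 -> `|x - P%:~R| <= e -> 1 / 2 <= e.
Proof.
move=> /int_norm_ge1 P1 /andP[x0 x2] H.
have := ler_normD (P%:~R - x) x; rewrite subrK (distrC P%:~R) (ger0_norm x0); lra.
Qed.

(** An integer nearest to the quotient by [alpha w] realises the minimum, so the default of [xget]
    in [gauss_coef] is not taken. *)
Lemma gauss_coefP alpha w i : 0 < alpha w ->
  `|(gauss_coef alpha w i)%:~R * alpha w - alpha_hat alpha w i| <= 1 / 2 * alpha w.
Proof.
move=> aw; have [a Ha] := nearest_int (alpha_hat alpha w i / alpha w).
have E (k : int) : `|k%:~R * alpha w - alpha_hat alpha w i| =
    `|k%:~R - alpha_hat alpha w i / alpha w| * alpha w.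
  rewrite -[RHS](_ : `|k%:~R - alpha_hat alpha w i / alpha w| * `|alpha w| = _).
    by rewrite -normrM mulrBl divfK // gt_eqF.
  by rewrite (gtr0_norm aw).
set S := [set a : int | forall k : int, `|a%:~R * alpha w - alpha_hat alpha w i|
      <= `|k%:~R * alpha w - alpha_hat alpha w i|].
have Sa : S a.
  move=> k; rewrite !E ler_pM2r //.
  have [->//|ka] := eqVneq k a.
  have := @int_norm_ge1 (k - a); rewrite subr_eq0 => /(_ ka); rewrite intrB => A.
  have := ler_normD (k%:~R - alpha_hat alpha w i / alpha w) (alpha_hat alpha w i / alpha w - a%:~R).
  have -> : k%:~R - alpha_hat alpha w i / alpha w + (alpha_hat alpha w i / alpha w - a%:~R)
    = k%:~R - a%:~R by ring.
  rewrite (distrC (alpha_hat alpha w i / alpha w) a%:~R); lra.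
have := @xgetPex _ 0 S (ex_intro _ a Sa) a; rewrite -/(gauss_coef alpha w i) => H.
by apply: (le_trans H); rewrite E ler_pM2r.
Qed.

Lemma gauss_ge0 alpha w i : 0 < alpha w -> 0 <= gauss alpha w i.
Proof. by move=> aw; rewrite /gauss divr_ge0 // ltW. Qed.

Lemma gauss_le_half alpha w i : 0 < alpha w -> gauss alpha w i <= 1 / 2.
Proof. by move=> aw; rewrite /gauss ler_pdivrMr // gauss_coefP. Qed.

(** [gauss_orbit] unfolds from the last letter of the word; the induction on Gauss steps consumes
    the first one. *)
Lemma gauss_orbitS alpha word n :
  gauss_orbit alpha word n.+1 =
  gauss_orbit (gauss alpha (word 0%N)) (fun k => word k.+1) n.
Proof. by elim: n => [//|n IH] /=; rewrite -IH. Qed.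

(* The integers [P] and [p i] follow the unit [U] and the generators
   [alpha i * U] through the change of generators performed by the Gauss map. *)
Lemma gauss_small_div_gen n (m : R) alpha word (U E : R) (P : int) (p : 'I_N -> int) :
  0 <= m -> 0 <= U -> (forall i, 0 <= alpha i <= 1) ->
  (forall k, (k < n)%N -> 0 < gauss_orbit alpha word k (word k)) ->
  `|m * U - P%:~R| <= E -> (forall i, `|m * (alpha i * U) - (p i)%:~R| <= E) ->
  (P != 0 \/ exists i, p i != 0) ->
  m * (U * \prod_(k < n) gauss_orbit alpha word k (word k)) <= 1 / 2 ->
  \prod_(k < n) gauss_orbit alpha word k (word k) <= 2 * E * 3 ^+ n.
Proof.
elim: n alpha word U E P p => [|n IH] alpha word U E P p m0 U0 a01 pos HP Hp nz.
  (* With no Gauss step left, [m U] and all [m alpha_i U] lie in [[0, 1 / 2]], at distance at least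
     [1 / 2] from any nonzero integer. *)
  rewrite !big_ord0 expr0 !mulr1 => mU.
  suff : 1 / 2 <= E by lra.
  case: nz => [P0|[i pi0]].
    by apply: (int_far P0 _ HP); rewrite mulr_ge0.
  have /andP[ai0 ai1] := a01 i.
  apply: (int_far pi0 _ (Hp i)); rewrite !mulr_ge0 //=.
  by apply: le_trans mU; rewrite ler_wpM2l // ler_piMl.
pose w := word 0%N; have aw : 0 < alpha w by exact: (pos 0%N).
have E0 : 0 <= E by exact: le_trans HP.
pose c i := gauss_coef alpha w i.
pose d i := (c i)%:~R * alpha w - alpha_hat alpha w i.
pose ph i := if i == w then P else p i.
(* The Gauss map keeps the absolute value of [d i]; the sign makes [p' i] an approximation of
   [m |d i| U]. *)
pose p' i := (if 0 <= d i then 1 else -1) * (c i * p w - ph i).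
pose alpha' := gauss alpha w; pose word' k := word k.+1.
have prodE : \prod_(k < n.+1) gauss_orbit alpha word k (word k) =
    alpha w * \prod_(k < n) gauss_orbit alpha' word' k (word' k).
  rewrite big_ord_recl; congr (_ * _); apply: eq_bigr => i _.
  by rewrite lift0 gauss_orbitS.
rewrite prodE => mU.
have aw1 : alpha w <= 1 by case/andP: (a01 w).
have ahat i : 0 <= alpha_hat alpha w i <= 1.
  by rewrite /alpha_hat; case: eqP => _; rewrite ?ler01 ?lexx.
have hatE i : `|m * (alpha_hat alpha w i * U) - (ph i)%:~R| <= E.
  by rewrite /alpha_hat /ph; case: eqP => _; rewrite ?mul1r.
(* From [|c i| alpha_w <= 1 + alpha_w / 2] and [alpha_w <= 1] the bound would be [5 / 2], rounded up
   to 3. *)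
have cE i : `|(c i)%:~R : R| + 1 <= 3 / alpha w.
  have := gauss_coefP i aw; rewrite -/(c i) => H.
  rewrite ler_pdivlMr // mulrDl mul1r -{1}(gtr0_norm aw) -normrM.
  have := ler_normD ((c i)%:~R * alpha w - alpha_hat alpha w i) (alpha_hat alpha w i).
  have /andP[h0 h1] := ahat i.
  by rewrite subrK (ger0_norm h0); lra.
have i3 : 1 <= 3 / alpha w by rewrite ler_pdivlMr //; lra.
have := @IH alpha' word' (U * alpha w) (3 / alpha w * E) (p w) p' m0.
have -> : 2 * (3 / alpha w * E) * 3 ^+ n = (2 * E * 3 ^+ n.+1) / alpha w.
  by rewrite exprS; ring.
move=> H; rewrite mulrC -ler_pdivlMr //; apply: H.
- by rewrite mulr_ge0 // ltW.
- move=> i; rewrite gauss_ge0 //=; have := gauss_le_half i aw; rewrite /alpha'; lra.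
- move=> k kn; have := pos k.+1 kn; by rewrite gauss_orbitS.
- rewrite (mulrC U); apply: le_trans (Hp w) _.
  by rewrite ler_peMl.
- move=> i.
  have -> : m * (alpha' i * (U * alpha w)) = m * (`|d i| * U).
    by rewrite /alpha' /gauss -/(d i); field; rewrite gt_eqF.
  have -> : `|m * (`|d i| * U) - (p' i)%:~R| = `|(c i)%:~R * (m * (alpha w * U) - (p w)%:~R)
      - (m * (alpha_hat alpha w i * U) - (ph i)%:~R)|.
    rewrite /p' intrM intrB intrM; case: (ger0P (d i)) => di.
      by congr `| _ |; rewrite /d; ring.
    by rewrite -[RHS]normrN; congr `| _ |; rewrite /d; ring.
  apply: le_trans (ler_normB _ _) _; rewrite normrM.
  apply: le_trans (_ : (`|(c i)%:~R| + 1) * E <= _); last by rewrite ler_wpM2r.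
  rewrite mulrDl mul1r; apply: lerD => //.
  by rewrite ler_wpM2l.
(* The change of generators is invertible: if all new integers were 0, then [p w = 0] and every
   [ph i = 0], and these include [P] and the remaining [p j]. *)
- have [pw0|] := eqVneq (p w) 0; last by left.
  right; apply: contrapT => N0.
  have p'0 i : p' i = 0 by apply/eqP/negPn/negP => H; apply: N0; exists i.
  have ph0 i : ph i = 0.
    have := p'0 i; rewrite /p' pw0 mulr0 sub0r => /eqP.
    by rewrite mulf_eq0 oppr_eq0 => /orP[|/eqP//]; case: ifP.
  case: nz => [|[j]].
    by have := ph0 w; rewrite /ph eqxx => ->; rewrite eqxx.
  have := ph0 j; rewrite /ph; case: (eqVneq j w) => [-> _|_ ->]; by rewrite ?pw0 eqxx.
- by move: mU; rewrite (mulrA U).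
Qed.

(** The initial unit is [U = 1], approximated by [P = m] without error, and [m] is nonzero. *)
Lemma gauss_small_div n (m : nat) alpha word (p : 'I_N -> int) e :
  (0 < m)%N -> (forall i, 0 <= alpha i <= 1) ->
  (forall k, (k < n)%N -> 0 < gauss_orbit alpha word k (word k)) ->
  (forall i, `|m%:R * alpha i - (p i)%:~R| <= e) ->
  m%:R * \prod_(k < n) gauss_orbit alpha word k (word k) <= 1 / 2 ->
  \prod_(k < n) gauss_orbit alpha word k (word k) <= 2 * e * 3 ^+ n.
Proof.
move=> m0 a01 pos Hp mU.
apply: (@gauss_small_div_gen n m%:R alpha word 1 e m p) => //.
- by rewrite mulr1 subrr normr0; exact: le_trans (Hp (word 0%N)).
- by move=> i; rewrite mulr1.
- by left; rewrite eqz_nat -lt0n.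
- by rewrite mul1r.
Qed.

End GaussArithmetic.

(** * Davie's counting function *)

Section DavieFunction.
Variables (R : realType) (A : pred nat) (q : R).
Hypothesis q0 : 0 < q.
Hypothesis Aq : forall m, A m -> (0 < m)%N -> q <= m%:R.
Hypothesis Agap : forall m m', A m -> A m' -> (0 < m')%N -> (m' < m)%N -> q <= (m - m')%:R.

Definition last_in (m : nat) : nat := \max_(i < m.+1 | A i) i.

(* Davie's substitute for the number of elements of [A] up to [m]: unlike that
   number it is superadditive, and it still jumps by 1 at the elements of [A]. *)
Definition davie (m : nat) : R :=
  Num.max 0 (Num.max (2 * m%:R / q - 2) (2 * (last_in m)%:R / q - 1)).

Lemma last_in_le m : (last_in m <= m)%N.
Proof. by apply/bigmax_leqP => i _; rewrite -ltnS ltn_ord. Qed.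

Lemma last_in_mono m m' : (m <= m')%N -> (last_in m <= last_in m')%N.
Proof.
move=> mm'; apply/bigmax_leqP => i Ai.
have im : (i < m'.+1)%N by apply: leq_trans (ltn_ord i) _.
exact: (@leq_bigmax_cond _ _ (fun i : 'I__ => i : nat) (Ordinal im)).
Qed.

Lemma last_in_self m : A m -> last_in m = m.
Proof.
move=> Am; apply/eqP; rewrite eqn_leq last_in_le /=.
exact: (@leq_bigmax_cond _ _ (fun i : 'I__ => i : nat) (@Ordinal m.+1 m (leqnn _))).
Qed.

Lemma last_inP m : last_in m = 0%N \/ A (last_in m).
Proof.
have [i Ai|N] := pickP (fun i : 'I_m.+1 => A i); last first.
  by left; rewrite /last_in big_pred0.
right; rewrite /last_in.
have [|j Aj ->//] := @eq_bigmax_cond _ (fun i : 'I_m.+1 => A i) (fun i => i : nat).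
by apply/card_gt0P; exists i.
Qed.

Lemma davie_ge0 m : 0 <= davie m.
Proof. by rewrite /davie le_max lexx. Qed.

Let two_q : 0 < 2 / q. Proof. by rewrite divr_gt0. Qed.

Lemma davie_lub m x : 0 <= x -> 2 * m%:R / q - 2 <= x ->
  2 * (last_in m)%:R / q - 1 <= x -> davie m <= x.
Proof. by move=> x0 x1 x2; rewrite /davie !ge_max x0 x1 x2. Qed.

Lemma davie_ge1 m : 2 * m%:R / q - 2 <= davie m.
Proof. by rewrite /davie le_max le_max lexx orbT. Qed.

Lemma davie_ge2 m : 2 * (last_in m)%:R / q - 1 <= davie m.
Proof. by rewrite /davie le_max le_max lexx !orbT. Qed.

Lemma davie_le m : davie m <= 2 * m%:R / q.
Proof.
have mq : 0 <= 2 * m%:R / q by rewrite divr_ge0 ?mulr_ge0 // ltW.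
have lq : 2 * (last_in m)%:R / q <= 2 * m%:R / q.
  by rewrite ler_pM2r ?invr_gt0 // ler_pM2l // ler_nat last_in_le.
by apply: davie_lub; lra.
Qed.

Lemma davie0 : davie 0 = 0.
Proof.
by apply/eqP; rewrite eq_le davie_ge0 andbT; apply: (le_trans (davie_le 0)); rewrite mulr0 mul0r.
Qed.

Lemma davie_mono m m' : (m <= m')%N -> davie m <= davie m'.
Proof.
move=> mm'.
have h1 : 2 * m%:R / q <= 2 * m'%:R / q by rewrite ler_pM2r ?invr_gt0 // ler_pM2l // ler_nat.
have h2 : 2 * (last_in m)%:R / q <= 2 * (last_in m')%:R / q.
  by rewrite ler_pM2r ?invr_gt0 // ler_pM2l // ler_nat last_in_mono.
have := davie_ge1 m'; have := davie_ge2 m'; have := davie_ge0 m' => g0 g2 g1.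
by apply: davie_lub; lra.
Qed.

(** If one value is 0, monotonicity suffices. A positive value is at most [2 m / q - 1], as
    [last_in m <= m]; two such bounds add up to the expression [2 (m + m') / q - 2] of the
    maximum. *)
Lemma davie_superadd m m' : davie m + davie m' <= davie (m + m').
Proof.
have h : 2 * (m + m')%:R / q = 2 * m%:R / q + 2 * m'%:R / q by rewrite natrD; ring.
have l1 : 2 * (last_in m)%:R / q <= 2 * m%:R / q.
  by rewrite ler_pM2r ?invr_gt0 // ler_pM2l // ler_nat last_in_le.
have l2 : 2 * (last_in m')%:R / q <= 2 * m'%:R / q.
  by rewrite ler_pM2r ?invr_gt0 // ler_pM2l // ler_nat last_in_le.
have M1 := davie_mono (leq_addr m' m); have M2 := davie_mono (leq_addl m m').
have lb := davie_ge1 (m + m').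
have [d1|d1] := leP (davie m) 0.
  by have := davie_ge0 m; lra.
have [d2|d2] := leP (davie m') 0.
  by have := davie_ge0 m'; lra.
have B k : 0 < davie k -> 2 * (last_in k)%:R / q <= 2 * k%:R / q ->
    davie k <= 2 * k%:R / q - 1.
  move=> dk lk; rewrite leNgt; apply/negP => H.
  have K0 : 0 <= 2 * k%:R / q - 1.
    rewrite leNgt; apply/negP => H0.
    by move: dk; rewrite ltNge => /negP; apply; apply: davie_lub; lra.
  by move: H; rewrite ltNge => /negP; apply; apply: davie_lub; lra.
have := B m d1 l1; have := B m' d2 l2; lra.
Qed.

(** At [m + 1] the value is at least [2 (m + 1) / q - 1]. At [m] every expression of the maximum is
    at most [2 (m + 1) / q - 2]: the zero by [Aq], the one with [last_in] by [Agap]. *)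
Lemma davie_step m : A m.+1 -> davie m + 1 <= davie m.+1.
Proof.
move=> Am.
have mq : 2 <= 2 * m.+1%:R / q.
  by rewrite -mulrA ler_peMr // ler_pdivlMr // mul1r Aq.
have D1 : davie m.+1 >= 2 * m.+1%:R / q - 1.
  by have := davie_ge2 m.+1; rewrite last_in_self.
suff : davie m <= 2 * m.+1%:R / q - 2 by lra.
apply: davie_lub; first lra.
  by rewrite lerD2r ler_pM2r ?invr_gt0 // ler_pM2l // ler_nat.
have [->|La] := last_inP m; first by rewrite mulr0 mul0r; lra.
have [L0|L0] := posnP (last_in m); first by rewrite L0 mulr0 mul0r; lra.
have lm : (last_in m < m.+1)%N by rewrite ltnS last_in_le.
have := Agap Am La L0 lm; rewrite natrB ?(ltnW lm) // => G.
have : 2 / q * q <= 2 / q * (m.+1%:R - (last_in m)%:R) by rewrite ler_pM2l.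
rewrite divfK ?gt_eqF //; lra.
Qed.

End DavieFunction.

(** * Distances on the circle and distances to the integers *)

Section CircleDistance.
Variable R : realType.
Local Notation C := (R[i]).
Local Notation nm := (@normc R).
Implicit Types (t x : R).

Lemma cisN t : cis (- t) = (cis t)^-1 :> C.
Proof. by apply: (mulIf (cis_neq0 t)); rewrite -cisD addNr cis0 mulVf // cis_neq0. Qed.

Lemma cisMn t n : cis (n%:R * t) = cis t ^+ n :> C.
Proof.
elim: n => [|n IH]; first by rewrite mul0r cis0 expr0.
by rewrite -natr1 mulrDl mul1r cisD IH exprSr.
Qed.

Lemma cis_2pi_int (p : int) : cis (2 * pi * p%:~R) = 1 :> C.
Proof.
case: p => n; first by rewrite mulrC -pmulrn cisMn cis2pi expr1n.
by rewrite NegzE rmorphN /= mulrN cisN mulrC -pmulrn cisMn cis2pi expr1n invr1.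
Qed.

(** Here [cos >= 1 / 2], as [cos (2 x) >= 0] shows, so [sin x - 3 x / 4] has a derivative of modulus
    at most [1 / 4]. *)
Lemma sin_ge_half t : 0 <= t <= pi / 4 -> t / 2 <= sin t.
Proof.
move=> /andP[t0 t4].
have := @rdiff_bound R (fun x => sin x - 3 / 4 * x) (fun x => cos x - 3 / 4) 0 t (1 / 4) t0.
rewrite sin0 mulr0 !subr0 => H.
suff : `|sin t - 3 / 4 * t| <= 1 / 4 * t by rewrite ler_norml => /andP[? ?]; lra.
apply: H => x /andP[x0 xt].
  apply: rdiff_eqd (rdiffB (is_derive_rdiff (is_derive_sin x)) (rdiffM (rdiff_cst _ _) (rdiff_id x))).
  by rewrite mul0r add0r mulr1.
have c2 : 0 <= cos (x + x) by apply: cos_ge0_pihalf; apply/andP; split; lra.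
have c0 : 0 <= cos x by apply: cos_ge0_pihalf; apply/andP; split; lra.
have c1 := cos_le1 x; have cs := cos2Dsin2 x.
move: c2; rewrite cosD -!expr2 => c2.
have ch : 1 / 2 <= cos x.
  rewrite leNgt; apply/negP => ch.
  have : cos x ^+ 2 <= 1 / 2 * (1 / 2) by rewrite expr2; apply: ler_pM => //; exact: ltW.
  lra.
by rewrite ler_norml; apply/andP; split; lra.
Qed.

(* Halving the angle twice does not increase the distance to 1, and brings
   the angle into a range where the sine dominates half of its argument. *)
Lemma cis_sub1_ge t : `|t| <= pi -> `|t| / 8 <= nm (cis t - 1).
Proof.
move=> tp.
have half s : `|s| <= pi / 2 -> nm (cis s - 1) <= nm (cis (s + s) - 1).
  move=> sp; have -> : cis (s + s) - 1 = (cis s - 1) * (cis s + 1) :> C by rewrite cisD; ring.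
  rewrite nmM ler_peMr ?nm_ge0 //; apply: le_trans (Re_le_nm _).
  rewrite ger0_norm /=; first by rewrite lerDr cos_ge0_pihalf // -ler_norml.
  by rewrite addr_ge0 // cos_ge0_pihalf // -ler_norml.
have A1 := half (t / 2); have A2 := half (t / 4).
rewrite -splitr normrM (ger0_norm (x := 2^-1)) // in A1.
have e4 : t / 4 + t / 4 = t / 2 by lra.
rewrite e4 normrM (ger0_norm (x := 4^-1)) // in A2.
have t0 := normr_ge0 t.
have {}A1 : nm (cis (t / 2) - 1) <= nm (cis t - 1) by apply: A1; lra.
have {}A2 : nm (cis (t / 4) - 1) <= nm (cis (t / 2) - 1) by apply: A2; lra.
apply: le_trans (le_trans A2 A1).
apply: le_trans (Im_le_nm _); rewrite /= subr0.
have -> : `|sin (t / 4)| = `|sin (`|t| / 4)|.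
  by case: (ger0P t) => _ //; rewrite mulNr sinN normrN.
apply: le_trans (ler_norm _).
have -> : `|t| / 8 = (`|t| / 4) / 2 by lra.
by apply: sin_ge_half; rewrite divr_ge0 //=; lra.
Qed.

(** For a nearest integer [p] the angle [2 pi (m a - p)] is at most [pi] in modulus, so
    [cis_sub1_ge] applies; [pi >= 2] brings its factor [2 pi / 8] to at least [1 / 2]. *)
Lemma expi2pi_dist_int (a : R) m : exists p : int,
  `|m%:R * a - p%:~R| <= 2 * nm (expi2pi a ^+ m - 1).
Proof.
have [p Hp] := nearest_int (m%:R * a).
exists p; rewrite distrC in Hp; set x := m%:R * a - p%:~R in Hp *.
have E : cis (2 * pi * x) = expi2pi a ^+ m :> C.
  rewrite -[RHS](cisMn (2 * pi * a)) /x -[RHS]mulr1 -(cis_2pi_int (- p)) -cisD.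
  by congr cis; rewrite rmorphN /=; ring.
have p2 := pi_ge2 R; have p0 : 0 < 2 * pi :> R by exact: pi2_gt0.
have n2 : `|2 * pi * x| = 2 * pi * `|x| by rewrite normrM gtr0_norm.
rewrite -E; have := @cis_sub1_ge (2 * pi * x); rewrite n2 => H.
have {}H : 2 * pi * `|x| / 8 <= nm (cis (2 * pi * x) - 1).
  by apply: H; have := ler_wpM2l (ltW p0) Hp; lra.
have := ler_wpM2r (normr_ge0 x) p2; lra.
Qed.

End CircleDistance.

(** * The Brjuno sum along a word *)

Section BrjunoSum.
Variables (R : realType) (N : nat).
Implicit Types (alpha : 'I_N -> R) (word : nat -> 'I_N).

(** When the selected number is 0, the division by 0 in the Gauss map returns 0, so the bounds
    persist along such an orbit too. *)
Lemma gauss_orbit01 alpha word n i : (forall i, 0 <= alpha i <= 1) ->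
  0 <= gauss_orbit alpha word n i <= 1.
Proof.
move=> a01; elim: n i => [|n IH] i //=.
set a := gauss_orbit alpha word n; set w := word n.
have /andP[aw0 _] := IH w; rewrite -/a in aw0.
move: aw0; rewrite le_eqVlt => /orP[/eqP aw|aw].
  by rewrite /gauss -aw invr0 mulr0 lexx ler01.
rewrite gauss_ge0 //=; have := gauss_le_half i aw; lra.
Qed.

Definition brjuno_term alpha word n : \bar R :=
  ((\prod_(k < n) gauss_orbit alpha word k (word k))%:E
      * lne ((gauss_orbit alpha word n (word n))%:E^-1))%E.

Lemma brjuno_term_ge0 alpha word n : (forall i, 0 <= alpha i <= 1) ->
  (0 <= brjuno_term alpha word n)%E.
Proof.
move=> a01; apply: mule_ge0.
  by rewrite lee_fin prodr_ge0 // => k _; case/andP: (gauss_orbit01 word k (word k) a01).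
have /andP[x0 x1] := gauss_orbit01 word n (word n) a01.
by rewrite lne_ge0 inve_ge1 lee_fin.
Qed.

(** The first vanishing selected number would contribute [+oo]: the product in front of it is still
    positive, and all terms are nonnegative. *)
Lemma brjuno_word_pos alpha word : (forall i, 0 <= alpha i <= 1) ->
  (brjuno_word alpha word < +oo)%E -> forall n, 0 < gauss_orbit alpha word n (word n).
Proof.
move=> a01 fin n; have [m mn] := ubnP n; elim: m n mn => // m IH n; rewrite ltnS => nm.
have /andP[x0 _] := gauss_orbit01 word n (word n) a01.
rewrite lt_neqAle x0 andbT eq_sym; apply/eqP => a0.
have T : brjuno_term alpha word n = +oo%E.
  rewrite /brjuno_term a0 inve0 /= gt0_muley // lte_fin prodr_gt0 // => k _.
  by apply: IH; exact: leq_trans (ltn_ord k) nm.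
have := @nneseries_lim_ge R (brjuno_term alpha word) xpredT 0%N n.+1
  (fun k _ _ => brjuno_term_ge0 word k a01).
rewrite big_nat_recr //= T addey; last first.
  by rewrite -ltNye; apply: lt_le_trans (sume_ge0 _ _) => // k _; exact: brjuno_term_ge0.
rewrite leye_eq => /eqP E.
by move: fin; rewrite /brjuno_word; rewrite [X in (X < _)%E]E ltxx.
Qed.

Lemma brjuno_word_sum alpha word (B : R) M : (forall i, 0 <= alpha i <= 1) ->
  (brjuno_word alpha word <= B%:E)%E ->
  \sum_(n < M) (\prod_(k < n) gauss_orbit alpha word k (word k))
    * - ln (gauss_orbit alpha word n (word n)) <= B.
Proof.
move=> a01 le; have pos := brjuno_word_pos a01 (le_lt_trans le (ltry B)).
rewrite -lee_fin; apply: le_trans le.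
have := @nneseries_lim_ge R (brjuno_term alpha word) xpredT 0%N M
  (fun k _ _ => brjuno_term_ge0 word k a01).
apply: le_trans; rewrite big_mkord -sumEFin; apply: lee_sum => n _.
rewrite /brjuno_term inver gt_eqF //.
by rewrite lne_EFin ?invr_gt0 // lnV ?posrE // EFinM.
Qed.

Lemma brjuno_realize alpha : (forall i, 0 <= alpha i <= 1) -> (brjuno alpha < +oo)%E ->
  0 <= fine (brjuno alpha) /\ exists word, (forall n, 0 < gauss_orbit alpha word n (word n)) /\
    forall M, \sum_(n < M) (\prod_(k < n) gauss_orbit alpha word k (word k))
      * - ln (gauss_orbit alpha word n (word n)) <= fine (brjuno alpha) + 1.
Proof.
move=> a01 fin.
have ge0 : (0 <= brjuno alpha)%E.
  apply: le_ereal_inf_tmp => _ [word _ <-]; apply: nneseries_ge0 => n _ _.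
  exact: brjuno_term_ge0.
have fn : brjuno alpha \is a fin_num by rewrite ge0_fin_numE.
split; first by rewrite fine_ge0.
have : (brjuno alpha < (fine (brjuno alpha) + 1)%:E)%E.
  by rewrite -{1}(fineK fn) lte_fin ltrDl.
move=> /ereal_inf_lt[_ [word _ <-] lt]; exists word; split.
  apply: brjuno_word_pos => //; exact: lt_trans lt (ltry _).
by move=> M; apply: brjuno_word_sum => //; exact: ltW.
Qed.

End BrjunoSum.

(** * Small divisors at all scales *)

Section SmallDivisors.
Variables (R : realType) (N : nat).
Local Notation C := (R[i]).
Local Notation nm := (@normc R).
Variables (alpha : 'I_N -> R) (word : nat -> 'I_N) (B : R).
Hypothesis a01 : forall i, 0 <= alpha i <= 1.
Let a n := gauss_orbit alpha word n (word n).
Let u n := \prod_(k < n) a k.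
Hypothesis apos : forall n, 0 < a n.
Hypothesis Bsum : forall M, \sum_(n < M) u n * - ln (a n) <= B.

Let u_gt0 n : 0 < u n.
Proof. by rewrite prodr_gt0. Qed.

Let uS n : u n.+1 = u n * a n.
Proof. by rewrite /u big_ord_recr. Qed.

Let a_le1 n : a n <= 1.
Proof. by case/andP: (gauss_orbit01 word n (word n) a01). Qed.

(** Every selected number but the first is an output of a Gauss map, hence at most [1 / 2]. *)
Let u_le n : u n <= 2 / 2 ^+ n.
Proof.
case: n => [|n]; first by rewrite /u big_ord0 expr0; lra.
elim: n => [|n IH]; first by rewrite uS /u big_ord0 mul1r expr1 divff ?a_le1.
have ah : a n.+1 <= 1 / 2 by apply: gauss_le_half; exact: apos.
have := ler_pM (ltW (u_gt0 n.+1)) (ltW (apos n.+1)) IH ah.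
rewrite -(uS n.+1) [2 ^+ n.+2]exprS invfM; move: (2 ^+ n.+1)^-1 (u n.+2) => v x; lra.
Qed.

Let u_le1 n : u n <= 1.
Proof. elim: n => [|n IH]; first by rewrite /u big_ord0.
by rewrite uS; apply: mulr_ile1 => //; exact: ltW.
Qed.

(** The threshold of smallness at scale [n]. Divisors all at most [2 theta n] at an order below
    [1 / (2 u n)] would give [u n <= u n / 2] by [near_bound]; the factor 2 is reserved for
    differences of two small orders. *)
Let theta n := u n / (16 * 3 ^+ n).

Let theta_gt0 n : 0 < theta n.
Proof. by rewrite divr_gt0 // mulr_gt0 // exprn_gt0. Qed.

Let theta_le1 n : theta n <= 1.
Proof.
rewrite ler_pdivrMr ?mul1r ?mulr_gt0 ?exprn_gt0 //; apply: le_trans (u_le1 n) _.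
have : 1 <= 3 ^+ n :> R by rewrite exprn_ege1 // ler1n.
lra.
Qed.

Let weight n := - ln (theta n).

Let weight_ge0 n : 0 <= weight n.
Proof. by rewrite oppr_ge0 ln_le0. Qed.

(** Here [weight n.+1 = - ln (u n) - ln (a n) + ln 16 + (n + 1) ln 3]. The part [- ln (a n)] is
    charged to [B]; the others, multiplied by [4 u n], are at most [172 (n + 1) / 2 ^ n], and
    [(n + 1) / 2 ^ n] sums to at most 4. *)
Lemma weight_sum M : \sum_(n < M) 4 * u n * weight n.+1 <= 4 * B + 688.
Proof.
have ln2 : ln (2 : R) <= 2 by rewrite ltW // ln_sublinear.
have ln3 : ln (3 : R) <= 3 by rewrite ltW // ln_sublinear.
have ln16 : ln (16 : R) <= 16 by rewrite ltW // ln_sublinear.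
have term n : 4 * u n * weight n.+1 <= 4 * (u n * - ln (a n)) + 172 * (n.+1%:R / 2 ^+ n).
  have e0 : 0 < (2 ^+ n)^-1 :> R by rewrite invr_gt0 exprn_gt0.
  have -> : weight n.+1 = - ln (u n) - ln (a n) + ln 16 + n.+1%:R * ln 3.
    rewrite /weight /theta uS lnM ?lnV ?posrE ?invr_gt0 ?mulr_gt0 ?exprn_gt0 //.
    rewrite lnM ?posrE // lnM ?posrE ?exprn_gt0 // lnXn // -mulr_natl; ring.
  (* The inequality [ln x <= x - 1] at [x = 2 ^- n / u n]; no lower bound on [u n] is at hand. *)
  have U : u n * - ln (u n) <= n%:R * u n * ln 2 + (2 ^+ n)^-1.
    have H : ln ((2 ^+ n)^-1 / u n) <= (2 ^+ n)^-1 / u n - 1.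
      rewrite -[in leLHS](subrK 1 ((2 ^+ n)^-1 / u n)) addrC; apply: le_ln1Dx.
      by rewrite ltrBrDr addNr divr_gt0.
    have E : ln ((2 ^+ n)^-1 / u n) = - (n%:R * ln 2) - ln (u n).
      by rewrite lnM ?posrE ?invr_gt0 // !lnV ?posrE ?exprn_gt0 // lnXn // mulr_natl.
    rewrite E in H; have := ler_wpM2l (ltW (u_gt0 n)) H.
    have -> : u n * ((2 ^+ n)^-1 / u n - 1) = (2 ^+ n)^-1 - u n.
      by field; rewrite expf_neq0 //= gt_eqF.
    by have := u_gt0 n; lra.
  set v := (2 ^+ n)^-1 in e0 U *.
  have u2 : u n <= 2 * v by exact: u_le.
  have u0 := u_gt0 n.
  have n0 : 0 <= n%:R :> R by [].
  have B1 : n%:R * u n * ln 2 <= n%:R * (2 * v) * 2.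
    apply: ler_pM => //; rewrite ?mulr_ge0 ?(ltW u0) ?ln_ge0 ?ler1n //.
    by rewrite ler_wpM2l.
  have B2 : u n * ln 16 <= 2 * v * 16 by apply: ler_pM; rewrite ?ln_ge0 ?ler1n // ltW.
  have B3 : u n * (n.+1%:R * ln 3) <= 2 * v * (n.+1%:R * 3).
    apply: ler_pM; [exact: ltW|by rewrite mulr_ge0 ?ln_ge0 ?ler1n|by []|].
    by rewrite ler_wpM2l.
  have nv : 0 <= n%:R * v by rewrite mulr_ge0 // ltW.
  have n1 : n.+1%:R = n%:R + 1 :> R by rewrite natr1.
  move: B3; rewrite n1 => B3; lra.
apply: le_trans (_ : \sum_(n < M) (4 * (u n * - ln (a n)) + 172 * (n.+1%:R / 2 ^+ n)) <= _).
  by apply: ler_sum => n _; exact: term.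
rewrite big_split /= -!mulr_sumr; apply: lerD; first by rewrite ler_pM2l // Bsum.
suff E : \sum_(n < M) n.+1%:R / 2 ^+ n = 4 - (M%:R + 2) * 2 / 2 ^+ M :> R.
  rewrite E; have : 0 <= (M%:R + 2) * 2 / 2 ^+ M :> R by rewrite divr_ge0 ?exprn_ge0.
  lra.
elim: M => [|M IH]; first by rewrite big_ord0 expr0; lra.
have n1 k : k.+1%:R = k%:R + 1 :> R by rewrite natr1.
by rewrite big_ord_recr /= IH !n1 exprS; field; rewrite expf_neq0.
Qed.

Let lam j : C := expi2pi (alpha j).

Let close n : pred nat := fun m =>
  (0 < m)%N && [forall j, nm (lam j ^+ m - 1) <= theta n].

Let near_bound m (e : R) k : (0 < m)%N -> (forall j, nm (lam j ^+ m - 1) <= e) ->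
  m%:R * u k <= 1 / 2 -> u k <= 4 * e * 3 ^+ k.
Proof.
move=> m0 H mu.
have ex j : exists p : int, `|m%:R * alpha j - p%:~R| <= 2 * e.
  have [p Hp] := expi2pi_dist_int (alpha j) m; exists p.
  by apply: le_trans Hp _; rewrite ler_pM2l //; exact: H.
have [p Hp] := choice ex.
have := @gauss_small_div R N k m alpha word p (2 * e) m0 a01 (fun k _ => apos k) Hp mu.
by rewrite mulrA -natrM.
Qed.

Let gap_arg m k : (0 < m)%N -> (forall j, nm (lam j ^+ m - 1) <= 2 * theta k) ->
  1 / (2 * u k) <= m%:R.
Proof.
move=> m0 H; rewrite leNgt; apply/negP => mk.
have u0 := u_gt0 k.
have mu : m%:R * u k <= 1 / 2.
  move: mk; rewrite ltr_pdivlMr ?mulr_gt0 //; lra.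
have := near_bound m0 H mu.
have -> : 4 * (2 * theta k) * 3 ^+ k = u k / 2.
  by rewrite /theta; field; rewrite expf_neq0.
lra.
Qed.

Let closeP n m j : close n m -> nm (lam j ^+ m - 1) <= theta n.
Proof. by move=> /andP[_ /forallP]. Qed.

Let close_min n m : close n m -> (0 < m)%N -> 1 / (2 * u n) <= m%:R.
Proof.
move=> cm m0; apply: gap_arg => // j; have := closeP j cm; have := theta_gt0 n; lra.
Qed.

(** Multiplying by the unimodular [lam j ^ m'] shows that the divisor of [m - m'] is at most the sum
    of the two small ones. *)
Let close_gap n m m' : close n m -> close n m' -> (0 < m')%N -> (m' < m)%N ->
  1 / (2 * u n) <= (m - m')%:R.
Proof.
move=> cm cm' m0 mm; apply: gap_arg; first by rewrite subn_gt0.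
move=> j; have := closeP j cm; have := closeP j cm'.
have l1 : nm (lam j) = 1 by exact: nm_cis.
have -> : lam j ^+ m - 1 = (lam j ^+ m' - 1) + lam j ^+ m' * (lam j ^+ (m - m') - 1).
  by rewrite mulrBr -exprD subnKC ?(ltnW mm) //; ring.
move=> A1 A2.
have -> : nm (lam j ^+ (m - m') - 1) = nm (lam j ^+ m' * (lam j ^+ (m - m') - 1)).
  by rewrite nmM nmX l1 expr1n mul1r.
move: A2; set x := lam j ^+ m' - 1 in A1 *; set y := lam j ^+ m' * _ => A2.
have := nm_sub_le y (- x); rewrite opprK nmN (addrC y); lra.
Qed.

Let q_gt0 n : 0 < 1 / (2 * u n).
Proof. by rewrite divr_gt0 // mulr_gt0. Qed.

(** By [davie_le] this is at most [4 m u n], the source of the factor 4 in front of [B]. *)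
Let G n := davie (close n) (1 / (2 * u n)).

(** Scale [k] contributes [weight k.+1] times its Davie function. If [k] is the first scale at which
    [m + 1] is not close, some divisor exceeds [theta k], while [Psi] grows by at least [weight k]:
    from the linear term if [k = 0], from the jump at scale [k - 1] otherwise. The constant is
    [704 = 688 + 16], as [weight 0 = ln 16 <= 16]. *)
Lemma small_divisor_potential n : exists Psi : nat -> R,
  [/\ Psi 0%N = 0, (forall m m', Psi m + Psi m' <= Psi (m + m')%N),
      (forall m, 0 <= Psi m), (forall m, Psi m <= m%:R * (4 * B + 704))
    & forall m, (m < n)%N -> exists j,
        expR (Psi m) <= nm (expi2pi (alpha j) ^+ m.+1 - 1) * expR (Psi m.+1)].
Proof.
(* No order up to [n] is close at scale [M], so [M] scales suffice; [Psi] thus depends on [n], its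
   bound does not. *)
have [M HM] : exists M, 2 * n%:R * (2 / 2 ^+ M) < 1 :> R.
  by have [M HM] := @half_geo_lt R (4 * n%:R) 1 ltr01; exists M; move: HM; lra.
pose Psi m := m%:R * weight 0 + \sum_(k < M) weight k.+1 * G k m.
have G_ge0 k m : 0 <= G k m by exact: davie_ge0.
exists Psi; split.
- rewrite /Psi mul0r add0r big1 // => k _.
  by rewrite /G (davie0 _ (q_gt0 k)) mulr0.
- move=> m m'; rewrite /Psi natrD mulrDl addrACA lerD2l -big_split /=.
  by apply: ler_sum => k _; rewrite -mulrDr ler_wpM2l // davie_superadd.
- move=> m; rewrite /Psi addr_ge0 ?mulr_ge0 // sumr_ge0 // => k _.
  by rewrite mulr_ge0.
- move=> m; have w0 : weight 0 <= 16.
    rewrite /weight /theta /u big_ord0 expr0 mulr1 div1r lnV ?posrE // opprK.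
    by rewrite ltW // ln_sublinear.
  have G_le k : weight k.+1 * G k m <= m%:R * (4 * u k * weight k.+1).
    have := davie_le (close k) (q_gt0 k) m.
    have -> : 2 * m%:R / (1 / (2 * u k)) = 4 * m%:R * u k.
      by field; rewrite gt_eqF.
    by move=> H; have := ler_wpM2l (weight_ge0 k.+1) H; rewrite /G; lra.
  rewrite /Psi; apply: le_trans (_ : m%:R * 16 + m%:R * (4 * B + 688) <= _); last by lra.
  apply: lerD; first by rewrite ler_wpM2l.
  apply: le_trans (_ : \sum_(k < M) m%:R * (4 * u k * weight k.+1) <= _).
    by apply: ler_sum => k _; exact: G_le.
  by rewrite -mulr_sumr ler_wpM2l // weight_sum.
move=> m mn.
have big : ~~ close M m.+1.
  apply/negP => cM; have := close_min cM isT.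
  rewrite ler_pdivrMr ?mulr_gt0 //; apply/negP; rewrite -ltNge.
  apply: le_lt_trans HM.
  rewrite (_ : _ * (2 * u M) = 2 * m.+1%:R * u M); last by ring.
  by apply: ler_pM; rewrite ?mulr_ge0 ?ler_wpM2l ?ler_nat // ltW.
have step k : (k < M)%N -> close k m.+1 -> Psi m + weight k.+1 <= Psi m.+1.
  move=> kM ck; rewrite /Psi -natr1 mulrDl mul1r.
  rewrite (bigD1 (Ordinal kM)) //= [in leRHS](bigD1 (Ordinal kM)) //=.
  have A1 : weight k.+1 * G k m + weight k.+1 <= weight k.+1 * G k m.+1.
    rewrite -{2}[weight k.+1]mulr1 -mulrDr ler_wpM2l //.
    by apply: davie_step => //; [exact: close_min|exact: close_gap].
  have A2 : \sum_(i < M | i != Ordinal kM) weight i.+1 * G i m <=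
            \sum_(i < M | i != Ordinal kM) weight i.+1 * G i m.+1.
    by apply: ler_sum => i _; rewrite ler_wpM2l // davie_mono.
  have := weight_ge0 0; lra.
have step0 : Psi m + weight 0 <= Psi m.+1.
  rewrite /Psi -natr1 mulrDl mul1r addrAC lerD2l.
  by apply: ler_sum => i _; rewrite ler_wpM2l // davie_mono.
have exk : exists k, ~~ close k m.+1 by exists M.
have concl k : ~~ close k m.+1 -> Psi m + weight k <= Psi m.+1 ->
    exists j, expR (Psi m) <= nm (lam j ^+ m.+1 - 1) * expR (Psi m.+1).
  rewrite negb_and /= negb_forall => /existsP[j]; rewrite -ltNge => H P.
  exists j; apply: le_trans (_ : theta k * expR (Psi m.+1) <= _); last first.
    by rewrite ler_wpM2r ?expR_ge0 // ltW.
  rewrite -{1}[theta k]lnK ?posrE // -expRD ler_expR.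
  by move: P; rewrite /weight; lra.
case: (ex_minnP exk) => k ck kmin.
case: k ck kmin => [|k] ck kmin; first exact: (concl 0%N).
apply: (concl k.+1) => //; apply: step.
  by have := kmin M big.
by apply/negPn/negP => /kmin; rewrite ltnn.
Qed.

End SmallDivisors.

(** * Formal linearization *)

Section OrderOfVanishing.
Variable R : realType.
Local Notation C := (R[i]).
Local Notation nm := (@normc R).
Local Notation Cpoly := {poly (complex_complex__canonical__GRing_NzRing R)}.
Implicit Types (f g x y : C -> C) (z w c : C) (p q : Cpoly) (K dl : R).

Lemma bigOP n f K dl : 0 < dl -> (forall z, nm z < dl -> nm (f z) <= K * nm z ^+ n) -> bigO n f.
Proof. by move=> dl0 H; exists K, dl. Qed.

Lemma bigO_pos n f : bigO n f -> exists K dl, [/\ 0 <= K, 0 < dl, dl <= 1 &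
  forall z, nm z < dl -> nm (f z) <= K * nm z ^+ n].
Proof.
move=> [K [dl [dl0 H]]]; exists `|K|, (Num.min dl 1).
rewrite normr_ge0 lt_min dl0 ltr01 ge_min lexx orbT; split=> // z.
rewrite lt_min => /andP[/H {}H _]; apply: (le_trans H).
by rewrite ler_wpM2r ?exprn_ge0 ?nm_ge0 // ler_norm.
Qed.

Lemma bigO_near n f g dl : 0 < dl -> (forall z, nm z < dl -> g z = f z) -> bigO n f -> bigO n g.
Proof.
move=> dl0 E [K [dl' [dl'0 H]]]; apply: (@bigOP _ _ K (Num.min dl dl')).
  by rewrite lt_min dl0.
by move=> z; rewrite lt_min => /andP[/E -> /H].
Qed.

Lemma bigO_ext n f g : (forall z, g z = f z) -> bigO n f -> bigO n g.
Proof. by move=> E; apply: (@bigO_near _ _ _ 1) => // z _; exact: E. Qed.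

Lemma bigOD n f g : bigO n f -> bigO n g -> bigO n (fun z => f z + g z).
Proof.
move=> [K [dl [dl0 H]]] [K' [dl' [dl'0 H']]].
apply: (@bigOP _ _ (K + K') (Num.min dl dl')); first by rewrite lt_min dl0.
move=> z; rewrite lt_min => /andP[/H {}H /H' {}H'].
by apply: le_trans (nmD _ _) _; rewrite mulrDl lerD.
Qed.

Lemma bigOZ n c f : bigO n f -> bigO n (fun z => c * f z).
Proof.
move=> [K [dl [dl0 H]]]; apply: (@bigOP _ _ (nm c * K) dl) => // z /H {}H.
by rewrite nmM -mulrA ler_wpM2l ?nm_ge0.
Qed.

Lemma bigON n f : bigO n f -> bigO n (fun z => - f z).
Proof. by move=> H; apply: bigO_ext (bigOZ (-1) H) => z; rewrite mulN1r. Qed.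

Lemma bigOB n f g : bigO n f -> bigO n g -> bigO n (fun z => f z - g z).
Proof. by move=> Hf Hg; exact: bigOD Hf (bigON Hg). Qed.

Lemma bigO_weak m n f : (m <= n)%N -> bigO n f -> bigO m f.
Proof.
move=> mn /bigO_pos[K [dl [K0 dl0 dl1 H]]]; apply: (@bigOP _ _ K dl) => // z zd.
apply: le_trans (H z zd) _; rewrite ler_wpM2l //.
by apply: ler_wiXn2l; rewrite ?nm_ge0 //; exact: ltW (lt_le_trans zd dl1).
Qed.

Lemma bigO_pow n c : bigO n (fun z => c * z ^+ n).
Proof. by apply: (@bigOP _ _ (nm c) 1) => // z _; rewrite nmM nmX. Qed.

Lemma bigO_rot n c f : nm c = 1 -> bigO n f -> bigO n (fun z => f (c * z)).
Proof.
move=> c1 [K [dl [dl0 H]]]; apply: (@bigOP _ _ K dl) => // z zd.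
by have := H (c * z); rewrite nmM c1 mul1r; apply.
Qed.

Lemma bigO1_small f e : bigO 1 f -> 0 < e -> exists2 dl : R, 0 < dl & forall z, nm z < dl -> nm (f z) < e.
Proof.
move=> /bigO_pos[K [dl [K0 dl0 _ H]]] e0; have K1 : 0 < K + 1 by lra.
exists (Num.min dl (e / (K + 1))); first by rewrite lt_min dl0 divr_gt0.
move=> z; rewrite lt_min => /andP[/H {}H zd]; apply: (le_lt_trans H).
rewrite expr1; have : (K + 1) * nm z < e by rewrite mulrC -ltr_pdivlMr.
by have := nm_ge0 z; lra.
Qed.

Lemma horner_bound p : exists2 K, 0 <= K & forall z, nm z <= 1 -> nm p.[z] <= K.
Proof.
elim/poly_ind: p => [|p c [K K0 H]].
  by exists 0 => // z _; rewrite horner0 nm0.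
exists (K + nm c); first by rewrite addr_ge0 ?nm_ge0.
move=> z z1; rewrite !hornerE; apply: le_trans (nmD _ _) _.
rewrite lerD2r nmM; apply: le_trans (_ : K * 1 <= _); last by rewrite mulr1.
by apply: ler_pM; rewrite ?nm_ge0 ?H.
Qed.

Lemma bigO_poly p n : (forall k, (k < n)%N -> p`_k = 0) -> bigO n (fun z => p.[z]).
Proof.
move=> H; have [K K0 B] := horner_bound (drop_poly n p).
apply: (@bigOP _ _ K 1) => // z /ltW z1.
have -> : p = drop_poly n p * 'X^n.
  rewrite -{1}(poly_take_drop n p) (_ : take_poly n p = 0) ?add0r //.
  by apply/polyP => k; rewrite coef_take_poly coef0; case: ltnP => // /H.
rewrite hornerM hornerXn nmM nmX ler_wpM2r ?exprn_ge0 ?nm_ge0 //.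
exact: B.
Qed.

Lemma bigO_poly_sub p n : (forall k, (k < n)%N -> p`_k = 0) ->
  bigO n.+1 (fun z => p.[z] - p`_n * z ^+ n).
Proof.
move=> H; apply: (@bigO_ext _ (fun z => (p - p`_n *: 'X^n).[z])).
  by move=> z; rewrite !hornerE.
apply: bigO_poly => k; rewrite ltnS coefB coefZ coefXn.
case: (ltngtP k n) => // [kn|->] _; last by rewrite mulr1 subrr.
by rewrite H // sub0r mulr0 oppr0.
Qed.

Lemma bigO_pow_eq0 n c : bigO n.+1 (fun z => c * z ^+ n) -> c = 0.
Proof.
move=> /bigO_pos[K [dl [K0 dl0 dl1 H]]].
apply/eqP; rewrite -nm_eq0 eq_le nm_ge0 andbT; apply: (@le0_eps _ _ K) => e e0.
pose r := Num.min e (dl / 2); have r0 : 0 < r by rewrite lt_min e0 divr_gt0.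
have : r <= r by []; rewrite {2}/r le_min => /andP[re rd].
have := H r%:C%C; rewrite nmM nmX nmR gtr0_norm // => {}H.
have {}H : nm c * r ^+ n <= K * r ^+ n.+1 by apply: H; lra.
rewrite exprSr mulrA (mulrAC K) ler_pM2r ?exprn_gt0 // in H.
by apply: (le_trans H); rewrite mulrC ler_wpM2r.
Qed.

(** Identities of formal power series are stated as orders of vanishing of functions; this turns
    them back into equations between coefficients. *)
Lemma bigO_poly_coef p n : bigO n (fun z => p.[z]) -> forall k, (k < n)%N -> p`_k = 0.
Proof.
move=> H k; have [m] := ubnP k; elim: m k => // m IH k; rewrite ltnS => km kn.
apply: (@bigO_pow_eq0 k).
apply: (@bigO_ext _ (fun z => p.[z] - (p.[z] - p`_k * z ^+ k))); first by move=> z; ring.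
apply: bigOB; first exact: bigO_weak kn H.
by apply: bigO_poly_sub => i ik; apply: IH; [exact: leq_trans ik km|exact: ltn_trans kn].
Qed.

(** On a disk of radius [K |z|] the derivative of [f] is within a multiple of [|z|] of [d]; the mean
    value inequality multiplies this by [|y z|]. *)
Lemma bigO_increment f d rho x y m : 0 < rho ->
  (forall z, nm z < rho -> exists d, cdiff f z d) -> cdiff f 0 d -> (0 < m)%N ->
  bigO 1 x -> bigO m y -> bigO m.+1 (fun z => f (x z + y z) - f (x z) - d * y z).
Proof.
move=> rho0 D Hd m0 /bigO_pos[K1 [d1 [K10 d10 d11 H1]]] /bigO_pos[K2 [d2 [K20 d20 d21 H2]]].
have [df Hdf] := exists_deriv D.
have [|D0 HD0] := @deriv_cdiff R f df 0 rho rho0; first by move=> z; rewrite subr0; exact: Hdf.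
have [dl dl0 Hl] := cdiff_lip HD0.
have df0 : df 0 = d by apply: cdiff_unique (Hdf 0 _) Hd; rewrite nm0.
pose L := nm D0 + 1; have L0 : 0 < L by rewrite ltr_wpDl ?nm_ge0.
pose K := K1 + K2 + 1; have K0 : 0 < K by rewrite /K; lra.
apply: (@bigOP _ _ (L * K * K2) (Num.min (Num.min d1 d2) (Num.min (rho / K) (dl / K)))).
  by rewrite !lt_min d10 d20 !divr_gt0.
move=> z; rewrite !lt_min => /andP[/andP[z1 z2] /andP[z3 z4]].
rewrite ltr_pdivlMr // in z3; rewrite ltr_pdivlMr // in z4.
have {}H1 := H1 z z1; have {}H2 := H2 z z2; rewrite expr1 in H1.
have nz := nm_ge0 z.
have [z0|z0] := eqVneq (nm z) 0.
  have x0 : x z = 0 by apply/eqP; rewrite -nm_eq0 eq_le nm_ge0 andbT; move: H1; rewrite z0 mulr0.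
  have y0 : y z = 0.
    apply/eqP; rewrite -nm_eq0 eq_le nm_ge0 andbT; move: H2.
    by rewrite z0 expr0n (gtn_eqF m0) mulr0.
  by rewrite x0 y0 addr0 subrr mulr0 subrr nm0 !mulr_ge0 ?exprn_ge0 // ltW.
have zp : 0 < nm z by rewrite lt_neqAle eq_sym z0.
have zm : nm z ^+ m <= nm z.
  by rewrite -[leRHS]expr1; apply: ler_wiXn2l => //; lra.
have y1 : nm (y z) <= K2 * nm z by apply: (le_trans H2); rewrite ler_wpM2l.
have xin : nm (x z - 0) < K * nm z.
  have k2 : 0 <= K2 * nm z by rewrite mulr_ge0.
  by rewrite subr0 /K; lra.
have xyin : nm (x z + y z - 0) < K * nm z.
  by rewrite subr0; apply: le_lt_trans (nmD _ _) _; rewrite /K; lra.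
have := @mean_value_ineq R f df 0 d (K * nm z) (L * (K * nm z)) _ _ (x z + y z) (x z) xyin xin.
have -> : x z + y z - x z = y z by ring.
move=> MV; apply: le_trans (MV _ _) _.
- by move=> v; rewrite subr0 => vK; apply: Hdf; lra.
- move=> v vK; rewrite -df0; apply: le_trans (Hl v _) _; first by apply: lt_trans vK _; lra.
  by rewrite -/L ler_pM2l // ltW.
- have : L * (K * nm z) * nm (y z) <= L * (K * nm z) * (K2 * nm z ^+ m).
    by rewrite ler_wpM2l // !mulr_ge0 // ltW.
  move=> A; apply: (le_trans A); rewrite exprS le_eqVlt; apply/orP; left; apply/eqP; ring.
Qed.

End OrderOfVanishing.

(** * The recursion for the coefficients of the linearization *)

Section FormalLinearization.
Variables (R : realType) (N : nat).
Local Notation C := (R[i]).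
Local Notation nm := (@normc R).
Local Notation Cpoly := {poly (complex_complex__canonical__GRing_NzRing R)}.
Variables (f : 'I_N -> C -> C) (lam : 'I_N -> C) (a : 'I_N -> nat -> C) (j0 : 'I_N).
Hypothesis lam1 : forall j, nm (lam j) = 1.
Hypothesis lam_neq : forall j m, lam j ^+ m.+2 - lam j != 0.
Hypothesis f_cdiff : forall j z, nm z < 1 -> exists d, cdiff (f j) z d.
Hypothesis f0 : forall j, f j 0 = 0.
Hypothesis f_lam : forall j, cdiff (f j) 0 (lam j).
Hypothesis f_taylor : forall j n, bigO n (fun z => f j z - psum (a j) n z).
Hypothesis f_comm : forall i j, exists2 dl : R, 0 < dl &
  forall z, nm z < dl -> f i (f j z) = f j (f i z).

(** The coefficient of [z ^ m] in [f_j] composed with [G], when [G] vanishes at 0: Taylor terms of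
    [f_j] beyond [m] do not reach this order. *)
Definition comp_coef j (G : Cpoly) m : C := (\sum_(p < m.+1) a j p *: G ^+ p)`_m.

(** The truncation of the linearization at degree [n + 1]. It is built from the index [j0];
    [lin_coef_mul] shows that its coefficients satisfy the recursion of every index. *)
Fixpoint lin_poly n : Cpoly :=
  if n is n'.+1 then
    lin_poly n' + (comp_coef j0 (lin_poly n') n'.+2 / (lam j0 ^+ n'.+2 - lam j0)) *: 'X^(n'.+2)
  else 'X.

Definition lin_coef n : C :=
  match n with
  | 0%N => 0
  | 1%N => 1
  | n'.+2 => comp_coef j0 (lin_poly n') n'.+2 / (lam j0 ^+ n'.+2 - lam j0)
  end.

Lemma coef_lin_poly n k : (lin_poly n)`_k = if (k < n.+2)%N then lin_coef k else 0.
Proof.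
elim: n => [|n IH] /=; first by rewrite coefX; case: k => [|[|k]].
rewrite coefD IH coefZ coefXn; case: (ltngtP k n.+2) => [kn|kn|->].
- by rewrite ltnS (ltnW kn) mulr0 addr0.
- by rewrite ltnS leqNgt kn mulr0 addr0.
- by rewrite ltnS leqnn add0r mulr1.
Qed.

Let lin_poly0 n : (lin_poly n)`_0 = 0.
Proof. by rewrite coef_lin_poly. Qed.

Let lin_bigO1 n : bigO 1 (fun z => (lin_poly n).[z]).
Proof. by apply: bigO_poly => -[]. Qed.

Let lin_rot n j : bigO 1 (fun z => (lin_poly n).[lam j * z]).
Proof. exact: bigO_rot (lin_bigO1 n). Qed.

Let comp_expand j n m : bigO m.+1 (fun z => f j (lin_poly n).[z] -
   (\sum_(p < m.+1) a j p *: lin_poly n ^+ p).[z]).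
Proof.
have [K [dl [K0 dl0 dl1 H]]] := bigO_pos (f_taylor j m.+1).
have [e e0 He] := bigO1_small (lin_bigO1 n) dl0.
have [K' [dl' [K'0 dl'0 dl'1 H']]] := bigO_pos (lin_bigO1 n).
apply: (@bigOP _ _ _ (K * K' ^+ m.+1) (Num.min e dl')); first by rewrite lt_min e0.
move=> z; rewrite lt_min => /andP[/He /H {}H /H' {}H']; rewrite expr1 in H'.
have -> : (\sum_(p < m.+1) a j p *: lin_poly n ^+ p).[z] = psum (a j) m.+1 (lin_poly n).[z].
  by rewrite horner_sum; apply: eq_bigr => p _; rewrite hornerZ horner_exp.
apply: (le_trans H); rewrite -mulrA ler_wpM2l // -exprMn.
by rewrite ler_pXn2r ?nnegrE ?nm_ge0 // mulr_ge0 // nm_ge0.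
Qed.

Let defect j n := fun z => f j (lin_poly n).[z] - (lin_poly n).[lam j * z].

(** As [lin_poly n] has no term of degree [n + 2], only the composition contributes in that
    degree. *)
Let defect_expand j n : bigO n.+2 (defect j n) ->
  bigO n.+3 (fun z => defect j n z - comp_coef j (lin_poly n) n.+2 * z ^+ n.+2).
Proof.
move=> H; set G := lin_poly n.
pose P := \sum_(p < n.+3) a j p *: G ^+ p - (G \Po (lam j *: 'X)).
have PE z : P.[z] = (\sum_(p < n.+3) a j p *: G ^+ p).[z] - G.[lam j * z].
  by rewrite /P hornerD hornerN horner_comp !hornerE.
have HP : bigO n.+3 (fun z => defect j n z - P.[z]).
  apply: bigO_ext (comp_expand j n n.+2) => z; rewrite PE /defect -/G; ring.
have HP2 : bigO n.+2 (fun z => P.[z]).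
  apply: (@bigO_ext _ _ (fun z => defect j n z - (defect j n z - P.[z]))); first by move=> z; ring.
  by apply: bigOB => //; exact: bigO_weak (leqnSn _) HP.
have Plow := bigO_poly_coef HP2.
have Pm : P`_n.+2 = comp_coef j G n.+2.
  rewrite /P coefB -/(comp_coef j G n.+2).
  suff -> : (G \Po (lam j *: 'X))`_n.+2 = 0 by rewrite subr0.
  rewrite coef_comp_poly big1 // => k _; rewrite exprZn coefZ coefXn.
  case: (eqVneq n.+2 k) => [<-|_]; last by rewrite !mulr0.
  by rewrite /G coef_lin_poly ltnn mul0r.
apply: (@bigO_ext _ _ (fun z => (defect j n z - P.[z]) + (P.[z] - P`_n.+2 * z ^+ n.+2))).
  by move=> z; rewrite Pm /G; ring.
by apply: bigOD => //; exact: bigO_poly_sub.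
Qed.

Let f_increment j x y m : (0 < m)%N -> bigO 1 x -> bigO m y ->
  bigO m.+1 (fun z => f j (x z + y z) - f j (x z) - lam j * y z).
Proof. exact: bigO_increment ltr01 (f_cdiff j) (f_lam j). Qed.

(** Two leading errors enter: the defect of [f_j] multiplied by [lam i], and that of [f_i] evaluated
    at [lam j * z]. *)
Let comm_expand i j n : (forall j, bigO n.+2 (defect j n)) ->
  bigO n.+3 (fun z => f i (f j (lin_poly n).[z]) - (lin_poly n).[lam i * lam j * z]
    - (comp_coef i (lin_poly n) n.+2 * lam j ^+ n.+2
       + lam i * comp_coef j (lin_poly n) n.+2) * z ^+ n.+2).
Proof.
move=> H; set G := lin_poly n; set ci := comp_coef i _ _; set cj := comp_coef j _ _.
have A1 := f_increment i (isT : (0 < n.+2)%N) (lin_rot n j) (H j).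
have A2 := bigO_rot (lam1 j) (defect_expand (H i)).
have A3 := bigOZ (lam i) (defect_expand (H j)).
apply: bigO_ext (bigOD A1 (bigOD A2 A3)) => z.
rewrite /defect -/G -/ci -/cj exprMn -(mulrA (lam i)).
have -> : G.[lam j * z] + (f j G.[z] - G.[lam j * z]) = f j G.[z] by ring.
ring.
Qed.

(** Commutation equates the two expansions of [comm_expand] with [i] and [j] exchanged; this is the
    one place where [f_comm] enters. *)
Let comp_coef_sym i j n : (forall j, bigO n.+2 (defect j n)) ->
  comp_coef i (lin_poly n) n.+2 * (lam j ^+ n.+2 - lam j) =
  comp_coef j (lin_poly n) n.+2 * (lam i ^+ n.+2 - lam i).
Proof.
move=> H; set ci := comp_coef i _ _; set cj := comp_coef j _ _.
have A := comm_expand i j H; have A' := comm_expand j i H.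
have [dl dl0 E] := f_comm i j.
have [e e0 He] := bigO1_small (lin_bigO1 n) dl0.
apply/eqP; rewrite -subr_eq0; apply/eqP; apply: (@bigO_pow_eq0 _ n.+2).
apply: bigO_near e0 _ (bigOB A' A) => z /He ze.
rewrite (E _ ze) -/ci -/cj (mulrC (lam j) (lam i)); ring.
Qed.

(** Adding [b z ^ m] changes the defect by [b (lam_j - lam_j ^ m) z ^ m] up to higher order; by
    [comp_coef_sym] the [b] chosen for [j0] cancels the leading term for every [j]. *)
Lemma lin_poly_bigO j n : bigO n.+2 (fun z => f j (lin_poly n).[z] - (lin_poly n).[lam j * z]).
Proof.
elim: n j => [|n IH] j.
  have := f_increment j (isT : (0 < 1)%N) (@bigO_ext _ 1 (fun z : C => 0 * z ^+ 1) (fun=> 0)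
     (fun z => esym (mul0r _)) (bigO_pow 1 0)) (lin_bigO1 0).
  by apply: bigO_ext => z /=; rewrite add0r f0 subr0 !hornerX.
have S := comp_coef_sym j j0 IH.
set G := lin_poly n in IH S *; set m := n.+2 in IH S *.
set c := comp_coef j G m in S *; set c0 := comp_coef j0 G m in S *.
pose b := c0 / (lam j0 ^+ m - lam j0).
have bc : c = b * (lam j ^+ m - lam j).
  by rewrite /b mulrAC -S mulfK // lam_neq.
have A1 := f_increment j (isT : (0 < m)%N) (lin_bigO1 n) (bigO_pow m b).
have A2 := defect_expand (IH j).
apply: bigO_ext (bigOD A1 A2) => z /=.
rewrite -/G -/c0 -/m -/b !hornerD !hornerZ !hornerXn /defect -/G -/c bc exprMn; ring.
Qed.

Lemma lin_coef_mul j n :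
  lin_coef n.+2 * (lam j ^+ n.+2 - lam j) = comp_coef j (lin_poly n) n.+2.
Proof.
have := comp_coef_sym j j0 (fun j => lin_poly_bigO j n) => S.
by rewrite /lin_coef mulrAC -S mulfK // lam_neq.
Qed.

End FormalLinearization.

(** * Convergence of the linearization *)

Section PolynomialMajorants.
Variable R : realType.
Implicit Types (p q G H : {poly R}) (r : R) (Psi : nat -> R).

Lemma coef_exp_low (K : nzRingType) (p : {poly K}) n k : p`_0 = 0 -> (k < n)%N -> (p ^+ n)`_k = 0.
Proof.
move=> p0; elim: n k => // n IH k kn; rewrite exprS coefM big1 // => -[[|i] ik] _ /=.
  by rewrite p0 mul0r.
rewrite IH ?mulr0 //.
by rewrite ltn_subLR //; apply: leq_trans kn _; rewrite addSn ltnS leq_addl.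
Qed.

Lemma coef_exp_ge0 p n k : (forall k, 0 <= p`_k) -> 0 <= (p ^+ n)`_k.
Proof.
move=> p0; elim: n k => [|n IH] k; first by rewrite expr0 coef1 ler0n.
by rewrite exprS coefM sumr_ge0 // => i _; rewrite mulr_ge0.
Qed.

Lemma coef_exp_le p q n k : (forall k, 0 <= p`_k) -> (forall k, p`_k <= q`_k) ->
  (p ^+ n)`_k <= (q ^+ n)`_k.
Proof.
move=> p0 pq; elim: n k => [|n IH] k; first by rewrite !expr0.
rewrite !exprS !coefM; apply: ler_sum => i _; apply: ler_pM => //.
exact: coef_exp_ge0.
Qed.

(* A superadditive weight on the coefficients passes to powers; each further
   factor shifts the weight by one. *)
Lemma coef_exp_weighted Psi G H n k : Psi 0%N = 0 ->
  (forall m m', Psi m + Psi m' <= Psi (m + m')%N) ->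
  (forall k, 0 <= G`_k) -> (forall k, 0 <= H`_k) -> H`_0 = 0 ->
  (forall k, G`_k <= expR (Psi k.-1) * H`_k) ->
  (G ^+ n)`_k <= expR (Psi (k - n)%N) * (H ^+ n)`_k.
Proof.
move=> P0 Psup G0 H0 H00 GH.
have G00 : G`_0 = 0.
  by apply/eqP; rewrite eq_le G0 andbT; apply: le_trans (GH 0%N) _; rewrite H00 mulr0.
elim: n k => [|n IH] k.
  rewrite !expr0 !coef1 subn0; case: k => [|k] /=; last by rewrite mulr0.
  by rewrite P0 expR0 mul1r.
have [kn|nk] := ltnP k n.+1; first by rewrite !coef_exp_low ?mulr0.
rewrite !exprS !coefM mulr_sumr; apply: ler_sum => -[[|i] ik] _ /=.
  by rewrite G00 H00 !mul0r mulr0.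
have [kin|nki] := ltnP (k - i.+1)%N n; first by rewrite !coef_exp_low ?mulr0.
apply: le_trans (ler_pM _ _ (GH i.+1) (IH _)) _ => //; first exact: coef_exp_ge0.
rewrite /= mulrACA -expRD ler_wpM2r ?mulr_ge0 ?coef_exp_ge0 // ler_expR.
apply: le_trans (Psup _ _) _; rewrite le_eqVlt; apply/orP; left; apply/eqP; congr Psi.
have ki : (i < k)%N by [].
lia.
Qed.

Lemma sum_coef_le_horner p r n : 0 <= r -> (forall k, 0 <= p`_k) ->
  \sum_(k < n) p`_k * r ^+ k <= p.[r].
Proof.
move=> r0 p0; rewrite (@horner_coef_wide _ (maxn n (size p))) ?leq_maxr //.
rewrite -!(big_mkord xpredT (fun k => p`_k * r ^+ k)).
rewrite [leRHS](@big_cat_nat _ _ _ n) ?leq_maxl //= lerDl sumr_ge0 // => k _.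
by rewrite mulr_ge0 ?exprn_ge0.
Qed.

End PolynomialMajorants.

(** * A majorant series free of small divisors *)

Section Majorant.
Variables (R : realType) (b : nat -> R) (Psi : nat -> R) (A Q r : R) (n0 : nat).
Hypothesis A0 : 0 <= A.
Hypothesis Q0 : 0 <= Q.
Hypothesis r0 : 0 < r.
Hypothesis rQ : 2 * r * Q <= 1 / 2.
Hypothesis rAQ : 8 * A * r * Q ^+ 2 <= 1.
Hypothesis Psi0 : Psi 0%N = 0.
Hypothesis Psi_sup : forall m m', Psi m + Psi m' <= Psi (m + m')%N.
Hypothesis Psi_ge0 : forall m, 0 <= Psi m.
Hypothesis b_ge0 : forall k, 0 <= b k.
Hypothesis b0 : b 0%N = 0.
Hypothesis b1 : b 1%N = 1.
Let bp n : {poly R} := \poly_(k < n.+2) b k.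
Hypothesis b_rec : forall n, (n < n0)%N -> exists d : R,
  [/\ expR (Psi n) <= d * expR (Psi n.+1), 0 <= d &
      b n.+2 * d <= A * \sum_(p < n.+1) Q ^+ p.+2 * (bp n ^+ p.+2)`_n.+2].

(** The coefficients with the accumulated inverse divisors taken out; the shift reflects that order
    1 carries none. *)
Let beta k := b k * expR (- Psi k.-1).
Let hp n : {poly R} := \poly_(k < n.+2) beta k.

Let beta_ge0 k : 0 <= beta k.
Proof. by rewrite mulr_ge0 // expR_ge0. Qed.

Let hp_ge0 n k : 0 <= (hp n)`_k.
Proof. by rewrite coef_poly; case: ifP. Qed.

Let Psi_mono m m' : (m <= m')%N -> Psi m <= Psi m'.
Proof.
move=> /subnKC <-; apply: le_trans (Psi_sup _ _); by rewrite lerDl.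
Qed.

(** A product of [p + 2] factors at order [n + 2] has weight [Psi (n - p)], at most [Psi n], and
    [b_rec] trades [expR (Psi n)] for the divisor times [expR (Psi n.+1)]. *)
Let beta_rec n : (n < n0)%N ->
  beta n.+2 <= A * \sum_(p < n.+1) Q ^+ p.+2 * (hp n ^+ p.+2)`_n.+2.
Proof.
move=> nn0; have [d [Hd d0 Hb]] := b_rec nn0.
set S := \sum_(p < n.+1) _.
have S0 : 0 <= S by rewrite sumr_ge0 // => p _; rewrite mulr_ge0 ?exprn_ge0 // coef_exp_ge0.
have B : A * \sum_(p < n.+1) Q ^+ p.+2 * (bp n ^+ p.+2)`_n.+2 <= A * (expR (Psi n) * S).
  rewrite ler_wpM2l // mulr_sumr; apply: ler_sum => p _.
  rewrite mulrCA ler_wpM2l ?exprn_ge0 //.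
  apply: le_trans (coef_exp_weighted (Psi := Psi) (H := hp n) _ _ _ _ _ _ _ _) _ => //.
  - by move=> k; rewrite coef_poly; case: ifP.
  - by rewrite coef_poly /beta /= b0 mul0r.
  - move=> k; rewrite !coef_poly; case: ifP => _; last by rewrite mulr0.
    by rewrite /beta mulrCA -expRD subrr expR0 mulr1.
  - by rewrite ler_wpM2r ?coef_exp_ge0 // ler_expR Psi_mono // leq_subLR !addSn -!addnS leq_addl.
have dp : 0 < d.
  by rewrite -(pmulr_lgt0 _ (expR_gt0 (Psi n.+1))); apply: lt_le_trans Hd; exact: expR_gt0.
have C : b n.+2 * d <= A * S * (d * expR (Psi n.+1)).
  apply: (le_trans Hb); apply: (le_trans B).
  by rewrite mulrA mulrAC ler_wpM2l // mulr_ge0.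
rewrite /beta /= -(ler_pM2r dp) -(ler_pM2r (expR_gt0 (Psi n.+1))).
have -> : b n.+2 * expR (- Psi n.+1) * d * expR (Psi n.+1) = b n.+2 * d.
  by rewrite mulrAC -(mulrA (b _)) -expRD addNr expR0 mulr1.
by rewrite -mulrA.
Qed.

(** The bound reproduces itself: the next value is at most [r] plus [A] times the sum of the
    [(2 r Q) ^ (p + 2)], hence at most [r + 2 A (2 r Q) ^ 2 <= 2 r] by [rQ] and [rAQ]. *)
Lemma majorant_sum n : (n <= n0)%N -> (hp n).[r] <= 2 * r.
Proof.
elim: n => [|n IH] nn0.
  rewrite horner_poly !big_ord_recl big_ord0 /beta /= b0 b1 Psi0 oppr0 expR0 /bump /=.
  by rewrite !mul0r !mul1r add0r addr0 expr1 mulr_natl mulr2n lerDl ltW.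
have {}IH := IH (ltnW nn0).
have hr0 : 0 <= (hp n).[r].
  by apply: le_trans (sum_coef_le_horner 0 (ltW r0) (hp_ge0 n)); rewrite big_ord0.
have beta0 : beta 0 = 0 by rewrite /beta b0 mul0r.
have beta1 : beta 1 = 1 by rewrite /beta b1 /= Psi0 oppr0 expR0 mulr1.
have -> : (hp n.+1).[r] = r + \sum_(k < n.+1) beta k.+2 * r ^+ k.+2.
  rewrite horner_poly big_ord_recl [X in _ + X]big_ord_recl beta0 mul0r add0r.
  by rewrite [lift _ _ : nat]/= beta1 mul1r expr1.
rewrite mulr_natl mulr2n lerD2l.
apply: le_trans (_ : \sum_(k < n.+1) (A * \sum_(p < n.+1) Q ^+ p.+2 * (hp n ^+ p.+2)`_k.+2) * r ^+ k.+2 <= _).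
  apply: ler_sum => k _; rewrite ler_pM2r ?exprn_gt0 //.
  have kn : (k <= n)%N by rewrite -ltnS.
  apply: le_trans (beta_rec (leq_ltn_trans kn nn0)) _; rewrite ler_wpM2l //.
  rewrite -!(big_mkord xpredT (fun p => Q ^+ p.+2 * (hp _ ^+ p.+2)`_k.+2)).
  rewrite [leRHS](@big_cat_nat _ _ _ k.+1) //= -[leLHS]addr0; apply: lerD.
    apply: ler_sum_nat => p _; rewrite ler_wpM2l ?exprn_ge0 //; apply: coef_exp_le => // i.
    rewrite !coef_poly; case: ltnP => ik; last by case: ifP.
    by rewrite (leq_trans ik) // !ltnS.
  by rewrite sumr_ge0 // => p _; rewrite mulr_ge0 ?exprn_ge0 // coef_exp_ge0.
have -> : \sum_(k < n.+1) (A * \sum_(p < n.+1) Q ^+ p.+2 * (hp n ^+ p.+2)`_k.+2) * r ^+ k.+2 =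
    A * \sum_(p < n.+1) Q ^+ p.+2 * \sum_(k < n.+1) (hp n ^+ p.+2)`_k.+2 * r ^+ k.+2.
  rewrite [RHS]mulr_sumr; under [RHS]eq_bigr do rewrite mulrA mulr_sumr.
  rewrite exchange_big /=; apply: eq_bigr => k _.
  by rewrite mulr_sumr mulr_suml; apply: eq_bigr => p _; ring.
apply: le_trans (_ : A * \sum_(p < n.+1) (2 * r * Q) ^+ p.+2 <= _).
  rewrite ler_wpM2l //; apply: ler_sum => p _; rewrite [2 * r * Q]mulrC exprMn.
  rewrite ler_wpM2l ?exprn_ge0 //.
  apply: le_trans (_ : (hp n).[r] ^+ p.+2 <= _); last first.
    by rewrite lerXn2r ?nnegrE // mulr_ge0 // ltW.
  rewrite -horner_exp.
  have hpp k : 0 <= (hp n ^+ p.+2)`_k by exact: coef_exp_ge0.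
  apply: le_trans (sum_coef_le_horner n.+3 (ltW r0) hpp).
  rewrite [leRHS]big_ord_recl [X in _ + X]big_ord_recl /bump /= addrA lerDr.
  by rewrite addr_ge0 // mulr_ge0 ?exprn_ge0 // ltW.
set y := 2 * r * Q; have y0 : 0 <= y by rewrite /y !mulr_ge0 // ltW.
have -> : \sum_(p < n.+1) y ^+ p.+2 = y ^+ 2 * \sum_(p < n.+1) y ^+ p.
  by rewrite mulr_sumr; apply: eq_bigr => p _; rewrite -exprD.
have y1 : 0 <= y < 1 by rewrite y0 /=; move: rQ; rewrite -/y; lra.
have G := geo_sum_le n.+1 y1.
have {}G : \sum_(p < n.+1) y ^+ p <= 2.
  apply: (le_trans G); rewrite -[leRHS]invrK lef_pV2 ?posrE ?invr_gt0 //; move: rQ; rewrite -/y; lra.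
apply: le_trans (_ : A * (y ^+ 2 * 2) <= _).
  by rewrite ler_wpM2l // ler_wpM2l ?exprn_ge0.
have -> : A * (y ^+ 2 * 2) = (8 * A * r * Q ^+ 2) * r by rewrite /y; ring.
by rewrite ler_piMl // ltW.
Qed.

Lemma majorant_coef k : (k < n0.+2)%N -> b k * r ^+ k <= 2 * r * expR (Psi k.-1).
Proof.
move=> kn; have H := majorant_sum (leqnn n0).
have H2 : beta k * r ^+ k <= 2 * r.
  apply: le_trans H; apply: le_trans (sum_coef_le_horner k.+1 (ltW r0) (hp_ge0 n0)).
  rewrite big_ord_recr /= {2}/hp coef_poly kn lerDr sumr_ge0 // => i _.
  by rewrite mulr_ge0 ?exprn_ge0 // ltW.
rewrite -ler_pdivrMr ?expR_gt0 // mulrAC -expRN; exact: H2.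
Qed.

End Majorant.

(** * Summation of the linearizing series *)

Section AnalyticLinearization.
Variable R : realType.
Local Notation C := (R[i]).
Local Notation nm := (@normc R).
Local Notation Cpoly := {poly (complex_complex__canonical__GRing_NzRing R)}.
Implicit Types (z w : C).

Lemma nm_coef_exp (G : Cpoly) (H : {poly R}) n k : (forall k, nm G`_k <= H`_k) ->
  nm (G ^+ n)`_k <= (H ^+ n)`_k.
Proof.
move=> GH; elim: n k => [|n IH] k.
  rewrite !expr0 !coef1; case: (k == 0%N); first by rewrite nm1.
  by rewrite nm0.
rewrite !exprS !coefM; apply: le_trans (nm_sum _ _ _) _; apply: ler_sum => i _.
by rewrite nmM; apply: ler_pM; rewrite ?nm_ge0.
Qed.

Lemma nm_subX z w (x : R) k : nm z <= x -> nm w <= x ->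
  nm (z ^+ k.+1 - w ^+ k.+1) <= k.+1%:R * x ^+ k * nm (z - w).
Proof.
move=> zx wx; have x0 := le_trans (nm_ge0 z) zx.
elim: k => [|k IH]; first by rewrite !expr1 expr0 !mul1r.
have -> : z ^+ k.+2 - w ^+ k.+2 = z * (z ^+ k.+1 - w ^+ k.+1) + (z - w) * w ^+ k.+1.
  by rewrite [z ^+ k.+2]exprS [w ^+ k.+2]exprS; ring.
apply: le_trans (nmD _ _) _; rewrite !nmM nmX.
have A1 : nm z * nm (z ^+ k.+1 - w ^+ k.+1) <= x * (k.+1%:R * x ^+ k * nm (z - w)).
  by apply: ler_pM; rewrite ?nm_ge0.
have A2 : nm (z - w) * nm w ^+ k.+1 <= nm (z - w) * x ^+ k.+1.
  by rewrite ler_wpM2l ?nm_ge0 // lerXn2r ?nnegrE ?nm_ge0.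
have -> : k.+2%:R = k.+1%:R + 1 :> R by rewrite natr1.
rewrite [x ^+ k.+1]exprS in A2 *; lra.
Qed.

(** At radius [x = 1 / (16 Q)] the terms of degree [k + 2] have Lipschitz constants at most
    [2 (k + 2) (Q x) ^ (k + 1)], with sum at most [2 / 7]. Staying within [1 / 2] of the identity
    makes [g] injective with a large image. *)
Lemma series_near_id (b : nat -> C) (g : C -> C) (K Q : R) : 0 < Q -> 0 <= K ->
  b 1%N = 1 -> (forall k, nm (b k.+1) <= 2 * Q ^+ k) ->
  (forall z, Q * nm z < 1 -> forall n,
    nm (g z - psum b n z) <= 2 * K / (1 - Q * nm z) * (Q * nm z) ^+ n) ->
  forall z w, 16 * Q * nm z < 1 -> 16 * Q * nm w < 1 ->
    nm (g z - g w - (z - w)) <= 1 / 2 * nm (z - w).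
Proof.
move=> Q0 K0 b1 Hb G z w zQ wQ.
pose x : R := 1 / (16 * Q).
have x0 : 0 < x by rewrite divr_gt0 // mulr_gt0.
have zx : nm z <= x by rewrite ler_pdivlMr ?mulr_gt0 // mulrC ltW.
have wx : nm w <= x by rewrite ler_pdivlMr ?mulr_gt0 // mulrC ltW.
have Qx : Q * x = 1 / 16 by rewrite /x; field; rewrite gt_eqF.
have P n : nm (psum b n.+2 z - psum b n.+2 w - (z - w)) <= 2 / 7 * nm (z - w).
  have -> : psum b n.+2 z - psum b n.+2 w - (z - w) = \sum_(k < n) b k.+2 * (z ^+ k.+2 - w ^+ k.+2).
    have S v : psum b n.+2 v = b 0%N + v + \sum_(k < n) b k.+2 * v ^+ k.+2.
      rewrite /psum big_ord_recl [X in _ + X]big_ord_recl /= expr0 mulr1.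
      by rewrite expr1 b1 mul1r addrA.
    rewrite !S; under [RHS]eq_bigr do rewrite mulrBr; rewrite sumrB.
    ring.
  apply: le_trans (nm_sum _ _ _) _.
  apply: le_trans (_ : \sum_(k < n) (1 / 4 * (1 / 8) ^+ k) * nm (z - w) <= _).
    apply: ler_sum => k _; rewrite nmM.
    apply: le_trans (_ : 2 * Q ^+ k.+1 * (k.+2%:R * x ^+ k.+1 * nm (z - w)) <= _).
      by apply: ler_pM; rewrite ?nm_ge0 // nm_subX.
    have -> : 2 * Q ^+ k.+1 * (k.+2%:R * x ^+ k.+1 * nm (z - w)) =
       (2 * k.+2%:R * (1 / 16) ^+ k.+1) * nm (z - w) 
      by rewrite -Qx [(Q * x) ^+ _]exprMn; move: (Q ^+ _) (x ^+ _) => y1 y2; ring.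
    rewrite ler_wpM2r ?nm_ge0 //.
    have k2 : k.+2%:R <= 2 * 2 ^+ k :> R.
      by rewrite -exprS -natrX ler_nat ltn_expl.
    have -> : 1 / 8 = 2 * (1 / 16) :> R by lra.
    rewrite [(2 * _) ^+ k]exprMn [(1 / 16) ^+ k.+1]exprS.
    have e0 : 0 <= (1 / 16) ^+ k :> R by rewrite exprn_ge0.
    have := ler_wpM2r e0 k2; lra.
  rewrite -mulr_suml ler_wpM2r ?nm_ge0 // -mulr_sumr.
  have h8 : 0 <= (1 / 8 : R) < 1 by apply/andP; split; lra.
  have := geo_sum_le n h8; have -> : (1 - 1 / 8)^-1 = 8 / 7 :> R by field.
  by lra.
rewrite -subr_le0; apply: (@le0_eps _ _ 2) => e e0.
have lim v : 16 * Q * nm v < 1 -> exists M, forall n, (M <= n)%N -> nm (g v - psum b n v) <= e.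
  move=> vQ; have Qv : 0 <= Q * nm v by rewrite mulr_ge0 ?nm_ge0 // ltW.
  have v1 : Q * nm v < 1 by lra.
  have [||M HM] := @geo_small _ (2 * K / (1 - Q * nm v)) (Q * nm v) e _ e0.
  - by rewrite Qv.
  - by rewrite divr_ge0 ?mulr_ge0 ?subr_ge0 // ltW.
  by exists M => n /HM; apply: le_trans; exact: G.
have [M1 H1] := lim z zQ; have [M2 H2] := lim w wQ.
pose n := maxn M1 M2.
have {}H1 : nm (g z - psum b n.+2 z) <= e by apply: H1; rewrite /n; lia.
have {}H2 : nm (g w - psum b n.+2 w) <= e by apply: H2; rewrite /n; lia.
have -> : g z - g w - (z - w) = (g z - psum b n.+2 z) - (g w - psum b n.+2 w)
  + (psum b n.+2 z - psum b n.+2 w - (z - w)) by ring.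
have := nmD (g z - psum b n.+2 z - (g w - psum b n.+2 w)) (psum b n.+2 z - psum b n.+2 w - (z - w)).
have := nmB (g z - psum b n.+2 z) (g w - psum b n.+2 w).
have := P n; have := nm_ge0 (z - w); lra.
Qed.

Lemma expi2pi_irrational (x : R) m : irrational x -> expi2pi x ^+ m.+1 != 1 :> C.
Proof.
move=> ix; apply/eqP => E; have [p] := expi2pi_dist_int x m.+1.
rewrite E subrr nm0 mulr0 normr_le0 subr_eq0 => /eqP H; apply: ix.
exists (p%:~R / m.+1%:R) => //.
rewrite fmorph_div /= ratr_int ratr_nat -H mulrAC divff ?mul1r //.
Qed.

Section Germs.
Variables (N : nat) (f : 'I_N -> C -> C) (alpha : 'I_N -> R) (K : R) (j0 : 'I_N).
Let lam j : C := expi2pi (alpha j).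
Hypothesis irr : forall j, irrational (alpha j).
Hypothesis f_cdiff : forall j z, nm z < 1 -> exists d, cdiff (f j) z d.
Hypothesis f_inj : forall j z w, nm z < 1 -> nm w < 1 -> f j z = f j w -> z = w.
Hypothesis f0 : forall j, f j 0 = 0.
Hypothesis f_lam : forall j, cdiff (f j) 0 (lam j).
Hypothesis f_comm : forall i j, exists2 dl : R, 0 < dl &
  forall z, nm z < dl -> f i (f j z) = f j (f i z).
Hypothesis K0 : 0 <= K.
(* [expR (Psi m)] dominates every product of inverse small divisors which occurs
   in the coefficient of order [m + 1] of the linearization. *)
Hypothesis potential : forall n, exists Psi : nat -> R,
  [/\ Psi 0%N = 0, (forall m m', Psi m + Psi m' <= Psi (m + m')%N),
      (forall m, 0 <= Psi m), (forall m, Psi m <= m%:R * K)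
    & forall m, (m < n)%N -> exists j,
        expR (Psi m) <= nm (lam j ^+ m.+1 - 1) * expR (Psi m.+1)].

Let lam1 j : nm (lam j) = 1.
Proof. exact: nm_cis. Qed.

Let lam_neq j m : lam j ^+ m.+2 - lam j != 0.
Proof.
rewrite exprS -[X in _ - X]mulr1 -mulrBr mulf_neq0 ?cis_neq0 //.
by rewrite subr_eq0 expi2pi_irrational.
Qed.

Let M : R := univalent_cst R.

Let M1 : 1 <= M.
Proof. by rewrite /M /univalent_cst lerDl expR_ge0. Qed.

Let f_bound j z : nm z < 1 / 8 -> nm (f j z) <= M.
Proof.
exact: (univalent_bound (f_cdiff j) (@f_inj j) (f0 j) (lam1 j) (f_lam j)).
Qed.

(** Cauchy's inequality at radius [1 / 16], within the disk of radius [1 / 8] where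
    [univalent_bound] holds. *)
Let taylor_coefs : exists a : 'I_N -> nat -> C, forall j,
  (forall n, nm (a j n) <= M * 16 ^+ n) /\ forall n, bigO n (fun z => f j z - psum (a j) n z).
Proof.
have ex j : exists a : nat -> C, (forall n, nm (a n) <= M * 16 ^+ n) /\
    forall n, bigO n (fun z => f j z - psum a n z).
  have [a Ha] := taylor ltr01 (f_cdiff j); exists a.
  have r16 : 0 < (1 / 16 : R) < 1 by apply/andP; split; lra.
  have [|B1 B2] := Ha (1 / 16) M r16.
    by move=> z zr; apply: f_bound; rewrite zr; lra.
  split=> n; first by have := B1 n; rewrite div1r exprVn invrK.
  apply: (@bigOP _ _ _ (2 * M * 16 ^+ n) (1 / 32)); first by lra.
  move=> z z32; apply: le_trans (B2 z n _) _; first by lra.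
  have -> : nm z / (1 / 16) = 16 * nm z by rewrite div1r invrK mulrC.
  have q : 1 / 16 / (1 / 16 - nm z) <= 2 by rewrite ler_pdivrMr; lra.
  have A0 : 0 <= 16 ^+ n * nm z ^+ n by rewrite mulr_ge0 ?exprn_ge0 ?nm_ge0.
  have := ler_wpM2l (le_trans ler01 M1) (ler_wpM2l A0 q).
  by rewrite exprMn; move: (1 / 16 / _) (16 ^+ n) => y1 y2; lra.
by have [a Ha] := choice ex; exists a.
Qed.

(** Equality in the condition [rAQ] of the majorant for [A = M] and [Q = 16]:
    [8 M r 16 ^ 2 = 2048 M r]. *)
Definition lin_radius : R := 1 / (2048 * M).

Let M2048 : 0 < 2048 * M.
Proof. by have := M1; lra. Qed.

Lemma lin_radius_gt0 : 0 < lin_radius.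
Proof. by rewrite /lin_radius div1r invr_gt0. Qed.

Let r0 := lin_radius_gt0.

Let rM : 2048 * M * lin_radius = 1.
Proof. by rewrite /lin_radius div1r; exact: mulfV (lt0r_neq0 M2048). Qed.

(** The majorant gives [|b_(k+1)| <= 2 Q ^ k] with [Q = exp K / lin_radius], so the working radius
    is [1 / (16 Q)]. The defect [f_j (g z) - g (lam_j z)] agrees to every order with that of a
    truncation, hence is flat at 0 and vanishes. *)
Theorem analytic_linearization : exists g : C -> C,
  [/\ forall z, nm z < lin_radius / 16 * expR (- K) -> exists d, cdiff g z d,
      g 0 = 0,
      forall z w, nm z < lin_radius / 16 * expR (- K) -> nm w < lin_radius / 16 * expR (- K) ->
        nm (g z - g w - (z - w)) <= 1 / 2 * nm (z - w),
      forall z, nm z < lin_radius / 16 * expR (- K) -> nm (g z) < 1 &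
      forall j z, nm z < lin_radius / 16 * expR (- K) -> f j (g z) = g (lam j * z)].
Proof.
have [a Ha] := taylor_coefs.
have a_le j n : nm (a j n) <= M * 16 ^+ n by have [] := Ha j.
have f_taylor j n : bigO n (fun z => f j z - psum (a j) n z) by have [] := Ha j.
pose b := lin_coef lam a j0.
pose G n := lin_poly lam a j0 n.
pose Q : R := expR K / lin_radius.
have Q0 : 0 < Q by rewrite divr_gt0 // expR_gt0.
have M0 : 0 <= M by exact: le_trans M1.
have b_le k : nm (b k.+1) <= 2 * Q ^+ k.
  have [Psi [P0 Psup Pge0 PK Pd]] := potential k.
  have := @majorant_coef R (fun k => nm (b k)) Psi M 16 lin_radius k M0 _ r0 _ _ P0 Psup Pge0.
  move=> H; have {}H : nm (b k.+1) * lin_radius ^+ k.+1 <= 2 * lin_radius * expR (Psi k).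
    apply: H => //; first by have := ler_wpM2r (ltW r0) M1; move: rM; lra.
    - have -> : 8 * M * lin_radius * 16 ^+ 2 = 2048 * M * lin_radius by ring.
      by rewrite rM.
    - by move=> m; exact: nm_ge0.
    - exact: nm0.
    - exact: nm1.
    move=> n nk; have [j Hj] := Pd n nk.
    exists (nm (lam j ^+ n.+1 - 1)); split; [exact: Hj|exact: nm_ge0|].
    have -> : nm (b n.+2) * nm (lam j ^+ n.+1 - 1) = nm (comp_coef a j (G n) n.+2).
      rewrite -(lin_coef_mul j0 lam1 lam_neq f_cdiff f0 f_lam f_taylor f_comm j n).
      have -> : lam j ^+ n.+2 - lam j = lam j * (lam j ^+ n.+1 - 1) by rewrite exprS; ring.
      by rewrite !nmM lam1 mul1r.
    have GH i : nm (G n)`_i <= (\poly_(k < n.+2) nm (b k))`_i.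
      by rewrite /G coef_lin_poly coef_poly; case: ifP; rewrite ?nm0.
    (* The terms [p = 0] and [p = 1] drop out: neither the constant 1 nor [G n] has a coefficient of
       degree [n + 2]. *)
    rewrite /comp_coef coef_sum big_ord_recl [X in nm (_ + X)]big_ord_recl /=.
    rewrite expr0 coefZ coef1 mulr0 add0r.
    rewrite coefZ expr1 {1}/G coef_lin_poly ltnn mulr0 add0r mulr_sumr.
    apply: le_trans (nm_sum _ _ _) _; apply: ler_sum => p _.
    have -> : bump 0 (bump 0 p) = p.+2 by [].
    rewrite coefZ nmM mulrA; apply: ler_pM; rewrite ?nm_ge0 //.
    exact: nm_coef_exp.
  have rk : 0 < lin_radius ^+ k.+1 by rewrite exprn_gt0.
  rewrite -(ler_pM2r rk); apply: (le_trans H).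
  have -> : 2 * Q ^+ k * lin_radius ^+ k.+1 = 2 * lin_radius * expR K ^+ k.
    by rewrite /Q expr_div_n exprS; field; rewrite expf_neq0 // gt_eqF.
  have r2 : 0 <= 2 * lin_radius by have := r0; lra.
  by apply: ler_wpM2l => //; rewrite -expRM_natl ler_expR PK.
pose K' : R := 2 / Q.
have K'0 : 0 <= K' by rewrite /K' divr_ge0 // ltW.
have b_le' n : nm (b n) <= K' * Q ^+ n.
  case: n => [|n]; first by rewrite nm0 expr0 mulr1.
  by apply: le_trans (b_le n) _; rewrite /K' exprS mulrA divfK // gt_eqF.
have [g Hg] := psum_limit Q0 b_le'.
have xE : lin_radius / 16 * expR (- K) = 1 / (16 * Q).
  by rewrite /Q expRN; field; rewrite !gt_eqF ?expR_gt0.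
have zQ z : nm z < lin_radius / 16 * expR (- K) -> 16 * Q * nm z < 1.
  have Q16 : 0 < 16 * Q by have := Q0; lra.
  by rewrite xE ltr_pdivlMr // mulrC.
have Qnm z : 0 <= Q * nm z by rewrite mulr_ge0 ?nm_ge0 // ltW.
have g_cdiff z : nm z < lin_radius / 16 * expR (- K) -> exists d, cdiff g z d.
  move=> /zQ z1; apply: (psum_limit_cdiff2 Q0 b_le' Hg).
  by have := Qnm z; lra.
have g0 : g 0 = 0.
  have := Hg 0; rewrite nm0 mulr0 => /(_ ltr01 1%N).
  by rewrite /psum big_ord1 mul0r subr0 expr1 mulr0 => H; apply/eqP; rewrite -nm_eq0 eq_le H nm_ge0.
have g_lip z w : nm z < lin_radius / 16 * expR (- K) -> nm w < lin_radius / 16 * expR (- K) ->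
    nm (g z - g w - (z - w)) <= 1 / 2 * nm (z - w).
  move=> /zQ z1 /zQ w1; exact: (series_near_id Q0 K'0 (erefl : b 1%N = 1) b_le Hg z1 w1).
have x0 : 0 < lin_radius / 16 * expR (- K) by rewrite mulr_gt0 ?expR_gt0 // divr_gt0.
have x1 : lin_radius / 16 * expR (- K) <= 1 / 2.
  have e1 : expR (- K) <= 1 by rewrite expR_le1 oppr_le0.
  have l1 : lin_radius / 16 <= 1 / 2 by have := ler_wpM2r (ltW r0) M1; move: rM; lra.
  rewrite -[leRHS]mulr1; apply: ler_pM => //; rewrite ?expR_ge0 //.
  by rewrite divr_ge0 // ltW.
have g_lt1 z : nm z < lin_radius / 16 * expR (- K) -> nm (g z) < 1.
  move=> zx; have := g_lip z 0 zx; rewrite nm0 g0 !subr0 => /(_ x0) H.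
  have := nm_sub_le (g z) z; lra.
have g_bigO n : bigO n.+2 (fun z => g z - (G n).[z]).
  have GE z : (G n).[z] = psum b n.+2 z.
    have sz : (size (G n) <= n.+2)%N.
      by apply/leq_sizeP => k nk; rewrite coef_lin_poly ltnNge nk.
    rewrite (horner_coef_wide _ sz); apply: eq_bigr => k _.
    by rewrite coef_lin_poly ltn_ord.
  apply: (@bigOP _ _ _ (4 * K' * Q ^+ n.+2) (lin_radius / 16 * expR (- K))) => // z zx.
  have z1 := zQ z zx; have q0 := Qnm z; have q1 : Q * nm z < 1 by lra.
  rewrite GE; apply: le_trans (Hg z q1 n.+2) _; rewrite exprMn -[leRHS]mulrA ler_wpM2r //.
    by rewrite mulr_ge0 ?exprn_ge0 ?nm_ge0 // ltW.
  by rewrite ler_pdivrMr ?subr_gt0 //; nra.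
exists g; split=> // j z zx; apply/eqP; rewrite -subr_eq0; apply/eqP.
apply: (@flat_eq0 R (fun z => f j (g z) - g (lam j * z)) (lin_radius / 16 * expR (- K))) => //.
  move=> w wx; have [d1 Hd1] := g_cdiff w wx.
  have [d2 Hd2] := f_cdiff j (g_lt1 w wx).
  have [|d3 Hd3] := g_cdiff (lam j * w); first by rewrite nmM lam1 mul1r.
  eexists; apply: cdiffB (cdiff_comp Hd1 Hd2) (@cdiff_comp _ g (fun w => lam j * w) _ _ _ _ Hd3).
  exact: cdiffZ (cdiff_id w).
move=> n.
have L1 : bigO 1 (fun z => (G n).[z]).
  by apply: bigO_poly => -[|//] _; rewrite coef_lin_poly.
have A1 := bigO_increment ltr01 (f_cdiff j) (f_lam j) (isT : (0 < n.+2)%N) L1 (g_bigO n).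
have A2 := bigOZ (lam j) (g_bigO n).
have A3 := lin_poly_bigO j0 lam1 lam_neq f_cdiff f0 f_lam f_taylor f_comm j n.
have A4 := bigO_rot (lam1 j) (g_bigO n).
have n3 : (n <= n.+3)%N := leqW (leqW (leqnSn n)).
have n2 : (n <= n.+2)%N := leqW (leqnSn n).
apply: bigO_ext (bigOD (bigO_weak n3 A1) (bigO_weak n2 (bigOB (bigOD A2 A3) A4))) => w.
rewrite -/(G n); have -> : (G n).[w] + (g w - (G n).[w]) = g w by ring.
ring.
Qed.

End Germs.

End AnalyticLinearization.

(** * The common Siegel disk *)

Section ComplexDerivatives.
Variable R : realType.
Local Notation C := (R[i]).
Local Notation nm := (@normc R).
Implicit Types (f : cplx R -> cplx R) (z w d : C).

Lemma disk_nm (r : R) z : disk r z = (nm z < r).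
Proof. by rewrite /disk /= nm_norm ltcR. Qed.

Lemma pos_complex z : 0 < z -> exists2 e : R, 0 < e & z = e%:C%C.
Proof.
case: z => x y; rewrite ltcE /= => /andP[/eqP -> x0]; by exists x.
Qed.

Lemma nearP_nm (P : C -> Prop) z :
  (\forall w \near (z : cplx R), P w) <->
  exists2 dl : R, 0 < dl & forall w, nm (w - z) < dl -> P w.
Proof.
split.
  move=> /nbhs_ballP[e /= /pos_complex[dl dl0 ->] H]; exists dl => // w wd.
  by apply: H; rewrite /ball /= distrC nm_norm ltcR.
move=> [dl dl0 H]; apply/nbhs_ballP; exists dl%:C%C => /=; first by rewrite ltcR.
by move=> w; rewrite /ball /= distrC nm_norm ltcR => /H.
Qed.

Lemma is_derive_cdiff f z d : is_derive (z : cplx R) 1 f d -> cdiff f z d.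
Proof.
move=> [D E] e e0.
have cv : (fun h : cplx R => h^-1 *: ((f \o shift (z : cplx R)) (h *: (1 : cplx R)) - f z))
    @ (0 : cplx R)^' --> (d : cplx R).
  by rewrite -E; exact: D.
have e0' : 0 < e%:C%C :> R[i] by rewrite ltcR.
have /cvgrPdist_le/(_ _ e0') := cv.
rewrite near_withinE => /nearP_nm[dl dl0 H].
exists dl => // w wz.
have [->|wz0] := eqVneq w z; first by rewrite !subrr mulr0 subrr nm0 mulr0.
have wz1 : w - z != 0 by rewrite subr_eq0.
have := H (w - z); rewrite subr0 => /(_ wz wz1) A.
have -> : f w - f z - d * (w - z) = - (d - (w - z)^-1 * (f w - f z)) * (w - z).
  by field.
rewrite nmM nmN ler_wpM2r ?nm_ge0 //.
by move: A; rewrite /shift /= /GRing.scale /= mulr1 subrK nm_norm lecR.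
Qed.

Lemma cdiff_is_derive f z d : cdiff f z d -> is_derive (z : cplx R) 1 f d.
Proof.
move=> H.
have cv : (fun h : cplx R => h^-1 *: ((f \o shift (z : cplx R)) (h *: (1 : cplx R)) - f z))
    @ (0 : cplx R)^' --> (d : cplx R).
  apply/cvgrPdist_le => ec /pos_complex[e e0 ->]; have [dl dl0 {}H] := H e e0.
  rewrite near_withinE; apply/nearP_nm; exists dl => // h.
  rewrite subr0 => hd h0.
  have h0' : 0 < nm h by rewrite nm_gt0.
  rewrite /shift /= /GRing.scale /= mulr1 nm_norm lecR.
  have := H (h + z); rewrite addrK => /(_ hd) A.
  rewrite -(ler_pM2r h0') -nmM.
  have -> : (d - h^-1 * (f (h + z) - f z)) * h = - (f (h + z) - f z - d * h).
    by field.
  by rewrite nmN.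
by split; [apply/cvg_ex; exists d | exact/cvg_lim].
Qed.

Lemma derivable_cdiffP f z : derivable f z 1 <-> exists d, cdiff f z d.
Proof.
split=> [/derivableP/is_derive_cdiff H|[d /cdiff_is_derive[]] //].
by exists ('D_1 f z).
Qed.

Lemma derive1_cdiff f z : derivable f z 1 -> cdiff f z (derive1 f z).
Proof. by move=> /derivableP/is_derive_cdiff; rewrite derive1E. Qed.

End ComplexDerivatives.

(** * Maps commuting with a rotation, and local inversion *)

Section LocalTools.
Variable R : realType.
Local Notation C := (R[i]).
Local Notation nm := (@normc R).
Local Notation Cpoly := {poly (complex_complex__canonical__GRing_NzRing R)}.
Implicit Types (f g h : C -> C) (z w v c : C) (rho : R).

Lemma taylor_bigO f rho : 0 < rho -> (forall z, nm z < rho -> exists d, cdiff f z d) ->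
  exists a : nat -> C, forall n, bigO n (fun z => f z - psum a n z).
Proof.
move=> rho0 D; have [a Ha] := taylor rho0 D; exists a => n.
have r2 : 0 < rho / 2 by lra.
have [|M M0 HM] := @circle_bound _ f (rho / 2) r2.
  by move=> z zr; have [|d /cdiff_cont] := D z; first by rewrite zr; lra.
have [|_ B] := Ha (rho / 2) M _ HM; first by apply/andP; split; lra.
apply: (@bigOP _ _ _ (M * ((rho / 2)^-1 ^+ n * 2)) (rho / 4)); first by lra.
move=> z z4; apply: le_trans (B z n _) _; first by lra.
have q : rho / 2 / (rho / 2 - nm z) <= 2 by rewrite ler_pdivrMr; lra.
have A0 : 0 <= nm z ^+ n * (rho / 2)^-1 ^+ n.
  by rewrite mulr_ge0 ?exprn_ge0 ?nm_ge0 // invr_ge0 ltW.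
have := ler_wpM2l M0 (ler_wpM2l A0 q).
by rewrite exprMn; move: (_ / (_ - _)) (_^-1 ^+ n) => y1 y2; lra.
Qed.

(** Comparing Taylor coefficients gives [a k (lam ^ k - lam) = 0], and [lam ^ k = lam] only for
    [k = 1]. *)
Lemma rotation_commuting_linear f lam rho : nm lam = 1 -> (forall m, lam ^+ m.+1 != 1) ->
  (forall z, nm z < rho -> exists d, cdiff f z d) ->
  (forall z, nm z < rho -> f (lam * z) = lam * f z) ->
  exists c, forall z, nm z < rho -> f z = c * z.
Proof.
move=> l1 lam_neq D E; have [rho0|rho0] := lerP rho 0.
  by exists 0 => z /lt_le_trans/(_ rho0); rewrite ltNge nm_ge0.
have [a Ha] := taylor_bigO rho0 D; exists (a 1%N).
have lam0 : lam != 0 by rewrite -nm_gt0 l1.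
have a0 k : k != 1%N -> a k = 0.
  move=> k1.
  pose p : Cpoly := \poly_(i < k.+1) (a i * (lam ^+ i - lam)).
  have pO : bigO k.+1 (fun z => p.[z]).
    apply: (@bigO_near _ _ _ _ rho rho0 _ (bigOB (bigOZ lam (Ha k.+1)) (bigO_rot l1 (Ha k.+1)))).
    move=> z /E ->; rewrite horner_poly /psum.
    have -> : lam * (f z - \sum_(i < k.+1) a i * z ^+ i) - (lam * f z - \sum_(i < k.+1) a i * (lam * z) ^+ i)
      = \sum_(i < k.+1) a i * (lam * z) ^+ i - \sum_(i < k.+1) lam * (a i * z ^+ i).
      by rewrite -mulr_sumr; ring.
    rewrite -sumrB; apply: eq_bigr => i _; rewrite exprMn; ring.
  have := bigO_poly_coef pO (ltnSn k); rewrite coef_poly ltnSn => /eqP.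
  rewrite mulf_eq0 => /orP[/eqP //|].
  rewrite subr_eq0; case: k k1 {p pO} => [_|[//|k] _] /eqP H.
    by have := lam_neq 0%N; rewrite expr1 -H expr0 eqxx.
  have := lam_neq k; rewrite -(inj_eq (mulfI lam0)) -exprS mulr1 H eqxx //.
move=> z zr; apply/eqP; rewrite -subr_eq0; apply/eqP.
apply: (@flat_eq0 R (fun z => f z - a 1%N * z) rho) => // [w wr|n].
  have [d' Hd] := D w wr; exists (d' - a 1%N * 1); exact: cdiffB Hd (cdiffZ _ (cdiff_id w)).
apply: (@bigO_weak _ n n.+2); first exact: leqW (leqnSn n).
apply: bigO_ext (Ha n.+2) => w; rewrite /psum big_ord_recl big_ord_recl /= big1.
  by rewrite (a0 0%N) // mul0r add0r addr0 expr1.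
by move=> i _; rewrite (a0 (bump 0 (bump 0 i))) // mul0r.
Qed.

Lemma local_open g v rho c : 0 < rho -> (forall z, nm (z - v) < rho -> exists d, cdiff g z d) ->
  cdiff g v c -> c != 0 ->
  exists2 dl : R, 0 < dl & forall w, nm (w - g v) < dl -> exists2 z, nm (z - v) < rho & g z = w.
Proof.
move=> rho0 D gc c0; have nc : 0 < nm c by rewrite nm_gt0.
have ex z : exists d, nm (z - v) < rho -> cdiff g z d.
  by have [/D[d' ?]|_] := boolP (nm (z - v) < rho); [exists d'|exists 0].
have [dg Hg] := choice ex.
have dgv : dg v = c by apply: cdiff_unique (Hg v _) gc; rewrite subrr nm0.
have [d Hd] := deriv_cdiff rho0 Hg.
have [|dl dl0 Hdl] := cdiff_cont Hd (e := nm c / 2); first by lra.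
pose r := Num.min rho dl; have r0 : 0 < r by rewrite lt_min rho0.
have sr z : nm (z - v) < r -> nm (z - v) < rho /\ nm (z - v) < dl by rewrite lt_min => /andP.
have L := @mean_value_ineq _ g dg v c r (nm c / 2).
have {}L : forall z w, nm (z - v) < r -> nm (w - v) < r ->
    nm (g z - g w - c * (z - w)) <= nm c / 2 * nm (z - w).
  apply: L => z /sr[z1 z2]; first exact: Hg.
  by have := Hdl z z2; rewrite dgv; exact: ltW.
have := covering r0 c0 L => {}H.
exists (nm c * r / 2); first by rewrite divr_gt0 // mulr_gt0.
by move=> w /H[z /sr[z1 _] <-]; exists z.
Qed.

Lemma inverse_cdiff g h z d dl L : 0 < dl -> (forall w, nm (w - z) < dl -> g (h w) = w) ->
  (forall w, nm (w - z) < dl -> nm (h w - h z) <= L * nm (w - z)) ->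
  d != 0 -> cdiff g (h z) d -> cdiff h z d^-1.
Proof.
move=> dl0 gh hL d0 Hd e e0.
have zz : nm (z - z) < dl by rewrite subrr nm0.
have nd : 0 < nm d by rewrite nm_gt0.
have L1 : 0 < `|L| + 1 by have := normr_ge0 L; lra.
have [dl' dl'0 H] := Hd (e * nm d / (`|L| + 1)) (divr_gt0 (mulr_gt0 e0 nd) L1).
exists (Num.min dl (dl' / (`|L| + 1))); first by rewrite lt_min dl0 divr_gt0.
move=> w; rewrite lt_min => /andP[w1 w2].
have hw : nm (h w - h z) <= (`|L| + 1) * nm (w - z).
  apply: le_trans (hL w w1) _; rewrite ler_wpM2r ?nm_ge0 //.
  by have := ler_norm L; lra.
have := H (h w); rewrite gh // gh // => H1.
have {}H1 : nm (w - z - d * (h w - h z)) <= e * nm d / (`|L| + 1) * nm (h w - h z).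
  by apply: H1; apply: le_lt_trans hw _; rewrite mulrC -ltr_pdivlMr.
have -> : h w - h z - d^-1 * (w - z) = - d^-1 * (w - z - d * (h w - h z)) by field.
rewrite nmM nmN nmV mulrC ler_pdivrMr //; apply: le_trans H1 _.
have -> : e * nm (w - z) * nm d = e * nm d / (`|L| + 1) * ((`|L| + 1) * nm (w - z)).
  by field; rewrite gt_eqF.
by rewrite ler_wpM2l // divr_ge0 ?mulr_ge0 ?nm_ge0 // ltW.
Qed.

End LocalTools.

(** * Inverse charts of linearization domains *)

Section Charts.
Variables (R : realType) (N : nat).
Local Notation C := (R[i]).
Local Notation nm := (@normc R).
Variables (f : 'I_N -> C -> C) (lam : 'I_N -> C) (j0 : 'I_N).
Hypothesis lam1 : forall j, nm (lam j) = 1.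
Hypothesis lam_neq : forall m, lam j0 ^+ m.+1 != 1.
Implicit Types (V : C -> Prop) (g h : C -> C) (z w v c : C) (r : R).

(** A linearization domain seen from the disk that parametrises it by [g]; the invariance of [V] is
    contained in the equation for [f j (g v)]. *)
Definition chart V h g r := [/\ 0 < r, g 0 = 0,
  forall v, nm v < r -> [/\ V (g v), h (g v) = v, exists d, cdiff g v d, nm (g v) < 1
    & forall j, f j (g v) = g (lam j * v)]
  & forall z, V z -> [/\ nm (h z) < r, g (h z) = z & exists d, cdiff h z d]].

(** The chain rule for [h (g w) = w] forbids a zero derivative of [g], so [g] is locally open. *)
Lemma chart_open V h g r : chart V h g r -> forall z, V z ->
  exists2 dl : R, 0 < dl & forall w, nm (w - z) < dl -> V w.
Proof.
move=> [r0 g0 Hg Hh] z Vz; have [hr gh [e He]] := Hh z Vz.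
have [_ hg [c Hc] _ _] := Hg (h z) hr.
have rho0 : 0 < r - nm (h z) by rewrite subr_gt0.
have sub w : nm (w - h z) < r - nm (h z) -> nm w < r.
  by have := nm_sub_le w (h z); lra.
have c0 : c != 0.
  apply/eqP => c0; have := Hc; rewrite c0 => Hc0.
  have He' : cdiff h (g (h z)) e by rewrite gh.
  have := cdiff_comp Hc0 He'; rewrite mulr0 => H0.
  have H1 : cdiff (fun w => h (g w)) (h z) 1.
    by apply: (cdiff_near rho0 _ (cdiff_id _)) => w /sub /Hg[].
  by have := cdiff_unique H0 H1 => /eqP; rewrite eq_sym oner_eq0.
have [|dl dl0 H] := local_open rho0 _ Hc c0.
  by move=> w /sub /Hg[].
exists dl => // w; rewrite -[X in nm (w - X)]gh => /H[u /sub ur <-]; by have [] := Hg u ur.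
Qed.

(** Near 0 the map [h' (g z)] commutes with the rotation by [lam j0], hence is [c * z]; [c = 0]
    would contradict the injectivity of [g]. *)
Lemma chart_agree V h g r V' h' g' r' : chart V h g r -> chart V' h' g' r' ->
  exists c, c != 0 /\ exists2 dl : R, 0 < dl & forall z, nm z < dl -> g z = g' (c * z).
Proof.
move=> ch ch'; have [r0 g0 Hg Hh] := ch; have [r'0 g'0 Hg' Hh'] := ch'.
have V'0 : V' 0 by have [] := Hg' 0; rewrite ?nm0 // g'0.
have [e e0 He] := chart_open ch' V'0.
have [d0 Hd0] : exists d, cdiff g 0 d by have [] := Hg 0; rewrite ?nm0.
have [dl1 dl10 Hdl1] := cdiff_cont Hd0 e0.
pose dl := Num.min dl1 r; have dl0 : 0 < dl by rewrite lt_min dl10.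
have zr z : nm z < dl -> nm z < r by rewrite lt_min => /andP[].
have gV z : nm z < dl -> V' (g z).
  rewrite lt_min => /andP[z1 _]; apply: He.
  by have := Hdl1 z; rewrite g0 !subr0; apply.
have D z : nm z < dl -> exists d, cdiff (fun z => h' (g z)) z d.
  move=> zd; have [_ _ [d1 Hd1] _ _] := Hg z (zr z zd).
  have [_ _ [d2 Hd2]] := Hh' _ (gV z zd).
  by eexists; exact: cdiff_comp Hd1 Hd2.
have E z : nm z < dl -> h' (g (lam j0 * z)) = lam j0 * h' (g z).
  move=> zd; have [_ _ _ _ /(_ j0) <-] := Hg z (zr z zd).
  have [h'r g'h' _] := Hh' _ (gV z zd).
  have [_ _ _ _ /(_ j0) E] := Hg' _ h'r; rewrite g'h' in E; rewrite E.
  by have [] := Hg' (lam j0 * h' (g z)); rewrite ?nmM ?lam1 ?mul1r.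
have [c Hc] := rotation_commuting_linear (lam1 j0) lam_neq D E.
have gE z : nm z < dl -> g z = g' (c * z).
  by move=> zd; rewrite -(Hc z zd); have [_ -> _] := Hh' _ (gV z zd).
exists c; split; last by exists dl.
apply/eqP => c0; pose z : C := (dl / 2)%:C%C.
have nz : nm z = dl / 2 by rewrite nmR ger0_norm // divr_ge0 // ltW.
have zd : nm z < dl by rewrite nz; lra.
have := gE z zd; rewrite c0 mul0r g'0 -g0 => gz.
have [_ A _ _ _] := Hg z (zr z zd); have [|_ A' _ _ _] := Hg 0; first by rewrite nm0.
by have := nz; rewrite -A gz A' nm0; lra.
Qed.

Lemma chart_eq V h g r V' h' g' r' (dl : R) : chart V h g r -> chart V' h' g' r' -> 0 < dl ->
  (forall z, nm z < dl -> g z = g' z) -> forall z, nm z < r -> nm z < r' -> g z = g' z.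
Proof.
move=> [_ _ Hg _] [_ _ Hg' _] dl0 E z zr zr'; apply/eqP; rewrite -subr_eq0; apply/eqP.
apply: (@near_eq0 R (fun z => g z - g' z) (Num.min r r') dl) => //.
- move=> w; rewrite lt_min => /andP[/Hg[_ _ [d Hd] _ _] /Hg'[_ _ [d' Hd'] _ _]].
  by eexists; exact: cdiffB Hd Hd'.
- by move=> w /E ->; rewrite subrr.
- by rewrite lt_min zr.
Qed.

Lemma chart_scale V h g r c : c != 0 -> chart V h g r ->
  chart V (fun z => c^-1 * h z) (fun z => g (c * z)) (r / nm c).
Proof.
move=> c0 [r0 g0 Hg Hh]; have nc : 0 < nm c by rewrite nm_gt0.
split; [exact: divr_gt0|by rewrite mulr0| |].
  move=> v; rewrite ltr_pdivlMr // mulrC -nmM => /Hg[A hg [d Hd] B E]; split=> //.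
  - by rewrite hg mulKf.
  - exists (d * (c * 1)); exact: (@cdiff_comp _ g (fun w => c * w) _ _ _ (cdiffZ c (cdiff_id v)) Hd).
  - by move=> j; rewrite E mulrCA.
move=> z /Hh[hr gh [d Hd]]; split.
- by rewrite nmM nmV mulrC ltr_pM2r ?invr_gt0.
- by rewrite mulrA divff // mul1r.
- by exists (c^-1 * d); exact: cdiffZ.
Qed.

Section Maximal.
Variables (V0 : C -> Prop) (h0 g0 : C -> C) (r0 : R).
Hypothesis ch0 : chart V0 h0 g0 r0.

(* Rescaling makes all inverse charts agree near 0 with the reference one. *)
Let normalized V h g r := chart V h g r /\
  exists2 dl : R, 0 < dl & forall z, nm z < dl -> g z = g0 z.

Let normalize V h g r : chart V h g r -> exists h' g' r', normalized V h' g' r'.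
Proof.
move=> ch; have [c [c0 E]] := chart_agree ch0 ch.
exists (fun z => c^-1 * h z), (fun z => g (c * z)), (r / nm c); split.
  exact: chart_scale.
by have [dl dl0 {}E] := E; exists dl => // z /E ->.
Qed.

Let normalized_eq V h g r V' h' g' r' : normalized V h g r -> normalized V' h' g' r' ->
  forall z, nm z < r -> nm z < r' -> g z = g' z.
Proof.
move=> [ch [dl dl0 E]] [ch' [dl' dl'0 E']].
apply: (chart_eq ch ch' (_ : 0 < Num.min dl dl')); first by rewrite lt_min dl0.
by move=> z; rewrite lt_min => /andP[/E -> /E' ->].
Qed.

Let radii : set R := [set r | exists V h g, normalized V h g r].

Let normalized0 : normalized V0 h0 g0 r0.
Proof. by split=> //; exists 1. Qed.

Let r0_radii : radii r0.
Proof. by exists V0, h0, g0. Qed.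

(** A normalized [g] takes at a fixed [z] the nonzero value [g0 z], while its values stay in the
    unit disk; Cauchy's inequality on a circle of radius [K] then bounds [|g0 z|] by
    [|z| / (K - |z|)]. *)
Let radii_ub : has_ubound radii.
Proof.
have [r00 g00 Hg0 _] := ch0.
pose z : C := (r0 / 2)%:C%C.
have nz : nm z = r0 / 2 by rewrite nmR ger0_norm // divr_ge0 // ltW.
have zr : nm z < r0 by rewrite nz; lra.
have gz : 0 < nm (g0 z).
  rewrite nm_gt0; apply/eqP => gz.
  have [_ A _ _ _] := Hg0 z zr; have [|_ A' _ _ _] := Hg0 0; first by rewrite nm0.
  by have := nz; rewrite -A gz -{1}g00 A' nm0; lra.
pose K := r0 + nm z / nm (g0 z).
have q0 : 0 < nm z / nm (g0 z) by rewrite divr_gt0 // nz; lra.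
exists K => r [V [h [g ng]]]; rewrite leNgt; apply/negP => Kr.
have [[rp g_0 Hg Hh] _] := ng.
have Kr' : 0 < K < r by rewrite Kr andbT /K; lra.
have Dg w : nm (w - 0) < r -> exists d, cdiff g w d by rewrite subr0 => /Hg[].
have Bg w : nm (w - 0) = K -> nm (g w) <= 1.
  by rewrite subr0 => wK; have [|_ _ _ /ltW] := Hg w; rewrite ?wK.
have [|_] := cauchy_ineq Kr' Dg Bg (z := z); first by rewrite subr0 nz /K; lra.
have zr' : nm z < r by apply: lt_trans zr (lt_trans _ Kr); rewrite /K ltrDl.
have -> : g z = g0 z by exact: (normalized_eq ng normalized0).
rewrite g_0 !subr0 mul1r; have Kz : nm z < K - nm z by rewrite nz /K; lra.
have Kz0 : 0 < K - nm z by apply: le_lt_trans Kz; exact: nm_ge0.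
rewrite ler_pdivlMr // leNgt => /negP; apply.
have -> : K - nm z = nm z / nm (g0 z) + nm z by rewrite /K nz; lra.
rewrite mulrDr mulrCA divff ?gt_eqF // mulr1 ltrDl mulr_gt0 // nz; lra.
Qed.

(** Normalized charts coincide on common disks and glue to a map [G] on the disk whose radius is
    their supremum. No chart of that radius is known beforehand: each property of [G] at a point is
    read off a normalized chart reaching beyond it. *)
Theorem maximal_chart : exists U h g r, chart U h g r /\
  forall V h' g' r', chart V h' g' r' -> forall z, V z -> U z.
Proof.
pose r := sup radii.
have rsup : has_sup radii by split; [exists r0|exact: radii_ub].
have le_r V h g s : normalized V h g s -> s <= r.
  by move=> n; apply: ub_le_sup; [exact: radii_ub|exists V, h, g].
have below z : nm z < r -> exists V h g s, normalized V h g s /\ nm z < s.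
  move=> zr; have e0 : 0 < r - nm z by rewrite subr_gt0.
  have [s [V [h [g n]]]] := sup_adherent e0 rsup.
  by rewrite subKr => zs; exists V, h, g, s.
have exG z : exists y, nm z < r -> exists V h g s, [/\ normalized V h g s, nm z < s & y = g z].
  have [/below[V [h [g [s [n zs]]]]]|] := boolP (nm z < r); last by exists 0.
  by exists (g z) => _; exists V, h, g, s.
have [G HG] := choice exG.
have GE V h g s z : normalized V h g s -> nm z < s -> G z = g z.
  move=> n zs; have [|V' [h' [g' [s' [n' zs' ->]]]]] := HG z.
    exact: lt_le_trans zs (le_r _ _ _ _ n).
  exact: normalized_eq n' n _ zs' zs.
pose U (z : C) := exists2 v, nm v < r & G v = z.
have Ginj v w : nm v < r -> nm w < r -> G v = G w -> v = w.
  (* A chart reaching the point of larger modulus contains both points, and is injective. *)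
  wlog vw : v w / nm v <= nm w.
    move=> H vr wr E; have [vw|wv] := leP (nm v) (nm w); first exact: H.
    by apply/esym/H => //; exact: ltW.
  move=> _ /below[V [h [g [s [n ws]]]]].
  have vs := le_lt_trans vw ws; rewrite (GE _ _ _ _ _ n vs) (GE _ _ _ _ _ n ws) => E.
  have [[_ _ Hg _] _] := n.
  by have [_ <- _ _ _] := Hg v vs; rewrite E; have [_ -> _ _ _] := Hg w ws.
have exH z : exists v, U z -> nm v < r /\ G v = z.
  by have [[v vr Gv]|nU] := pselect (U z); [exists v|exists 0].
have [H HH] := choice exH.
have HGv v : nm v < r -> H (G v) = v.
  by move=> vr; have [|a b] := HH (G v); [exists v|exact: Ginj].
have subU V h g s : normalized V h g s -> forall z, V z -> U z /\ H z = h z.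
  move=> n z Vz; have [[_ _ Hg Hh] _] := n; have [hs gh _] := Hh z Vz.
  have hr := lt_le_trans hs (le_r _ _ _ _ n).
  have Gh : G (h z) = z by rewrite (GE _ _ _ _ _ n hs).
  by split; [exists (h z)|rewrite -{1}Gh HGv].
exists U, H, G, r; split; last first.
  by move=> V h' g' r' /normalize[h [g [s n]]] z /(subU _ _ _ _ n)[].
have [r00 g00 _ _] := ch0.
have rp : 0 < r := lt_le_trans r00 (le_r _ _ _ _ normalized0).
split=> //; first by rewrite (GE _ _ _ _ _ normalized0) ?nm0.
- move=> v vr; have [V [h [g [s [n vs]]]]] := below v vr.
  have [[_ _ Hg _] _] := n; have [_ _ [d Hd] g1 E] := Hg v vs.
  have Gv : G v = g v := GE _ _ _ _ _ n vs.
  split; [by exists v|exact: HGv| |by rewrite Gv|].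
    exists d; have vs' : 0 < s - nm v by rewrite subr_gt0.
    apply: (cdiff_near vs' _ Hd) => w wv; apply: (GE _ _ _ _ _ n).
    by have := nm_sub_le w v; lra.
  by move=> j; rewrite Gv E; apply/esym/(GE _ _ _ _ _ n); rewrite nmM lam1 mul1r.
- move=> z Uz; have [Hr GH] := HH z Uz; split=> //.
  have [v vr vz] := Uz; have [V [h [g [s [n vs]]]]] := below v vr.
  have [ch _] := n; have [_ _ Hg Hh] := ch.
  have Vz : V z by rewrite -vz (GE _ _ _ _ _ n vs); have [] := Hg v vs.
  have [dl dl0 Hdl] := chart_open ch Vz.
  have [_ _ [d Hd]] := Hh z Vz.
  by exists d; apply: (cdiff_near dl0 _ Hd) => w /Hdl /(subU _ _ _ _ n)[].
Qed.

End Maximal.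

End Charts.

(** * Translation between charts and linearization domains *)

Section LinearizationDomains.
Variables (R : realType) (N : nat).
Local Notation C := (R[i]).
Local Notation nm := (@normc R).
Variables (f : 'I_N -> cplx R -> cplx R) (alpha : 'I_N -> R).
Let lam j : C := expi2pi (alpha j).
Implicit Types (V : set (cplx R)) (h g : C -> C) (z w v c : C) (r : R).

Let lam1 j : nm (lam j) = 1.
Proof. exact: nm_cis. Qed.

Let lamK j z : lam j * ((lam j)^-1 * z) = z.
Proof. by rewrite mulrA divff ?mul1r // cis_neq0. Qed.

Lemma linearization_domain_chart V : linearization_domain f alpha V ->
  exists h g r, chart f lam V h g r.
Proof.
move=> [_ _ V0 Vsub [fV [h [r [r0 [Dh hV [g [Dg gh]]] h0 E]]]]].
exists h, g, r; split=> //; first by rewrite -h0 gh.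
  move=> v vr; have : disk r v by rewrite disk_nm.
  rewrite -hV => -[z Vz zv]; have gz : g v = z by rewrite -zv gh.
  split; rewrite ?gz //.
  - by apply/derivable_cdiffP/Dg; rewrite disk_nm.
  - by have := Vsub z Vz; rewrite disk_nm.
  move=> j; have Vf : V (f j z) by rewrite -(fV j); exists z.
  by rewrite -(gh _ Vf) E // zv.
move=> z Vz; split; last exact/derivable_cdiffP/Dh.
- by rewrite -disk_nm -hV; exists z.
- exact: gh.
Qed.

(** The images of the radii of the disk cover [V] and all contain 0. *)
Let chart_connected V h g r : chart f lam V h g r -> connected V.
Proof.
move=> [r0 g0 Hg Hh].
pose seg v : set (cplx R) := [set (g (t%:C%C * v) : cplx R) | t in `[0 : R, 1]%classic].
have tv (t : R) v : 0 <= t <= 1 -> nm v < r -> nm (t%:C%C * v) < r.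
  move=> /andP[t0 t1]; apply: le_lt_trans; rewrite nmM nmR ger0_norm //.
  by rewrite -[leRHS]mul1r ler_wpM2r ?nm_ge0.
have -> : V = \bigcup_(v in disk r) seg v.
  apply/seteqP; split=> z.
    move=> /Hh[hr gh _]; exists (h z); first by rewrite disk_nm.
    by exists 1; rewrite ?mul1r //= in_itv /= ler01 lexx.
  move=> [v]; rewrite disk_nm => vr [t /=]; rewrite in_itv /= => t01 <-.
  by have [] := Hg _ (tv t v t01 vr).
apply: bigcup_connected.
  exists (0 : cplx R) => v; rewrite disk_nm => vr.
  by exists 0; rewrite /= ?mul0r //= in_itv /= ler01 lexx.
move=> v; rewrite disk_nm => vr; apply: connected_continuous_connected.
  exact: segment_connected.
apply: continuous_in_subspaceT => t; rewrite inE /= in_itv /= => t01.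
have [_ _ [d Hd] _ _] := Hg _ (tv t v t01 vr).
apply/cvgrPdist_lt => _ /pos_complex[e e0 ->].
have [dl dl0 H] := cdiff_cont Hd e0.
have v1 : 0 < nm v + 1 by have := nm_ge0 v; lra.
apply/nbhs_ballP; exists (dl / (nm v + 1)) => /=; first exact: divr_gt0.
move=> s; rewrite /ball /= distrC ltr_pdivlMr // => ts.
rewrite distrC nm_norm ltcR; apply: H.
rewrite -mulrBl nmM -raddfB nmR; apply: le_lt_trans ts.
by rewrite ler_wpM2l // lerDl.
Qed.

Lemma chart_linearization_domain V h g r : chart f lam V h g r ->
  linearization_domain f alpha V.
Proof.
move=> ch; have [r0 g0 Hg Hh] := ch.
have V0 : V 0 by have [] := Hg 0; rewrite ?nm0 // g0.
have lr j v : nm v < r -> nm (lam j * v) < r by rewrite nmM lam1 mul1r.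
have fE j z : V z -> f j z = g (lam j * h z).
  by move=> /Hh[hr gh _]; have [_ _ _ _ /(_ j)] := Hg _ hr; rewrite gh.
split=> //.
- rewrite openE => z Vz; apply/nearP_nm; exact: chart_open ch z Vz.
- exact: chart_connected ch.
- move=> z /Hh[hr gh _]; rewrite disk_nm.
  by have [_ _ _] := Hg _ hr; rewrite gh.
split.
  move=> j; apply/seteqP; split=> z.
    move=> [w Vw <-]; rewrite fE //; have [hr _ _] := Hh w Vw.
    by have [] := Hg _ (lr j _ hr).
  move=> Vz; have [hr gh _] := Hh z Vz.
  have vr : nm ((lam j)^-1 * h z) < r by rewrite nmM nmV lam1 invr1 mul1r.
  have [Vg hg _ _ E] := Hg _ vr.
  by exists (g ((lam j)^-1 * h z)) => //; rewrite E lamK.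
exists h, r; split=> //.
- split.
  + by move=> z /Hh[_ _ D]; apply/derivable_cdiffP.
  + apply/seteqP; split=> v.
      by move=> [z /Hh[hr _ _] <-]; rewrite disk_nm.
    by rewrite disk_nm => /Hg[Vg hg _ _ _]; exists (g v).
  + exists g; split=> [v|z /Hh[] //].
    by rewrite disk_nm => /Hg[_ _ D _ _]; apply/derivable_cdiffP.
- by have [|_] := Hg 0; rewrite ?nm0 ?g0.
- move=> j z Vz; rewrite fE //; have [hr _ _] := Hh z Vz.
  by have [_ -> _ _ _] := Hg _ (lr j _ hr).
Qed.

Lemma chart_linearizable V h g r : chart f lam V h g r -> simultaneously_linearizable f alpha.
Proof.
move=> ch; have [r0 g0 Hg Hh] := ch.
have V0 : V 0 by have [] := Hg 0; rewrite ?nm0 // g0.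
have [dl dl0 Hdl] := chart_open ch V0.
have nearV : \forall z \near (0 : cplx R), V z /\ nm z < r.
  apply/nearP_nm; exists (Num.min dl r); first by rewrite lt_min dl0.
  by move=> w; rewrite lt_min => /andP[/Hdl wV]; rewrite subr0.
exists h, g; split; last first.
  move=> j; apply: filterS nearV => z [_ zr].
  have [_ _ _ _ ->] := Hg z zr.
  by have [|_ -> _ _ _] := Hg (lam j * z); rewrite ?nmM ?lam1 ?mul1r.
split=> //.
- by have [|_] := Hg 0; rewrite ?nm0 ?g0.
- apply: filterS nearV => z [Vz zr].
  have [_ _ D] := Hh z Vz; have [_ _ D' _ _] := Hg z zr.
  by split; apply/derivable_cdiffP.
- apply: filterS nearV => z [Vz zr].
  by have [_ -> _] := Hh z Vz; have [_ -> _ _ _] := Hg z zr.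
Qed.

(** The estimate gives [|z - w| <= 2 |g z - g w|], hence injectivity and a Lipschitz inverse;
    [covering] with slope 1 puts the disk of radius [x / 2] into the image. *)
Lemma near_id_chart g x : 0 < x ->
  (forall z, nm z < x -> exists d, cdiff g z d) -> g 0 = 0 ->
  (forall z w, nm z < x -> nm w < x -> nm (g z - g w - (z - w)) <= 1 / 2 * nm (z - w)) ->
  (forall z, nm z < x -> nm (g z) < 1) ->
  (forall j z, nm z < x -> f j (g z) = g (lam j * z)) ->
  exists V h, chart f lam V h g x /\ disk (x / 2) `<=` V.
Proof.
move=> x0 D g0 L g1 E.
pose V z := exists2 v, nm v < x & g v = z.
have expand z w : nm z < x -> nm w < x -> nm (z - w) <= 2 * nm (g z - g w).
  move=> zx wx; have := L z w zx wx; have := nm_sub_le (z - w) (g z - g w).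
  by rewrite [nm (z - w - _)]nmBC; lra.
have cover v w : nm v < x -> nm (w - g v) < (x - nm v) / 2 ->
    exists2 z, nm (z - v) < x - nm v & g z = w.
  move=> vx; have r0 : 0 < x - nm v by rewrite subr_gt0.
  have sub z : nm (z - v) < x - nm v -> nm z < x by have := nm_sub_le z v; lra.
  move=> wv; apply: (covering r0 (oner_neq0 C)); rewrite nm1 mul1r //.
  by move=> z z' /sub zx /sub z'x; rewrite !mul1r -[2^-1]mul1r; exact: L.
have exh z : exists v, V z -> nm v < x /\ g v = z.
  by have [[v vx gv]|nV] := pselect (V z); [exists v|exists 0].
have [h Hh] := choice exh.
have hg v : nm v < x -> h (g v) = v.
  move=> vx; have [|a b] := Hh (g v); first by exists v.
  apply/eqP; rewrite -subr_eq0 -nm_eq0 eq_le nm_ge0 andbT.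
  by have := expand _ _ a vx; rewrite b subrr nm0 mulr0.
exists V, h; split.
  split=> //.
    by move=> v vx; split; [exists v|exact: hg|exact: D|exact: g1|by move=> j; exact: E].
  move=> z Vz; have [hx gh] := Hh z Vz; split=> //.
  have [d Hd] := D _ hx; exists d^-1.
  have dl0 : 0 < (x - nm (h z)) / 2 by rewrite divr_gt0 // subr_gt0.
  have Vw w : nm (w - z) < (x - nm (h z)) / 2 -> V w.
    rewrite -{1}gh => /(cover _ _ hx)[u ux <-]; exists u => //.
    by have := nm_sub_le u (h z); lra.
  apply: (inverse_cdiff (g := g) (L := 2) dl0) => //.
  - by move=> w /Vw/Hh[].
  - by move=> w /Vw/Hh[hw ghw]; have := expand _ _ hw hx; rewrite gh ghw.
  (* A zero derivative would make some increment of [g] at most a quarter of the step, whereas it is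
     at least half of it. *)
  apply/eqP => d0; move: Hd; rewrite d0 => /(_ (1 / 4)) H.
  have [|dl dlp {}H] := H; first lra.
  pose s := Num.min dl (x - nm (h z)) / 2.
  have s0 : 0 < s by rewrite divr_gt0 // lt_min dlp subr_gt0.
  have [sdl sx] : s < dl /\ s < x - nm (h z).
    have : Num.min dl (x - nm (h z)) <= dl by rewrite ge_min lexx.
    have : Num.min dl (x - nm (h z)) <= x - nm (h z) by rewrite ge_min lexx orbT.
    by move: s0; rewrite /s; lra.
  pose u := h z + s%:C%C.
  have uE : nm (u - h z) = s by rewrite /u addrC addKr nmR gtr0_norm.
  have ux : nm u < x by have := nm_sub_le u (h z); lra.
  have := H u; rewrite mul0r subr0 uE => /(_ sdl).
  by have := expand u (h z) ux hx; rewrite uE; lra.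
move=> z; rewrite disk_nm => zx.
have [||v vx <-] := cover 0 z; rewrite ?nm0 ?g0 ?subr0 //.
by exists v => //; move: vx; rewrite nm0 !subr0.
Qed.

End LinearizationDomains.

(** * Simultaneous linearization and the size of the common Siegel disk *)

Theorem theorem1p1 (R : realType) :
  exists C : R, 0 < C /\
  forall (N : nat) (alpha : 'I_N -> R) (f : 'I_N -> cplx R -> cplx R),
    (1 <= N)%N ->
    (forall j, 0 < alpha j < 1) ->
    (forall j, irrational (alpha j)) ->
    rationally_independent alpha ->
    (forall j, univalent_on (disk 1) (f j)) ->
    (forall j, f j 0 = 0) ->
    (forall j, derive1 (f j) 0 = expi2pi (alpha j)) ->
    (forall i j, \forall z \near (0 : cplx R), f i (f j z) = f j (f i z)) ->
    (brjuno alpha < +oo)%E ->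
    simultaneously_linearizable f alpha /\
    exists U : set (cplx R), is_common_siegel_disk f alpha U /\
      disk (C * expR (- (2 * pi * fine (brjuno alpha)))) `<=` U.
Proof.
have l0 := lin_radius_gt0 R.
(* The linearization lives on the disk of radius [lin_radius / 16 * exp (- K)], and its image
   contains the disk of half that radius. With the slack 1 of the chosen word,
   [K = 4 (B + 1) + 704 = 4 B + 708]. *)
exists (lin_radius R / 32 * expR (- 708)); split.
  by rewrite mulr_gt0 ?expR_gt0 // divr_gt0.
move=> N alpha f N1 a01 irr _ univ f0 df f_comm fin.
(* One index serves both to define the coefficients of the series and to compare charts. *)
pose j0 := Ordinal N1.
have a01' i : 0 <= alpha i <= 1 by have /andP[/ltW -> /ltW ->] := a01 i.
have [B0 [word [apos Bsum]]] := brjuno_realize a01' fin.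
set B := fine (brjuno alpha) in B0 Bsum *.
have f_cdiff j z : normc z < 1 -> exists d, cdiff (f j) z d.
  by rewrite -disk_nm; have [D _] := univ j => /D/derivable_cdiffP.
have f_inj j z w : normc z < 1 -> normc w < 1 -> f j z = f j w -> z = w.
  rewrite -!disk_nm => zd wd; have [_ I] := univ j; apply: I; exact: mem_set.
have f_lam j : cdiff (f j) 0 (expi2pi (alpha j)).
  rewrite -df; apply: derive1_cdiff; have [D _] := univ j; apply: D.
  by rewrite disk_nm nm0.
have f_comm' i j : exists2 dl : R, 0 < dl &
    forall z, normc z < dl -> f i (f j z) = f j (f i z).
  have /nearP_nm[dl dl0 H] := f_comm i j; exists dl => // z zd.
  by apply: H; rewrite subr0.
have K0 : 0 <= 4 * (B + 1) + 704 by lra.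
have [g [gD g0 gL g1 gE]] := analytic_linearization j0 irr f_cdiff f_inj f0 f_lam f_comm' K0
  (small_divisor_potential a01' apos Bsum).
set x : R := lin_radius R / 16 * expR _ in gD gL g1 gE.
have xp : 0 < x by rewrite mulr_gt0 ?expR_gt0 // divr_gt0.
have [V [h [ch Vsub]]] := near_id_chart xp gD g0 gL g1 gE.
have lam1 j : normc (expi2pi (alpha j)) = 1 by exact: nm_cis.
split; first exact: chart_linearizable ch.
have [U [h' [g' [r [chU maxU]]]]] :=
  maximal_chart lam1 (fun m => expi2pi_irrational m (irr j0)) ch.
exists U; split.
  split; first exact: chart_linearization_domain chU.
  by move=> W /linearization_domain_chart[h2 [g2 [r2 ch2]]] z Wz; exact: maxU ch2 z Wz.
move=> z zd; apply: (maxU _ _ _ _ ch); apply: Vsub.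
move: zd; rewrite !disk_nm => /lt_le_trans; apply.
rewrite -mulrA -expRD /x.
have -> : lin_radius R / 16 * expR (- (4 * (B + 1) + 704)) / 2 =
  lin_radius R / 32 * expR (- (4 * (B + 1) + 704)) by field.
apply: ler_wpM2l; first by rewrite divr_ge0 // ltW.
rewrite ler_expR.
have := ler_wpM2r B0 (pi_ge2 R); lra.
Qed.
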